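(* Let $F=\varinjlim M_{2^k}(\mathbb C)$ (algebraic direct limit, unital embeddings). Up to position there is a unique generic index 4 matroid algebra inclusion $$\zeta : F\oplus F\to F$$ with $H_1(\zeta)=0$. That is, such an inclusion exists, and any two such inclusions are conjugate by a star automorphism of $F$.
   Context: All algebras are complex; direct limits here are algebraic. A matroid algebra is a complex $*$-algebra which is the union of a chain of $*$-subalgebras each of which is a full matrix algebra. 4-cycle algebras. For positive integers $n_1,\dots,n_4$ with $r=\sum n_i$, the 4-cycle algebra with these block sizes is the algebra $A\subseteq M_r(\mathbb C)$ of block matrices $(a_{ij})$, $a_{ij}\in M_{n_i,n_j}(\mathbb C)$, with $a_{ij}=0$ unless $i=j$ or ($i\in\{1,2\}$, $j\in\{3,4\}$). $A(D_4)$ is the case $n_1=\dots=n_4=1$. $Q_1,\dots,Q_4$ denote the block projections. $C^*(A)=M_r(\mathbb C)$. An embedding (injective homomorphism) $\phi:A\to A'$ is star extendible if it extends to a $*$-homomorphism $C^*(A)\to C^*(A')$. A multiplicity one star extendible embedding is rigid of type $\theta$ if $\theta$ is a permutation of $\{1,2,3,4\}$ preserving $\{1,2\}$ and $\{3,4\}$ and $\phi(Q_iAQ_j)\subseteq Q'_{\theta(i)}A'Q'_{\theta(j)}$ for all $i,j$ (four types: $\mathrm{id},(12),(34),(12)(34)$). A rigid embedding is a sum of multiplicity one rigid embeddings with mutually orthogonal ranges; it is generic if all four types occur. $H_1$ of a 4-cycle algebra is $\mathbb Z$, and for $\phi$ rigid $H_1(\phi)$ is multiplication by (number of summands of type $\mathrm{id}$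 or $(12)(34)$) minus (number of type $(12)$ or $(34)$). A generic system is a direct system $(A_k,\alpha_k)$ of 4-cycle algebras with all $\alpha_k$ generic; $A$ denotes its algebraic direct limit, $B$ the self-adjoint algebra generated by $A$ (the limit of the $C^*(A_k)$). An inclusion $\pi:D_1\oplus D_2\to D$ of matroid algebras is a generic index 4 inclusion if it is conjugate by a star isomorphism to an inclusion $A\cap A^*\to B$ of this form; $A$ is then the associated limit algebra, and $H_1(\pi)=H_1(A)=\varinjlim(H_1(A_k),H_1(\alpha_k))$. In the paper $\zeta$ denotes the unital inclusion arising from the stationary system $A_k=A(D_4)\otimes M_{4^k}$ with $\alpha_k$ the unital multiplicity 4 embedding having exactly one summand of each of the four types. Two inclusions $\pi_1,\pi_2:F\oplus F\to F$ have the same position (are conjugate) if a star automorphism of $F$ carries the range of $\pi_1$ onto the range of $\pi_2$. *)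

(* Defs.v *)
From HB Require Import structures.
From mathcomp Require Import all_boot all_order all_algebra perm.
From mathcomp Require Import spectral complex.
From mathcomp Require Import boolp classical_sets reals.

Set Implicit Arguments.
Unset Strict Implicit.
Unset Printing Implicit Defensive.

Import Order.TTheory GRing.Theory Num.Theory.
Local Open Scope ring_scope.
Local Open Scope quotient_scope.
Local Open Scope sesquilinear_scope.
Local Open Scope complex_scope.

(* Complex *-algebras. No unit is required: neither the connecting maps of a
   generic system nor matroid algebras are assumed to be unital. *)

HB.mixin Record Lmodule_isStarAlg (R : realType) V
    of GRing.Lmodule R[i] V := {
  smul : V -> V -> V;
  star : V -> V;
  smulA : associative smul;
  smulDl : left_distributive smul +%R;
  smulDr : right_distributive smul +%R;
  smulZl : forall (c : R[i]) a b, smul (c *: a) b = c *: smul a b;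
  smulZr : forall (c : R[i]) a b, smul a (c *: b) = c *: smul a b;
  starD : {morph star : a b / a + b};
  starZ : forall (c : R[i]) a, star (c *: a) = Num.conj c *: star a;
  starK : involutive star;
  starM : forall a b, star (smul a b) = smul (star b) (star a) }.

#[short(type="starAlgType")]
HB.structure Definition StarAlg (R : realType) :=
  {V of Lmodule_isStarAlg R V & GRing.Lmodule R[i] V}.

HB.mixin Record isStarMorphism (R : realType) (U V : starAlgType R)
    (f : U -> V) := {
  starhomM : {morph f : a b / smul a b};
  starhomS : {morph f : a / star a} }.

#[short(type="starHom")]
HB.structure Definition StarHom (R : realType) (U V : starAlgType R) :=
  {f of isStarMorphism R U V f & @GRing.Linear R[i] U V *:%R f}.

Notation "{ 'starhom' U -> V }" := (starHom U%type V%type)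
  (at level 0, U at level 98, V at level 99) : type_scope.

Section MatrixStarAlg.
Variables (R : realType) (n : nat).
Implicit Types A B : 'M[R[i]]_n.

Fact mx_smulA : associative (fun A B => A *m B).
Proof. exact: mulmxA. Qed.
Fact mx_smulDl : left_distributive (fun A B => A *m B) +%R.
Proof. by move=> A B D; rewrite mulmxDl. Qed.
Fact mx_smulDr : right_distributive (fun A B => A *m B) +%R.
Proof. by move=> A B D; rewrite mulmxDr. Qed.
Fact mx_smulZl (c : R[i]) A B : (c *: A) *m B = c *: (A *m B).
Proof. by rewrite scalemxAl. Qed.
Fact mx_smulZr (c : R[i]) A B : A *m (c *: B) = c *: (A *m B).
Proof. by rewrite scalemxAr. Qed.
Fact mx_starD : {morph (fun A => A ^t*) : A B / A + B}.
Proof. by move=> A B; apply/matrixP => i j; rewrite !mxE rmorphD. Qed.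
Fact mx_starZ (c : R[i]) A : (c *: A) ^t* = Num.conj c *: A ^t*.
Proof. by apply/matrixP => i j; rewrite !mxE rmorphM. Qed.
Fact mx_starK : involutive (fun A => A ^t*).
Proof. by move=> A; rewrite trmxCK. Qed.
Fact mx_starM A B : (A *m B) ^t* = B ^t* *m A ^t*.
Proof. by rewrite trmx_mul map_mxM. Qed.

HB.instance Definition _ := Lmodule_isStarAlg.Build R 'M[R[i]]_n
  mx_smulA mx_smulDl mx_smulDr mx_smulZl mx_smulZr
  mx_starD mx_starZ mx_starK mx_starM.

End MatrixStarAlg.

Section ProdStarAlg.
Variables (R : realType) (D1 D2 : starAlgType R).
Implicit Types a b : (D1 * D2)%type.

Definition prod_smul a b := (smul a.1 b.1, smul a.2 b.2).
Definition prod_star a := (star a.1, star a.2).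

Fact prod_smulA : associative prod_smul.
Proof. by move=> a b c; congr (_, _); rewrite /= smulA. Qed.
Fact prod_smulDl : left_distributive prod_smul +%R.
Proof. by move=> a b c; congr (_, _); rewrite /= smulDl. Qed.
Fact prod_smulDr : right_distributive prod_smul +%R.
Proof. by move=> a b c; congr (_, _); rewrite /= smulDr. Qed.
Fact prod_smulZl (c : R[i]) a b : prod_smul (c *: a) b = c *: prod_smul a b.
Proof. by congr (_, _); rewrite /= smulZl. Qed.
Fact prod_smulZr (c : R[i]) a b : prod_smul a (c *: b) = c *: prod_smul a b.
Proof. by congr (_, _); rewrite /= smulZr. Qed.
Fact prod_starD : {morph prod_star : a b / a + b}.
Proof. by move=> a b; congr (_, _); rewrite /= starD. Qed.
Fact prod_starZ (c : R[i]) a : prod_star (c *: a) = Num.conj c *: prod_star a.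
Proof. by congr (_, _); rewrite /= starZ. Qed.
Fact prod_starK : involutive prod_star.
Proof. by case=> a b; rewrite /prod_star /= !starK. Qed.
Fact prod_starM a b :
  prod_star (prod_smul a b) = prod_smul (prod_star b) (prod_star a).
Proof. by congr (_, _); rewrite /= starM. Qed.

HB.instance Definition _ := Lmodule_isStarAlg.Build R (D1 * D2)%type
  prod_smulA prod_smulDl prod_smulDr prod_smulZl prod_smulZr
  prod_starD prod_starZ prod_starK prod_starM.

End ProdStarAlg.

(* The algebraic direct limit of V 0 -> V 1 -> V 2 -> ... It is realised as
   the sequences (x_k) that satisfy x_(k+1) = f_k x_k for all large k, modulo
   equality for all large k; the class of (x_k) is the common image in the
   limit of the x_k with k large. All operations are then termwise. *)
Section DirectLimit.
Variables (V : nat -> zmodType) (f : forall k, {additive V k -> V k.+1}).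

Record thread := Thread {
  thread_val :> forall k, V k;
  threadP : exists N, forall k, (N <= k)%N ->
              thread_val k.+1 = f k (thread_val k) }.

HB.instance Definition _ := gen_eqMixin thread.
HB.instance Definition _ := gen_choiceMixin thread.

Definition germ_eq : rel thread :=
  fun x y => `[< exists N, forall k, (N <= k)%N -> x k = y k >].

Fact germ_eq_refl : reflexive germ_eq.
Proof. by move=> x; apply/asboolP; exists 0%N. Qed.
Fact germ_eq_sym : symmetric germ_eq.
Proof.
by move=> x y; apply/asboolP/asboolP => -[N xy]; exists N => k /xy.
Qed.
Fact germ_eq_trans : transitive germ_eq.
Proof.
move=> y x z /asboolP[N xy] /asboolP[M yz]; apply/asboolP.
by exists (maxn N M) => k; rewrite geq_max => /andP[/xy-> /yz].
Qed.

Canonical germ_equiv := EquivRel germ_eq germ_eq_refl germ_eq_sym germ_eq_trans.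

Definition dirlim := {eq_quot germ_eq}.

HB.instance Definition _ := Choice.on dirlim.
HB.instance Definition _ := Quotient.on dirlim.
HB.instance Definition _ := EqQuotient.on dirlim.

Lemma dirlim_eqP (x y : thread) :
  \pi_dirlim x = \pi_dirlim y <-> exists N, forall k, (N <= k)%N -> x k = y k.
Proof.
split; first by move=> /eqP; rewrite eqmodE => /asboolP.
by move=> xy; apply/eqP; rewrite eqmodE; apply/asboolP.
Qed.

Fact thread0P : exists N, forall k, (N <= k)%N -> (0 : V k.+1) = f k 0.
Proof. by exists 0%N => k _; rewrite raddf0. Qed.
Definition thread0 := Thread thread0P.

Fact threadNP (x : thread) :
  exists N, forall k, (N <= k)%N -> - x k.+1 = f k (- x k).
Proof. by have [N xN] := threadP x; exists N => k /xN ->; rewrite raddfN. Qed.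
Definition threadN x := Thread (threadNP x).

Fact threadDP (x y : thread) :
  exists N, forall k, (N <= k)%N -> x k.+1 + y k.+1 = f k (x k + y k).
Proof.
have [[N xN] [M yM]] := (threadP x, threadP y).
exists (maxn N M) => k; rewrite geq_max => /andP[/xN-> /yM->].
by rewrite raddfD.
Qed.
Definition threadD x y := Thread (threadDP x y).

Definition dirlim0 : dirlim := \pi_dirlim thread0.
Definition dirlimN (x : dirlim) : dirlim := \pi_dirlim (threadN (repr x)).
Definition dirlimD (x y : dirlim) : dirlim := \pi_dirlim (threadD (repr x) (repr y)).

Lemma dirlim_reprP (x : thread) :
  exists N, forall k, (N <= k)%N -> repr (\pi_dirlim x) k = x k.
Proof. by apply: (dirlim_eqP _ _).1; rewrite reprK. Qed.

Lemma dirlimN_pi x : dirlimN (\pi_dirlim x) = \pi_dirlim (threadN x).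
Proof.
apply/dirlim_eqP; have [N xN] := dirlim_reprP x.
by exists N => k /xN /= ->.
Qed.

Lemma dirlimD_pi x y : dirlimD (\pi_dirlim x) (\pi_dirlim y) = \pi_dirlim (threadD x y).
Proof.
apply/dirlim_eqP; have [[N xN] [M yM]] := (dirlim_reprP x, dirlim_reprP y).
by exists (maxn N M) => k; rewrite geq_max => /andP[/xN/= -> /yM ->].
Qed.

Fact dirlimDA : associative dirlimD.
Proof.
elim/quotW=> x; elim/quotW=> y; elim/quotW=> z.
rewrite (dirlimD_pi y z) (dirlimD_pi x y) !dirlimD_pi.
by apply/dirlim_eqP; exists 0%N => k _ /=; rewrite addrA.
Qed.
Fact dirlimDC : commutative dirlimD.
Proof.
elim/quotW=> x; elim/quotW=> y; rewrite !dirlimD_pi.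
by apply/dirlim_eqP; exists 0%N => k _ /=; rewrite addrC.
Qed.
Fact dirlim0D : left_id dirlim0 dirlimD.
Proof.
elim/quotW=> x; rewrite dirlimD_pi.
by apply/dirlim_eqP; exists 0%N => k _ /=; rewrite add0r.
Qed.
Fact dirlimND : left_inverse dirlim0 dirlimN dirlimD.
Proof.
elim/quotW=> x; rewrite dirlimN_pi dirlimD_pi.
by apply/dirlim_eqP; exists 0%N => k _ /=; rewrite addNr.
Qed.

HB.instance Definition _ :=
  GRing.isZmodule.Build dirlim dirlimDA dirlimDC dirlim0D dirlimND.

Lemma dirlim_addE x y : \pi_dirlim x + \pi_dirlim y = \pi_dirlim (threadD x y).
Proof. exact: dirlimD_pi. Qed.

End DirectLimit.

Section StarDirectLimit.
Variables (R : realType) (A : nat -> starAlgType R).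
Variable f : forall k, {starhom A k -> A k.+1}.

Notation thread := (thread (V := fun k => A k) f).

Definition starlim := dirlim (V := fun k => A k) f.

HB.instance Definition _ := GRing.Zmodule.on starlim.
HB.instance Definition _ := Quotient.on starlim.

Fact threadZP (c : R[i]) (x : thread) :
  exists N, forall k, (N <= k)%N -> c *: x k.+1 = f k (c *: x k).
Proof. by have [N xN] := threadP x; exists N => k /xN ->; rewrite linearZ. Qed.
Definition threadZ c x : thread := Thread (threadZP c x).

Fact threadMP (x y : thread) :
  exists N, forall k, (N <= k)%N ->
    smul (x k.+1) (y k.+1) = f k (smul (x k) (y k)).
Proof.
have [[N xN] [M yM]] := (threadP x, threadP y).
exists (maxn N M) => k; rewrite geq_max => /andP[/xN-> /yM->].
by rewrite starhomM.
Qed.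
Definition threadM x y : thread := Thread (threadMP x y).

Fact threadSP (x : thread) :
  exists N, forall k, (N <= k)%N -> star (x k.+1) = f k (star (x k)).
Proof. by have [N xN] := threadP x; exists N => k /xN ->; rewrite starhomS. Qed.
Definition threadS x : thread := Thread (threadSP x).

Definition starlimZ (c : R[i]) (x : starlim) : starlim :=
  \pi_starlim (threadZ c (repr x)).
Definition starlimM (x y : starlim) : starlim :=
  \pi_starlim (threadM (repr x) (repr y)).
Definition starlimS (x : starlim) : starlim := \pi_starlim (threadS (repr x)).

Lemma starlimZ_pi c (x : thread) : starlimZ c (\pi_starlim x) = \pi_starlim (threadZ c x).
Proof.
apply/dirlim_eqP; have [N xN] := dirlim_reprP x.
by exists N => k /xN /= ->.
Qed.
Lemma starlimM_pi (x y : thread) :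
  starlimM (\pi_starlim x) (\pi_starlim y) = \pi_starlim (threadM x y).
Proof.
apply/dirlim_eqP; have [[N xN] [M yM]] := (dirlim_reprP x, dirlim_reprP y).
by exists (maxn N M) => k; rewrite geq_max => /andP[/xN/= -> /yM ->].
Qed.
Lemma starlimS_pi (x : thread) : starlimS (\pi_starlim x) = \pi_starlim (threadS x).
Proof.
apply/dirlim_eqP; have [N xN] := dirlim_reprP x.
by exists N => k /xN /= ->.
Qed.
Lemma starlimD_pi (x y : thread) :
  \pi_starlim x + \pi_starlim y = \pi_starlim (threadD x y) :> starlim.
Proof. exact: dirlim_addE. Qed.

Fact starlim_scaleA (c d : R[i]) (x : starlim) :
  starlimZ c (starlimZ d x) = starlimZ (c * d) x.
Proof.
elim/quotW: x => x; rewrite (starlimZ_pi d) !starlimZ_pi.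
by apply/dirlim_eqP; exists 0%N => k _ /=; rewrite scalerA.
Qed.
Fact starlim_scale1 : left_id 1 starlimZ.
Proof.
elim/quotW=> x; rewrite starlimZ_pi.
by apply/dirlim_eqP; exists 0%N => k _ /=; rewrite scale1r.
Qed.
Fact starlim_scaleDr : right_distributive starlimZ +%R.
Proof.
move=> c; elim/quotW=> x; elim/quotW=> y.
rewrite starlimD_pi (starlimZ_pi c x) (starlimZ_pi c y) starlimZ_pi starlimD_pi.
by apply/dirlim_eqP; exists 0%N => k _ /=; rewrite scalerDr.
Qed.
Fact starlim_scaleDl (x : starlim) : {morph starlimZ^~ x : c d / c + d}.
Proof.
elim/quotW: x => x c d /=; rewrite (starlimZ_pi c) (starlimZ_pi d) starlimZ_pi starlimD_pi.
by apply/dirlim_eqP; exists 0%N => k _ /=; rewrite scalerDl.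
Qed.

HB.instance Definition _ := GRing.Zmodule_isLmodule.Build R[i] starlim
  starlim_scaleA starlim_scale1 starlim_scaleDr starlim_scaleDl.

Lemma starlim_scaleE c (x : thread) :
  c *: \pi_starlim x = \pi_starlim (threadZ c x) :> starlim.
Proof. exact: starlimZ_pi. Qed.

Fact starlim_smulA : associative starlimM.
Proof.
elim/quotW=> x; elim/quotW=> y; elim/quotW=> z.
rewrite (starlimM_pi y z) (starlimM_pi x y) !starlimM_pi.
by apply/dirlim_eqP; exists 0%N => k _ /=; rewrite smulA.
Qed.
Fact starlim_smulDl : left_distributive starlimM +%R.
Proof.
elim/quotW=> x; elim/quotW=> y; elim/quotW=> z.
rewrite starlimD_pi !starlimM_pi starlimD_pi.
by apply/dirlim_eqP; exists 0%N => k _ /=; rewrite smulDl.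
Qed.
Fact starlim_smulDr : right_distributive starlimM +%R.
Proof.
elim/quotW=> x; elim/quotW=> y; elim/quotW=> z.
rewrite starlimD_pi !starlimM_pi starlimD_pi.
by apply/dirlim_eqP; exists 0%N => k _ /=; rewrite smulDr.
Qed.
Fact starlim_smulZl (c : R[i]) (x y : starlim) :
  starlimM (c *: x) y = c *: starlimM x y.
Proof.
elim/quotW: x => x; elim/quotW: y => y.
rewrite starlim_scaleE !starlimM_pi starlim_scaleE.
by apply/dirlim_eqP; exists 0%N => k _ /=; rewrite smulZl.
Qed.
Fact starlim_smulZr (c : R[i]) (x y : starlim) :
  starlimM x (c *: y) = c *: starlimM x y.
Proof.
elim/quotW: x => x; elim/quotW: y => y.
rewrite starlim_scaleE !starlimM_pi starlim_scaleE.
by apply/dirlim_eqP; exists 0%N => k _ /=; rewrite smulZr.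
Qed.
Fact starlim_starD : {morph starlimS : x y / x + y}.
Proof.
elim/quotW=> x; elim/quotW=> y.
rewrite starlimD_pi !starlimS_pi starlimD_pi.
by apply/dirlim_eqP; exists 0%N => k _ /=; rewrite starD.
Qed.
Fact starlim_starZ (c : R[i]) (x : starlim) :
  starlimS (c *: x) = Num.conj c *: starlimS x.
Proof.
elim/quotW: x => x; rewrite starlim_scaleE !starlimS_pi starlim_scaleE.
by apply/dirlim_eqP; exists 0%N => k _ /=; rewrite starZ.
Qed.
Fact starlim_starK : involutive starlimS.
Proof.
elim/quotW=> x; rewrite (starlimS_pi x) starlimS_pi.
by apply/dirlim_eqP; exists 0%N => k _ /=; rewrite starK.
Qed.
Fact starlim_starM (x y : starlim) :
  starlimS (starlimM x y) = starlimM (starlimS y) (starlimS x).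
Proof.
elim/quotW: x => x; elim/quotW: y => y.
rewrite (starlimM_pi x) (starlimS_pi x) (starlimS_pi y) starlimM_pi.
rewrite starlimS_pi.
by apply/dirlim_eqP; exists 0%N => k _ /=; rewrite starM.
Qed.

HB.instance Definition _ := Lmodule_isStarAlg.Build R starlim
  starlim_smulA starlim_smulDl starlim_smulDr starlim_smulZl starlim_smulZr
  starlim_starD starlim_starZ starlim_starK starlim_starM.

Lemma starlim_smulE (x y : thread) :
  smul (\pi_starlim x) (\pi_starlim y) = \pi_starlim (threadM x y).
Proof. exact: starlimM_pi. Qed.
Lemma starlim_starE (x : thread) :
  star (\pi_starlim x) = \pi_starlim (threadS x).
Proof. exact: starlimS_pi. Qed.

End StarDirectLimit.

Definition matroid (R : realType) (D : starAlgType R) : Prop :=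
  exists (n : nat -> nat) (i : forall k, {starhom 'M[R[i]]_(n k) -> D}),
    [/\ forall k, (0 < n k)%N,
        forall k, injective (i k),
        forall k, (range (i k) `<=` range (i k.+1))%classic
      & forall x, exists k, range (i k) x].

(* The 4-cycle algebra with block sizes n. The paper's block indices 1, 2, 3, 4
   are the elements 0, 1, 2, 3 of 'I_4. *)
Section FourCycle.
Variables (R : realType) (n : 'I_4 -> nat).

Definition cyc_pos (i j : 'I_4) := (i == j) || ((i < 2) && (2 <= j))%N.

Definition cyc_pred : {pred 'M[R[i]]_(\sum_i n i)} :=
  fun x => [forall i, forall j, ~~ cyc_pos i j ==> (submxblock x i j == 0)].

Lemma cyc_predP x :
  reflect (forall i j, ~~ cyc_pos i j -> submxblock x i j = 0)
          (x \in cyc_pred).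
Proof.
apply: (iffP forallP) => [H i j nij|H i].
  by have /forallP/(_ j)/implyP/(_ nij)/eqP := H i.
by apply/forallP => j; apply/implyP => /H /eqP.
Qed.

Lemma submxblock_mul (x y : 'M[R[i]]_(\sum_i n i)) i j :
  submxblock (x *m y) i j = \sum_k submxblock x i k *m submxblock y k j.
Proof.
rewrite -{1}[x]submxblockK -{1}[y]submxblockK.
by rewrite mul_mxblock mxblockK.
Qed.

Fact cyc_pred_submod : submod_closed cyc_pred.
Proof.
split=> [|c x y /cyc_predP xP /cyc_predP yP]; apply/cyc_predP => i j nij.
  exact: submxblock0.
rewrite submxblockD yP // addr0.
have -> : submxblock (c *: x) i j = c *: submxblock x i j.
  by apply/matrixP => a b; rewrite !mxE.
by rewrite xP // scaler0.
Qed.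

Fact cyc_pred_subring : subring_closed cyc_pred.
Proof.
have [c0 cL] := cyc_pred_submod; split.
- apply/cyc_predP => i j; rewrite negb_or => /andP[/negPf nij _].
  rewrite [1](_ : _ = \mxdiag_i 1%:M); last by rewrite mxdiagZ.
  by rewrite mxblockK nij.
- by move=> x y xP yP; rewrite -[x - y]addrC -scaleN1r cL.
- move=> x y /cyc_predP xP /cyc_predP yP; apply/cyc_predP => i j nij.
  rewrite submxblock_mul big1 // => k _.
  have [xk|nik] := boolP (cyc_pos i k); last by rewrite xP // mul0mx.
  rewrite yP ?mulmx0 //; apply: contraNN nij; move: xk; rewrite /cyc_pos.
  case/orP=> [/eqP-> //|/andP[i2 k2] /orP[/eqP<-|/andP[]]].
    by rewrite i2 k2 orbT.
  by rewrite ltnNge k2.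
Qed.

HB.instance Definition _ := GRing.isSubmodClosed.Build R[i]
  'M[R[i]]_(\sum_i n i) cyc_pred cyc_pred_submod.
HB.instance Definition _ := GRing.isMulClosed.Build
  'M[R[i]]_(\sum_i n i) cyc_pred (GRing.subring_closedM cyc_pred_subring).

Record four_cycle := FourCycle {
  cyc_val :> 'M[R[i]]_(\sum_i n i);
  cyc_valP : cyc_val \in cyc_pred }.

HB.instance Definition _ := [isSub for cyc_val].
HB.instance Definition _ := [Choice of four_cycle by <:].
HB.instance Definition _ := [SubChoice_isSubZmodule of four_cycle by <:].
HB.instance Definition _ := [SubZmodule_isSubLmodule of four_cycle by <:].
HB.instance Definition _ := GRing.SubZmodule_isSubPzRing.Build
  ('M[R[i]]_(\sum_i n i) : pzRingType) cyc_pred four_cycle cyc_pred_subring.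

Definition block_proj_mx (i : 'I_4) : 'M[R[i]]_(\sum_i n i) :=
  \mxdiag_j (i == j)%:R%:M.

Fact block_proj_subproof i : block_proj_mx i \in cyc_pred.
Proof.
apply/cyc_predP => k l; rewrite negb_or => /andP[/negPf nkl _].
by rewrite mxblockK nkl.
Qed.

Definition block_proj i : four_cycle := FourCycle (block_proj_subproof i).

End FourCycle.

Section Embeddings.
Variables (R : realType) (n n' : 'I_4 -> nat).
Local Notation A := (four_cycle R n).
Local Notation A' := (four_cycle R n').
Local Notation CA := 'M[R[i]]_(\sum_i n i).
Local Notation CA' := 'M[R[i]]_(\sum_i n' i).

Definition embedding (phi : A -> A') : Prop :=
  [/\ injective phi, linear phi & {morph phi : a b / a * b}].

Definition star_extension (phi : A -> A') (Phi : {starhom CA -> CA'}) : Prop :=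
  forall a : A, Phi (cyc_val a) = cyc_val (phi a).

Definition multiplicity_one (Phi : {starhom CA -> CA'}) : Prop :=
  forall p : CA, p *m p = p -> p ^t* = p -> \rank p = 1%N ->
    \rank (Phi p : CA') = 1%N.

Definition preserves_halves (theta : {perm 'I_4}) : Prop :=
  forall i, (theta i < 2)%N = (i < 2)%N.

Definition of_type (theta : {perm 'I_4}) (phi : A -> A') : Prop :=
  forall (i j : 'I_4) (a : A), exists a' : A',
    phi (block_proj R n i * a * block_proj R n j) =
    block_proj R n' (theta i) * a' * block_proj R n' (theta j).

Definition rigid_one (theta : {perm 'I_4}) (phi : A -> A') : Prop :=
  [/\ embedding phi,
      exists Phi, star_extension phi Phi /\ multiplicity_one Phi,
      preserves_halves theta
    & of_type theta phi].

(* A rigid embedding comes with a decomposition into multiplicity one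
   summands; the number of summands of each type does not depend on it. *)
Record rigid_embedding := RigidEmbedding {
  rig_size : nat;
  rig_type : 'I_rig_size -> {perm 'I_4};
  rig_summand : 'I_rig_size -> A -> A';
  rig_size_gt0 : (0 < rig_size)%N;
  rig_rigid : forall s, rigid_one (rig_type s) (rig_summand s);
  rig_orthogonal : forall s t, s != t ->
    forall a b, rig_summand s a * rig_summand t b = 0 }.

Definition rig_map (phi : rigid_embedding) (a : A) : A' :=
  \sum_s @rig_summand phi s a.

Definition summands_of_type (phi : rigid_embedding) theta : {set 'I_(rig_size phi)} :=
  [set s | @rig_type phi s == theta].

Definition generic (phi : rigid_embedding) : Prop :=
  forall theta, preserves_halves theta ->
    (0 < #|summands_of_type phi theta|)%N.

Definition perm12 : {perm 'I_4} := tperm (inord 0) (inord 1).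
Definition perm34 : {perm 'I_4} := tperm (inord 2) (inord 3).

(* H_1 of a 4-cycle algebra is Z; this is the integer by which H_1(phi) acts. *)
Definition H1_mult (phi : rigid_embedding) : int :=
  (#|summands_of_type phi 1%g| + #|summands_of_type phi (perm12 * perm34)%g|)%:Z
  - (#|summands_of_type phi perm12| + #|summands_of_type phi perm34|)%:Z.

End Embeddings.

Arguments rig_type {R n n'} r s.
Arguments rig_summand {R n n'} r s a.

(* The *-extension of a star extendible embedding is unique, since A generates
   M_r as a *-algebra; it is recorded in order to form the limit of the C*(A_k). *)
Record generic_system (R : realType) := GenericSystem {
  gs_block : nat -> 'I_4 -> nat;
  gs_block_gt0 : forall k i, (0 < gs_block k i)%N;
  gs_map : forall k, rigid_embedding R (gs_block k) (gs_block k.+1);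
  gs_generic : forall k, generic (gs_map k);
  gs_ext : forall k, {starhom 'M[R[i]]_(\sum_i gs_block k i) ->
                              'M[R[i]]_(\sum_i gs_block k.+1 i)};
  gs_extP : forall k, star_extension (rig_map (gs_map k)) (gs_ext k) }.

Section GenericSystem.
Variables (R : realType) (S : generic_system R).
Local Open Scope classical_set_scope.

Definition gs_B : starAlgType R := starlim (gs_ext S).

(* The limit of the A_k, as a subalgebra of B. *)
Definition gs_A : set gs_B :=
  [set x | exists t : thread (V := fun k => 'M[R[i]]_(\sum_i gs_block S k i))
                             (gs_ext S),
     x = \pi_(starlim (gs_ext S)) t /\
     exists N, forall k, (N <= k)%N -> t k \in cyc_pred (R := R) (n := gs_block S k)].

Definition gs_diagonal : set gs_B := gs_A `&` (star @` gs_A).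

Definition gs_H1 : zmodType :=
  dirlim (V := fun=> int) (fun k => H1_mult (gs_map S k) \*o idfun).

(* The system A_k = A(D_4) (x) M_(4^k) with unital maps having exactly one
   summand of each type. *)
Definition four_adic_system : Prop :=
  [/\ forall k i, gs_block S k i = (4 ^ k)%N,
      forall k, rig_map (gs_map S k) 1 = 1
    & forall k theta, preserves_halves theta ->
        #|summands_of_type (gs_map S k) theta| = 1%N].

End GenericSystem.

Arguments gs_A {R} S _.
Arguments gs_diagonal {R} S _.

Section Inclusions.
Variables (R : realType) (D1 D2 D : starAlgType R).
Local Open Scope classical_set_scope.

(* pi is conjugate to the inclusion of A /\ A^* in B, where A and B are the
   limit algebras of the system S. *)
Definition index4_inclusion_of (S : generic_system R)
    (pi : {starhom D1 * D2 -> D}) : Prop :=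
  [/\ matroid D1, matroid D2, matroid D, injective pi
    & exists Psi : {starhom D -> gs_B S},
        bijective Psi /\ Psi @` range pi = gs_diagonal S].

Definition generic_index4_inclusion (pi : {starhom D1 * D2 -> D}) : Prop :=
  exists S, index4_inclusion_of S pi.

Definition H1_zero (pi : {starhom D1 * D2 -> D}) : Prop :=
  exists S, index4_inclusion_of S pi /\ forall x : gs_H1 S, x = 0.

Definition same_position (pi1 pi2 : {starhom D1 * D2 -> D}) : Prop :=
  exists sigma : {starhom D -> D},
    bijective sigma /\ sigma @` range pi1 = range pi2.

End Inclusions.

(* Main.v *)
(* A *-homomorphism M_n -> M_m has Kraus form x |-> sum_s V_s x V_s^* with
   isometries V_s of orthogonal ranges; it is rigid when each V_s permutes the
   four blocks, by an element of the Klein group {id, (12), (34), (12)(34)}. The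
   summands of a composite are counted by convolution over this group, so each
   character of the counts is multiplicative along the system.

   Uniqueness. One nontrivial character of the counts is H_1, hence it vanishes
   infinitely often. The other two vanish infinitely often because each half
   of the diagonal is a copy of F, whose only traces are the multiples of one
   trace. After telescoping, the four types are therefore equidistributed, and,
   everything being a power of 2, the four blocks have equal sizes. Given
   equidistributed maps u : X -> Y and f : X -> Z with Kraus families V, W such
   that the labels of W are those of V times a further equidistributed label
   set, v(y) = sum_t X_t y X_t^* with X_t = sum_s W_(s,t) V_s^* satisfies
   v u = f. So two such systems can be intertwined back and forth by maps that
   respect the blocks.

   Existence. In the system with one summand of each type, the map between the
   diagonals factors, on either half, through the full matrix algebra of that
   half; so each half is an increasing union of full matrix algebras of 2-power
   size, hence isomorphic to F by the same intertwining without blocks. *)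
Require Import Defs.
From HB Require Import structures.
From mathcomp Require Import all_boot all_order all_algebra perm.
From mathcomp Require Import spectral complex zify ring.
From mathcomp Require Import boolp classical_sets reals.

Set Implicit Arguments.
Unset Strict Implicit.
Unset Printing Implicit Defensive.

Import Order.TTheory GRing.Theory Num.Theory.
Local Open Scope ring_scope.
Local Open Scope complex_scope.
Local Open Scope sesquilinear_scope.
Local Open Scope quotient_scope.

(** * Kraus families *)

Section Kraus.
Variable R : realType.
Local Notation C := R[i].

(** Label counts multiply by convolution, so factoring f as v u asks to divide the counts of f by
    those of u. Over the Klein group this has in general no solution in natural numbers; when both
    counts are constant it is an ordinary division by four times the constant of u. Hence the
    insistence on equidistributed maps, and on constants that are powers of 2: divisibility becomes
    an inequality between exponents, which the growth of multiplicities along a system supplies.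
    Equal block sizes are what the very first map between two systems asks for; all later maps come
    from extension. Of the block projections, the back and forth uses only self-adjointness and the
    relations of [graded], so the same argument with all projections equal to 0 treats chains of
    full matrix algebras without blocks. *)

Lemma adjM m n p (A : 'M[C]_(m, n)) (B : 'M[C]_(n, p)) :
  (A *m B)^t* = B^t* *m A^t*.
Proof. by rewrite trmx_mul map_mxM. Qed.

Lemma adjD m n (A B : 'M[C]_(m, n)) : (A + B)^t* = A^t* + B^t*.
Proof. by apply/matrixP => i j; rewrite !mxE rmorphD. Qed.

Lemma adj0 m n : (0 : 'M[C]_(m, n))^t* = 0.
Proof. by rewrite trmx0 map_mx0. Qed.

Lemma adj_sum m n (I : Type) (r : seq I) (P : pred I) (F : I -> 'M[C]_(m, n)) :
  (\sum_(i <- r | P i) F i)^t* = \sum_(i <- r | P i) (F i)^t*.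
Proof. exact: (big_morph (fun A => A^t*) (@adjD m n) (@adj0 m n)). Qed.

Lemma adj1 n : (1%:M : 'M[C]_n)^t* = 1%:M.
Proof. by rewrite trmx1 map_mx1. Qed.

Lemma adj_delta m n i j : (delta_mx i j : 'M[C]_(m, n))^t* = delta_mx j i.
Proof. by rewrite trmx_delta map_delta_mx. Qed.

Lemma mxhomM m n (phi : {starhom 'M[C]_n -> 'M[C]_m}) x y :
  phi (x *m y) = phi x *m phi y.
Proof. exact: (starhomM (s := phi)). Qed.

Lemma mxhomS m n (phi : {starhom 'M[C]_n -> 'M[C]_m}) x :
  phi (x^t*) = (phi x)^t*.
Proof. exact: (starhomS (s := phi)). Qed.

Lemma delta_mx_mulD m n p (i : 'I_m) (j k : 'I_n) (l : 'I_p) :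
  delta_mx i j *m delta_mx k l = (j == k)%:R *: delta_mx i l :> 'M[C]_(m, p).
Proof. by rewrite mul_delta_mx_cond scaler_nat. Qed.

Definition projection n (p : 'M[C]_n) := p *m p = p /\ p^t* = p.

(** Gram-Schmidt applied to a row basis of [p] gives [U] with orthonormal rows spanning the row
    space of [p]; since [p] is self-adjoint, the adjoint of [U] spans its range. *)
Lemma projection_isometry n (p : 'M[C]_n) r : projection p -> \rank p = r ->
  exists W : 'M[C]_(n, r), W^t* *m W = 1%:M /\ W *m W^t* = p.
Proof.
case=> pp pH <-; pose U := schmidt (row_base p).
have Uu : U *m U^t* = 1%:M.
  by apply/unitarymxP/schmidt_unitarymx; exact: rank_leq_col.
have eqU : (U :=: p)%MS.
  apply: eqmx_trans (eq_row_base p).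
  by apply: eqmx_schmidt_free; exact: row_base_free.
exists (U^t*); rewrite !trmxCK; split=> //.
have /submxP[X UX] : (U <= p)%MS by rewrite eqU.
have /submxP[Y pY] : (p <= U)%MS by rewrite eqU.
have Up : U *m p = U by rewrite UX -mulmxA pp.
have pU : p *m U^t* = U^t* by rewrite -{2}Up adjM pH.
by rewrite -pU [X in X *m U^t*]pY -[Y *m U *m _]mulmxA Uu mulmx1.
Qed.

Definition isometric m n (S : finType) (V : S -> 'M[C]_(m, n)) :=
  forall s t, (V s)^t* *m V t = (s == t)%:R%:M.

Definition kraus m n (S : finType) (V : S -> 'M[C]_(m, n)) (x : 'M[C]_n) : 'M[C]_m :=
  \sum_s V s *m x *m (V s)^t*.

Definition complete m n (S : finType) (V : S -> 'M[C]_(m, n)) :=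
  \sum_s V s *m (V s)^t* = 1%:M.

Lemma kraus1 m n (S : finType) (V : S -> 'M[C]_(m, n)) :
  kraus V 1%:M = \sum_s V s *m (V s)^t*.
Proof. by apply: eq_bigr => s _; rewrite mulmx1. Qed.

Lemma kraus_linear m n (S : finType) (V : S -> 'M[C]_(m, n)) : linear (kraus V).
Proof.
move=> a x y; rewrite /kraus scaler_sumr -big_split; apply: eq_bigr => s _ /=.
by rewrite mulmxDr mulmxDl scalemxAl scalemxAr.
Qed.

Lemma kraus_star m n (S : finType) (V : S -> 'M[C]_(m, n)) x :
  kraus V (x^t*) = (kraus V x)^t*.
Proof. by rewrite adj_sum; apply: eq_bigr => s _; rewrite !adjM trmxCK mulmxA. Qed.

Section Isometric.
Variables (m n : nat) (S : finType) (V : S -> 'M[C]_(m, n)).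
Hypothesis Viso : isometric V.

Lemma kraus_mulV x s : kraus V x *m V s = V s *m x.
Proof.
rewrite /kraus mulmx_suml (bigD1 s) //= big1 => [|t nts].
  by rewrite addr0 -!mulmxA Viso eqxx mulmx1.
by rewrite -!mulmxA Viso (negPf nts) (_ : 0%:R%:M = 0) ?mulmx0 // raddf0.
Qed.

Lemma isometric_mul1 s : (V s)^t* *m V s = 1%:M.
Proof. by rewrite Viso eqxx. Qed.

Lemma kraus_mul x y : kraus V (x *m y) = kraus V x *m kraus V y.
Proof.
rewrite {3}/kraus mulmx_sumr; apply: eq_bigr => s _.
by rewrite !mulmxA kraus_mulV.
Qed.

Lemma kraus_compress x s : (V s)^t* *m kraus V x *m V s = x.
Proof. by rewrite -mulmxA kraus_mulV mulmxA isometric_mul1 mul1mx. Qed.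

Lemma kraus_inj : (0 < #|S|)%N -> injective (kraus V).
Proof.
by move=> /card_gt0P[s _] x y xy; rewrite -(kraus_compress x s) xy kraus_compress.
Qed.

Lemma kraus_trace x : \tr (kraus V x) = #|S|%:R * \tr x.
Proof.
rewrite /kraus raddf_sum /= (eq_bigr (fun=> \tr x)) => [|s _].
  by rewrite sumr_const mulr_natl.
by rewrite mxtrace_mulC mulmxA isometric_mul1 mul1mx.
Qed.

(** Compare traces at the identity: each isometry contributes [n]. *)
Lemma complete_dim : complete V -> m = (#|S| * n)%N.
Proof.
move=> Vc; apply/eqP; rewrite -(eqr_nat C) natrM.
by rewrite -[m%:R]mxtrace1 -Vc -kraus1 kraus_trace mxtrace1.
Qed.

End Isometric.

Lemma kraus_comp m n p (S T : finType) (V : S -> 'M[C]_(m, n))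
    (W : T -> 'M[C]_(p, m)) x :
  kraus W (kraus V x) = kraus (fun u : T * S => W u.1 *m V u.2) x.
Proof.
rewrite /kraus.
rewrite -(pair_bigA _ (fun t s => W t *m V s *m x *m (W t *m V s)^t*)) /=.
apply: eq_bigr => t _; rewrite mulmx_sumr mulmx_suml; apply: eq_bigr => s _.
by rewrite adjM !mulmxA.
Qed.

Lemma isometric_comp m n p (S T : finType) (V : S -> 'M[C]_(m, n))
    (W : T -> 'M[C]_(p, m)) : isometric V -> isometric W ->
  isometric (fun u : T * S => W u.1 *m V u.2).
Proof.
move=> Vi Wi [t s] [t' s'] /=; rewrite adjM mulmxA -[_ *m W t']mulmxA Wi.
rewrite xpair_eqE; case: (t == t'); first by rewrite mulmx1 Vi.
by rewrite (_ : 0%:R%:M = 0) ?mulmx0 ?mul0mx ?raddf0 //.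
Qed.

Lemma complete_comp m n p (S T : finType) (V : S -> 'M[C]_(m, n))
    (W : T -> 'M[C]_(p, m)) : complete V -> complete W ->
  complete (fun u : T * S => W u.1 *m V u.2).
Proof. by rewrite /complete -!kraus1 -kraus_comp => -> ->. Qed.

(* With w spanning the range of phi(e_00), the isometries are
   V_s = sum_a phi(e_a0) w_s e_a^*. *)
Lemma starhom_kraus m n (phi : {starhom 'M[C]_n -> 'M[C]_m}) (i0 : 'I_n) :
  exists (d : nat) (V : 'I_d -> 'M[C]_(m, n)),
    [/\ d = \rank (phi (delta_mx i0 i0)), isometric V & phi =1 kraus V].
Proof.
pose e (a b : 'I_n) : 'M[C]_n := delta_mx a b.
have phiM x y : phi (x *m y) = phi x *m phi y by exact: mxhomM.
have phiS x : phi (x^t*) = (phi x)^t* by exact: mxhomS.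
set p := phi (e i0 i0).
have pP : projection p.
  by split; rewrite /p -?phiM -?phiS ?adj_delta // mul_delta_mx.
have [d rp] : {d | \rank p = d} by exists (\rank p).
have [W [WW Wp]] := projection_isometry pP rp.
pose w s := col s W.
have ww s t : (w s)^t* *m w t = (s == t)%:R%:M.
  apply/matrixP => i j; move/matrixP/(_ s t): WW; rewrite !mxE.
  by rewrite !ord1 eqxx mulr1n => <-; apply: eq_bigr => k _; rewrite !mxE.
have wp : \sum_s w s *m (w s)^t* = p.
  rewrite -Wp; apply/matrixP => i j; rewrite summxE !mxE.
  by apply: eq_bigr => s _; rewrite !mxE big_ord1 !mxE.
have pw s : p *m w s = w s.
  rewrite -wp mulmx_suml (bigD1 s) //= big1 => [|t nts].
    by rewrite addr0 -mulmxA ww eqxx mulmx1.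
  by rewrite -mulmxA ww (negPf nts) raddf0 mulmx0.
pose f a := phi (e a i0).
have ff a b : (f a)^t* *m f b = (a == b)%:R *: p.
  by rewrite /f -phiS -phiM adj_delta delta_mx_mulD linearZ.
have fpf a b : f a *m p *m (f b)^t* = phi (e a b).
  by rewrite /f -phiS -!phiM adj_delta !mul_delta_mx.
pose g s (a : 'I_n) : 'M[C]_(m, n) := f a *m w s *m delta_mx (0 : 'I_1) a.
have gg s t a b : (g s a)^t* *m g t b = ((a == b)%:R * (s == t)%:R) *: e a b.
  rewrite /g !adjM adj_delta !mulmxA.
  rewrite -(mulmxA _ ((f a)^t*)) ff -!scalemxAr -!scalemxAl -scalerA; congr (_ *: _).
  rewrite -(mulmxA _ p) pw -(mulmxA _ _ (w t)) ww mul_mx_scalar -scalemxAl.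
  by rewrite mul_delta_mx.
have gxg s a b x : g s a *m x *m (g s b)^t* = x a b *: (f a *m (w s *m (w s)^t*) *m (f b)^t*).
  rewrite /g !adjM adj_delta !mulmxA -(mulmxA _ _ x) -rowE.
  rewrite -(mulmxA _ (row a x)) -colE.
  have -> : col b (row a x) = (x a b)%:M.
    by apply/matrixP => i j; rewrite !mxE !ord1 eqxx.
  by rewrite mul_mx_scalar -!scalemxAl.
exists d, (fun s => \sum_a g s a); split=> //.
  move=> s t; rewrite adj_sum mulmx_suml (eq_bigr (fun a => (s == t)%:R *: e a a)).
    by rewrite -scaler_sumr -mx1_sum_delta scalemx1.
  move=> a _; rewrite mulmx_sumr (bigD1 a) //= big1 => [|b nba].
    by rewrite addr0 gg eqxx mul1r.
  by rewrite gg eq_sym (negPf nba) mul0r scale0r.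
move=> x; rewrite {1}[x]matrix_sum_delta linear_sum /=.
have -> : kraus (fun s => \sum_a g s a) x =
    \sum_s \sum_a \sum_b x a b *: (f a *m (w s *m (w s)^t*) *m (f b)^t*).
  apply: eq_bigr => s _; rewrite !mulmx_suml; apply: eq_bigr => a _.
  by rewrite adj_sum mulmx_sumr; apply: eq_bigr => b _.
rewrite exchange_big /=; apply: eq_bigr => a _.
rewrite exchange_big /= linear_sum /=; apply: eq_bigr => b _.
by rewrite linearZ /= -scaler_sumr -mulmx_suml -mulmx_sumr wp fpf.
Qed.

End Kraus.

(** * Summand types and intertwining *)

Lemma sum_pair (V : Type) (idx : V) (op : Monoid.com_law idx) (S T : finType) (F : S * T -> V) :
  \big[op/idx]_u F u = \big[op/idx]_s \big[op/idx]_t F (s, t).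
Proof. by rewrite pair_bigA /=; apply: eq_bigr => -[]. Qed.

Section Labels.

(* (b, c) stands for the type (12)^b (34)^c. *)
Definition lab := (bool * bool)%type.
Definition ladd (g h : lab) : lab := (g.1 (+) h.1, g.2 (+) h.2).
Definition act (g : lab) : {perm 'I_4} :=
  ((if g.1 then perm12 else 1) * (if g.2 then perm34 else 1))%g.

(** Tables of values on natural numbers: identities between these permutations then reduce to
    finitely many cases. *)
Lemma perm12_nat i : nat_of_ord (perm12 i) = nth 0%N [:: 1; 0; 2; 3]%N i.
Proof.
rewrite permE /=; case: i => [[|[|[|[|//]]]] h]; rewrite -!val_eqE /= !inordK //=.
all: by rewrite ?inordK.
Qed.

Lemma perm34_nat i : nat_of_ord (perm34 i) = nth 0%N [:: 0; 1; 3; 2]%N i.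
Proof.
rewrite permE /=; case: i => [[|[|[|[|//]]]] h]; rewrite -!val_eqE /= !inordK //=.
all: by rewrite ?inordK.
Qed.

Lemma act_nat g i : nat_of_ord (act g i) =
  nth 0%N (match g with
  | (false, false) => [:: 0; 1; 2; 3] | (true, false) => [:: 1; 0; 2; 3]
  | (false, true) => [:: 0; 1; 3; 2] | (true, true) => [:: 1; 0; 3; 2] end)%N i.
Proof.
case: g => -[] []; rewrite permM /= ?perm34_nat ?perm12_nat ?perm1 ?perm12_nat //.
all: by case: i => [[|[|[|[|//]]]] h].
Qed.

Lemma act_ladd g h i : act (ladd g h) i = act g (act h i).
Proof.
apply: ord_inj; rewrite !act_nat.
by case: g h i => [[] []] [[] []] [[|[|[|[|//]]]] hi].
Qed.

Lemma act_inv g i : act g (act g i) = i.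
Proof.
apply: ord_inj; rewrite !act_nat.
by case: g i => [[] []] [[|[|[|[|//]]]] hi].
Qed.

Lemma act_half g : preserves_halves (act g).
Proof.
by move=> i; rewrite act_nat; case: g i => [[] []] [[|[|[|[|//]]]] hi].
Qed.

Lemma act_inj : injective act.
Proof.
move=> g h gh; have := act_nat g (inord 0); have := act_nat g (inord 2).
rewrite gh !act_nat !inordK //.
by case: g h {gh} => [[] []] [[] []].
Qed.

(** The images of 0 and 2 tell whether each pair is exchanged, and this determines a permutation
    that preserves the halves. *)
Lemma act_surj theta : preserves_halves theta -> exists g, theta = act g.
Proof.
move=> th; exists (nat_of_ord (theta (inord 0)) != 0%N, nat_of_ord (theta (inord 2)) != 2%N).
have v i : (theta i < 4)%N by [].
have inj i j : (i < 4)%N -> (j < 4)%N -> i != j ->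
    val (theta (inord i)) != val (theta (inord j)).
  move=> hi hj; apply: contra => /eqP/val_inj/perm_inj/(congr1 val) /=.
  by rewrite !inordK // => ->.
have := inj 0%N 1%N isT isT isT; have := inj 2%N 3%N isT isT isT.
have := th (inord 0); have := th (inord 1); have := th (inord 2); have := th (inord 3).
have := v (inord 0); have := v (inord 1); have := v (inord 2); have := v (inord 3).
rewrite !inordK //= => v3 v2 v1 v0 h3 h2 h1 h0 n23 n01.
apply/permP => i; apply: ord_inj; rewrite act_nat.
have -> : i = inord (val i) by rewrite inord_val.
have a01 : theta (inord 0) = 0 :> nat /\ theta (inord 1) = 1 :> nat \/
  theta (inord 0) = 1 :> nat /\ theta (inord 1) = 0 :> nat by lia.
have a23 : theta (inord 2) = 2 :> nat /\ theta (inord 3) = 3 :> nat \/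
  theta (inord 2) = 3 :> nat /\ theta (inord 3) = 2 :> nat by lia.
rewrite inordK ?ltn_ord //; case: a01 a23 => -[a0 a1] [] [a2 a3]; rewrite a0 a2.
all: by case: i => [[|[|[|[|//]]]] hi].
Qed.

Lemma laddK g : involutive (ladd g).
Proof. by case: g => [[] []] [[] []]. Qed.

Lemma laddC : commutative ladd.
Proof. by case=> [[] []] [[] []]. Qed.

Definition fibre (S : finType) (lam : S -> lab) g := #|[set s | lam s == g]|.

Lemma fibre_sum (S : finType) (lam : S -> lab) g :
  fibre lam g = (\sum_s (lam s == g))%N.
Proof. by rewrite /fibre -sum1_card big_mkcond; apply: eq_bigr => s _; rewrite inE; case: eqP. Qed.

Lemma sum_fibre (S : finType) (lam : S -> lab) (F : lab -> nat) :
  (\sum_s F (lam s) = \sum_g fibre lam g * F g)%N.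
Proof.
rewrite (partition_big lam xpredT) //=; apply: eq_bigr => g _.
rewrite (eq_bigr (fun=> F g)) => [|s /eqP-> //].
by rewrite sum_nat_const /fibre; congr (_ * _)%N; apply: eq_card => s; rewrite !inE.
Qed.

Lemma card_fibre (S : finType) (lam : S -> lab) : #|S| = (\sum_g fibre lam g)%N.
Proof.
rewrite -sum1_card (sum_fibre lam (fun=> 1%N)).
by apply: eq_bigr => g _; rewrite muln1.
Qed.

Lemma sum_lab (F : lab -> nat) : (\sum_g F g =
  F (false, false) + F (false, true) + (F (true, false) + F (true, true)))%N.
Proof.
by rewrite (sum_pair _ F) /= !big_bool /=; lia.
Qed.

Lemma card_fibre_const (S : finType) (lam : S -> lab) d :
  (forall g, fibre lam g = d) -> #|S| = (4 * d)%N.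
Proof. by move=> hd; rewrite (card_fibre lam) sum_lab !hd; lia. Qed.

Lemma fibre_fst e g : fibre (fun u : lab * 'I_e => u.1) g = e.
Proof.
rewrite fibre_sum (@sum_pair _ _ _ lab 'I_e) /=.
under eq_bigr => h _ do rewrite sum_nat_const card_ord.
rewrite (bigD1 g) //= eqxx muln1 big1 ?addn0 // => h /negPf nh.
by rewrite nh muln0.
Qed.

(** Convolution over the Klein group: every element is its own inverse, so [ladd h g] is the
    difference of [g] and [h]. *)
Definition conv (c c' : lab -> nat) g := (\sum_h c h * c' (ladd h g))%N.

Lemma fibre_prod (S T : finType) (lam : S -> lab) (mu : T -> lab) g :
  fibre (fun u : T * S => ladd (mu u.1) (lam u.2)) g =
  conv (fibre mu) (fibre lam) g.
Proof.
rewrite fibre_sum -(pair_bigA _ (fun t s => nat_of_bool (ladd (mu t) (lam s) == g))) /=.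
rewrite /conv -(sum_fibre mu (fun h => fibre lam (ladd h g))).
apply: eq_bigr => t _; rewrite fibre_sum; apply: eq_bigr => s _.
by rewrite -(inj_eq (inv_inj (laddK (mu t)))) laddK.
Qed.

(** Equal fibres mean that the lists of labels of [S] and [T] are permutations of each other; the
    rearrangement of indices gives [tau]. *)
Lemma fibre_bij (S T : finType) (lam : S -> lab) (mu : T -> lab) :
  (forall g, fibre lam g = fibre mu g) ->
  exists tau : S -> T, bijective tau /\ forall s, mu (tau s) = lam s.
Proof.
move=> eqf; have cST : #|S| = #|T|.
  by rewrite (card_fibre lam) (card_fibre mu); apply: eq_bigr.
(* The enumerations below take default elements, so an empty [S] is settled apart. *)
have [s0 _|S0] := pickP (fun _ : S => true); last first.
  have noS (s : S) : False by have := S0 s.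
  exists (fun s => False_rect T (noS s)); split=> [|s]; last by case: (noS s).
  by apply: inj_card_bij => [s|]; [case: (noS s) | rewrite cST].
have Tgt : (0 < #|T|)%N by rewrite -cST; apply/card_gt0P; exists s0.
have /card_gt0P[t0 _] := Tgt.
have pe : perm_eq [seq lam s | s <- enum S] [seq mu t | t <- enum T].
  apply/allP => g _ /=; apply/eqP; rewrite !count_map.
  have := eqf g; rewrite /fibre !cardE !size_filter -!enumT.
  have cE (U : finType) (nu : U -> lab) :
      count (mem [set u | nu u == g]) (enum U) = count (preim nu (pred1 g)) (enum U).
    by apply: eq_count => u; rewrite !inE.
  by rewrite -!cE.
have /(perm_iotaP (false, false))[Is pI eI] := pe.
rewrite size_map in pI; have uI : uniq Is by rewrite (perm_uniq pI) iota_uniq.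
have sI : size Is = #|S| by rewrite (perm_size pI) size_iota -cardE cST.
have idx (s : S) : (index s (enum S) < size Is)%N.
  by rewrite sI cardE index_mem mem_enum.
have Ib (s : S) : (nth 0%N Is (index s (enum S)) < size (enum T))%N.
  have : nth 0%N Is (index s (enum S)) \in Is by rewrite mem_nth.
  by rewrite (perm_mem pI) mem_iota.
exists (fun s => nth t0 (enum T) (nth 0%N Is (index s (enum S)))); split.
  apply: inj_card_bij; last by rewrite cST.
  move=> s s' /eqP; rewrite nth_uniq ?enum_uniq // nth_uniq // => /eqP.
  by move/(congr1 (nth s0 (enum S))); rewrite !nth_index ?mem_enum.
move=> s; have := congr1 (fun l => nth (false, false) l (index s (enum S))) eI.
rewrite /= (nth_map s0) ?index_mem ?mem_enum // nth_index ?mem_enum // => ->.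
by rewrite (nth_map 0%N _ _ (idx s)) (nth_map t0 _ _ (Ib s)).
Qed.

End Labels.

(** * Maps with prescribed label counts *)

Section Graded.
Variable R : realType.
Local Notation C := R[i].

Definition graded m n (Q : 'I_4 -> 'M[C]_n) (Q' : 'I_4 -> 'M[C]_m) g (V : 'M[C]_(m, n)) :=
  forall i, V *m Q i = Q' (act g i) *m V.

Definition hermitian n (Q : 'I_4 -> 'M[C]_n) := forall i, (Q i)^t* = Q i.

(** Completeness of the family makes the map unital. The family itself is forgotten: label counts
    are what matters for composing and factoring. *)
Definition linked m n (Q : 'I_4 -> 'M[C]_n) (Q' : 'I_4 -> 'M[C]_m) (c : lab -> nat)
    (phi : 'M[C]_n -> 'M[C]_m) :=
  exists (S : finType) (V : S -> 'M[C]_(m, n)) (lam : S -> lab),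
    [/\ isometric V, complete V, forall s, graded Q Q' (lam s) (V s),
        forall g, fibre lam g = c g & phi =1 kraus V].

Section Adjoint.
Variables (m n : nat) (Q : 'I_4 -> 'M[C]_n) (Q' : 'I_4 -> 'M[C]_m).
Hypotheses (QH : hermitian Q) (QH' : hermitian Q').

Lemma graded_adj g V : graded Q Q' g V ->
  forall i, V^t* *m Q' i = Q (act g i) *m V^t*.
Proof.
move=> gV i; apply: (can_inj (@trmxCK _ _ _)).
by rewrite !adjM !trmxCK QH QH' gV act_inv.
Qed.

(** Commutation with the blocks passes forward through each isometry, and passes back because
    compressing by a single [V s] recovers [x]. *)
Lemma kraus_diag (S : finType) (V : S -> 'M[C]_(m, n)) lam x :
  isometric V -> (0 < #|S|)%N -> (forall s, graded Q Q' (lam s) (V s)) ->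
  (forall i, Q i *m x = x *m Q i) <->
  (forall i, Q' i *m kraus V x = kraus V x *m Q' i).
Proof.
move=> Vi /card_gt0P[s _] Vg; split=> xQ i.
  rewrite /kraus mulmx_sumr mulmx_suml; apply: eq_bigr => t _.
  rewrite -!mulmxA (graded_adj (Vg t)) !mulmxA.
  rewrite -[in X in X *m V t](act_inv (lam t) i) -(Vg t) -(mulmxA _ (Q _) x) xQ.
  by rewrite !mulmxA.
rewrite -(kraus_compress Vi x s) -[RHS]mulmxA (Vg s) !mulmxA.
rewrite -[in X in X *m (V s)^t*](act_inv (lam s) i) -(graded_adj (Vg s)).
by rewrite -(mulmxA _ (Q' _) (kraus V x)) xQ !mulmxA.
Qed.

Lemma linked_diag c phi x : linked Q Q' c phi -> (0 < m)%N ->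
  (forall i, Q i *m x = x *m Q i) <-> (forall i, Q' i *m phi x = phi x *m Q' i).
Proof.
case=> S [V [lam [Vi Vc Vg _ phiE]]] m0; rewrite phiE; apply: (kraus_diag x Vi _ Vg).
by move: m0; rewrite (complete_dim Vi Vc) muln_gt0 => /andP[].
Qed.

End Adjoint.

Lemma linked_comp m n p (Q : 'I_4 -> 'M[C]_n) (Q' : 'I_4 -> 'M[C]_m)
    (Q'' : 'I_4 -> 'M[C]_p) c c' f f' :
  linked Q Q' c f -> linked Q' Q'' c' f' -> linked Q Q'' (conv c' c) (f' \o f).
Proof.
case=> S [V [lam [Vi Vc Vg Vf fE]]] [T [W [mu [Wi Wc Wg Wf f'E]]]].
exists (T * S)%type, (fun u => W u.1 *m V u.2), (fun u => ladd (mu u.1) (lam u.2)).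
split.
- exact: isometric_comp.
- exact: complete_comp.
- by move=> [t s] i /=; rewrite -mulmxA Vg mulmxA Wg act_ladd mulmxA.
- by move=> g; rewrite fibre_prod /conv; apply: eq_bigr => h _; rewrite Vf Wf.
- by move=> x /=; rewrite f'E fE kraus_comp.
Qed.

(* With V, W Kraus families of u, f and T identified with S x S' as labelled
   sets, v has the Kraus family X_(s') = sum_s W_(s,s') V_s^*. *)
Lemma linked_extend m n p (Q : 'I_4 -> 'M[C]_n) (Q' : 'I_4 -> 'M[C]_m)
    (Q'' : 'I_4 -> 'M[C]_p) d e u f :
  hermitian Q -> hermitian Q' ->
  linked Q Q' (fun=> d) u -> linked Q Q'' (fun=> 4 * d * e)%N f ->
  exists2 v, linked Q' Q'' (fun=> e) v & forall x, v (u x) = f x.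
Proof.
move=> QH QH' [S [V [lam [Vi Vc Vg Vf uE]]]] [T [W [mu [Wi Wc Wg Wf fE]]]].
pose S' := (lab * 'I_e)%type; pose lam' (s' : S') : lab := s'.1.
have f' g : fibre lam' g = e by exact: fibre_fst.
(* Every fibre of [S * S'] has [4 * d * e] elements: four choices for the first label, then [d] and
   [e]. *)
have [tau [tb tl]] : exists tau : S * S' -> T, bijective tau /\
    forall u, mu (tau u) = ladd (lam u.1) (lam' u.2).
  apply: fibre_bij => g; rewrite fibre_prod Wf /conv.
  under eq_bigr => h _ do rewrite Vf f'.
  by rewrite sum_nat_const card_prod card_bool mulnA.
pose X s' := \sum_s W (tau (s, s')) *m (V s)^t*.
have XV s' s : X s' *m V s = W (tau (s, s')).
  rewrite /X mulmx_suml (bigD1 s) //= big1 => [|t nts].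
    by rewrite addr0 -mulmxA Vi eqxx mulmx1.
  by rewrite -mulmxA Vi (negPf nts) raddf0 mulmx0.
have WX s s' s'' : (W (tau (s, s')))^t* *m X s'' = (s' == s'')%:R *: (V s)^t*.
  rewrite /X mulmx_sumr (bigD1 s) //= big1 => [|t nts].
    rewrite addr0 mulmxA Wi (inj_eq (bij_inj tb)) xpair_eqE eqxx /=.
    by rewrite mul_scalar_mx.
  rewrite mulmxA Wi (inj_eq (bij_inj tb)) xpair_eqE eq_sym (negPf nts) /=.
  by rewrite raddf0 mul0mx.
exists (kraus X); last first.
  move=> x; rewrite uE fE kraus_comp /kraus [RHS](reindex tau) /=; last exact: onW_bij.
  rewrite (@sum_pair _ _ _ S' S) (@sum_pair _ _ _ S S') /=.
  rewrite exchange_big /=; apply: eq_bigr => s _; apply: eq_bigr => s' _.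
  by rewrite XV.
exists S', X, lam'; split=> //.
(* Completeness of [V] enters here: the range projections of the [V s] add up to 1. *)
- move=> s' s''; rewrite {1}/X adj_sum mulmx_suml.
  rewrite (eq_bigr (fun s => (s' == s'')%:R *: (V s *m (V s)^t*))) => [|s _].
    by rewrite -scaler_sumr Vc scalemx1.
  by rewrite adjM trmxCK -mulmxA WX -scalemxAr.
- rewrite /complete -Wc (reindex tau) /=; last exact: onW_bij.
  rewrite (@sum_pair _ _ _ S S').
  rewrite exchange_big /=; apply: eq_bigr => s' _.
  rewrite {2}/X adj_sum mulmx_sumr; apply: eq_bigr => s _.
  by rewrite adjM trmxCK mulmxA XV.
(* [W (tau (s, s'))] has label [lam s] plus [lam' s'], and the adjoint of [V s] undoes [lam s];
   every term of the sum thus has label [lam' s']. *)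
- move=> s' i; rewrite /X mulmx_suml mulmx_sumr; apply: eq_bigr => s _.
  rewrite -mulmxA (graded_adj QH QH' (Vg s)) mulmxA Wg tl /= mulmxA.
  by rewrite laddC act_ladd act_inv.
Qed.

End Graded.

(** * Towers and back and forth *)

Lemma starhom_of (R : realType) (U V : starAlgType R) (f : U -> V) :
  linear f -> {morph f : a b / smul a b} -> {morph f : a / star a} ->
  exists F : {starhom U -> V}, F =1 f.
Proof.
move=> fL fM fS.
pose F : {starhom U -> V} := HB.pack f
  (GRing.isLinear.Build R[i] U V *:%R f fL) (isStarMorphism.Build R U V f fM fS).
by exists F.
Qed.

Lemma kraus_starhom (R : realType) m n (S : finType) (V : S -> 'M[R[i]]_(m, n)) :
  isometric V -> exists F : {starhom 'M[R[i]]_n -> 'M[R[i]]_m}, F =1 kraus V.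
Proof.
move=> Vi; apply: starhom_of; first exact: kraus_linear.
- by move=> x y; exact: kraus_mul.
- by move=> x; exact: kraus_star.
Qed.

Lemma starhom_comp (R : realType) (U V W : starAlgType R)
    (g : {starhom V -> W}) (f : {starhom U -> V}) :
  exists G : {starhom U -> W}, forall x, G x = g (f x).
Proof.
apply: starhom_of => [c x y|x y|x]; first by rewrite !linearP.
  by rewrite !starhomM.
by rewrite !starhomS.
Qed.

Section Good.
Variable R : realType.
Local Notation C := R[i].
Implicit Types m n p : nat.

Definition good m n (Q : 'I_4 -> 'M[C]_n) (Q' : 'I_4 -> 'M[C]_m) a phi :=
  linked Q Q' (fun=> 2 ^ a)%N phi.

(** The [+ 2] reflects the order 4 of the label group: convolving two constants sums their product
    over four labels. *)
Lemma good_comp m n p (Q : 'I_4 -> 'M[C]_n) (Q' : 'I_4 -> 'M[C]_m)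
    (Q'' : 'I_4 -> 'M[C]_p) a b f g :
  good Q Q' a f -> good Q' Q'' b g -> good Q Q'' (a + b + 2) (g \o f).
Proof.
move=> fg gg; rewrite /good.
suff -> : (fun=> 2 ^ (a + b + 2))%N = conv (fun=> 2 ^ b)%N (fun=> 2 ^ a)%N.
  exact: linked_comp fg gg.
apply/funext => h; rewrite /conv sum_nat_const card_prod card_bool !expnD; lia.
Qed.

Lemma good_extend m n p (Q : 'I_4 -> 'M[C]_n) (Q' : 'I_4 -> 'M[C]_m)
    (Q'' : 'I_4 -> 'M[C]_p) a b u f :
  hermitian Q -> hermitian Q' -> (a + 2 <= b)%N ->
  good Q Q' a u -> good Q Q'' b f ->
  exists2 v, good Q' Q'' (b - (a + 2)) v & forall x, v (u x) = f x.
Proof.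
move=> QH QH' ab gu; rewrite /good.
have -> : (2 ^ b = 4 * 2 ^ a * 2 ^ (b - (a + 2)))%N.
  by rewrite -{1}(subnKC ab) !expnD; lia.
exact: linked_extend gu.
Qed.

Lemma good_inj m n (Q : 'I_4 -> 'M[C]_n) (Q' : 'I_4 -> 'M[C]_m) a f :
  good Q Q' a f -> injective f.
Proof.
case=> S [V [lam [Vi _ _ Vf fE]]] x y; rewrite !fE.
apply: (kraus_inj Vi); rewrite (card_fibre_const Vf); have := expn_gt0 2 a; lia.
Qed.

Lemma linked_linear m n (Q : 'I_4 -> 'M[C]_n) (Q' : 'I_4 -> 'M[C]_m) c f :
  linked Q Q' c f -> linear f.
Proof. by case=> S [V [lam [_ _ _ _ fE]]] a x y; rewrite !fE kraus_linear. Qed.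

Lemma linked_mul m n (Q : 'I_4 -> 'M[C]_n) (Q' : 'I_4 -> 'M[C]_m) c f x y :
  linked Q Q' c f -> f (x *m y) = f x *m f y.
Proof. by case=> S [V [lam [Vi _ _ _ fE]]]; rewrite !fE kraus_mul. Qed.

Lemma linked_star m n (Q : 'I_4 -> 'M[C]_n) (Q' : 'I_4 -> 'M[C]_m) c f x :
  linked Q Q' c f -> f (x^t*) = (f x)^t*.
Proof. by case=> S [V [lam [_ _ _ _ fE]]]; rewrite !fE kraus_star. Qed.

End Good.

(* A chain of matrix algebras in B whose block structure is recorded by the
   projections tQ k; for an ungraded chain take tQ k = 0. *)
Record tower (R : realType) (B : starAlgType R) := Tower {
  tn : nat -> nat;
  tQ : forall k, 'I_4 -> 'M[R[i]]_(tn k);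
  th : forall k, {starhom 'M[R[i]]_(tn k) -> B};
  tn_gt0 : forall k, (0 < tn k)%N;
  tQ_herm : forall k, hermitian (tQ k);
  th_inj : forall k, injective (th k);
  t_link : forall k N, exists K, forall k', (K <= k')%N -> exists a f,
    [/\ (N <= a)%N, good (tQ k) (tQ k') a f & forall x, th k' (f x) = th k x] }.
Arguments tQ {R B} t k.
Arguments th {R B} t k.
Arguments tn {R B} t k.

Section Towers.
Variable R : realType.

Definition tdiag (B : starAlgType R) (T : tower B) (x : B) :=
  exists k z, x = th T k z /\ forall i, tQ T k i *m z = z *m tQ T k i.

Definition tunion (B : starAlgType R) (T : tower B) (x : B) :=
  exists k z, x = th T k z.

(** Two representatives of one element agree at a common later stage, and commutation with the
    blocks is both preserved and reflected on the way there. *)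
Lemma tdiag_stage (B : starAlgType R) (T : tower B) k z :
  tdiag T (th T k z) <-> forall i, tQ T k i *m z = z *m tQ T k i.
Proof.
split=> [[l [y [zy yQ]]]|zQ]; last by exists k, z.
have [K HK] := t_link T k 0; have [L HL] := t_link T l 0.
have [|a [f [_ gf hf]]] := HK (maxn K L); first exact: leq_maxl.
have [|b [g [_ gg hg]]] := HL (maxn K L); first exact: leq_maxr.
apply: (linked_diag (tQ_herm T k) (tQ_herm T _) z gf (tn_gt0 T _)).2.
have -> : f z = g y by apply: (th_inj (t := T)); rewrite hf hg.
by apply: (linked_diag (tQ_herm T l) (tQ_herm T _) y gg (tn_gt0 T _)).1.
Qed.

Section BackAndForth.
Variables (B1 B2 : starAlgType R) (T1 : tower B1) (T2 : tower B2).

Record partial_iso := PartialIso {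
  pk : nat; pl : nat; pa : nat;
  pu : 'M[R[i]]_(tn T1 pk) -> 'M[R[i]]_(tn T2 pl);
  pu_good : good (tQ T1 pk) (tQ T2 pl) pa pu }.

Arguments pu : clear implicits.

(** The stages change along the induction, so successive partial maps are compared as relations
    between [B1] and [B2], not as maps of matrix algebras. *)
Definition pgraph (s : partial_iso) (x : B1) (y : B2) :=
  exists z, x = th T1 (pk s) z /\ y = th T2 (pl s) (pu s z).

(** One full round: enlarge the target until it contains stage [i] of [T2], map it back by [v] into
    a stage of [T1] that contains stage [i], and map that forward by [w]. Both composites are
    connecting maps, so the graph of [w] extends the old one and covers stage [i] on both sides. *)
Lemma pgraph_step (s : partial_iso) i : exists s' : partial_iso,
  [/\ forall x y, pgraph s x y -> pgraph s' x y,
      forall z, exists y, pgraph s' (th T1 i z) y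
    & forall z, exists x, pgraph s' x (th T2 i z)].
Proof.
case: s => k l a u gu.
have [K HK] := t_link T2 l 0; have [K' HK'] := t_link T2 i 0.
set l1 := maxn K K'.
have [|b [f2 [_ gf2 hf2]]] := HK l1; first exact: leq_maxl.
have [|b' [f2' [_ _ hf2']]] := HK' l1; first exact: leq_maxr.
have gu1 := good_comp gu gf2.
(* [a + b + 2] is the exponent of the enlarged map; the further [+ 2] is what [good_extend] asks in
   order to divide by it. *)
have [L HL] := t_link T1 k (a + b + 2 + 2); have [L' HL'] := t_link T1 i 0.
set k1 := maxn L L'.
have [|c [f1 [ac gf1 hf1]]] := HL k1; first exact: leq_maxl.
have [|c' [f1' [_ _ hf1']]] := HL' k1; first exact: leq_maxr.
have [v gv vu] := good_extend (tQ_herm T1 k) (tQ_herm T2 l1) ac gu1 gf1.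
have [M HM] := t_link T2 l1 (c - (a + b + 2 + 2) + 2).
have [|d [f3 [cd gf3 hf3]]] := HM M; first exact: leqnn.
have [w gw wv] := good_extend (tQ_herm T2 l1) (tQ_herm T1 k1) cd gv gf3.
exists (PartialIso gw); split=> [x y [z [-> ->]]|z|z].
- exists (f1 z); rewrite hf1 /=; split=> //.
  by rewrite -vu wv hf3 /= hf2.
- by exists (th T2 M (w (f1' z))); exists (f1' z); rewrite hf1'.
- by exists (th T1 k1 (v (f2' z))), (v (f2' z)); rewrite /= wv hf3 hf2'.
Qed.

Lemma pgraph_functional s x y y' : pgraph s x y -> pgraph s x y' -> y = y'.
Proof. by move=> [z [-> ->]] [z' [/(th_inj (t := T1))-> ->]]. Qed.

Lemma pgraph_injective s x x' y : pgraph s x y -> pgraph s x' y -> x = x'.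
Proof.
move=> [z [-> ->]] [z' [-> /(th_inj (t := T2))]].
by move=> /(good_inj (pu_good s))->.
Qed.

Lemma pgraph_linear s (c : R[i]) x y x' y' : pgraph s x y -> pgraph s x' y' ->
  pgraph s (c *: x + x') (c *: y + y').
Proof.
move=> [z [-> ->]] [z' [-> ->]]; exists (c *: z + z').
by rewrite (linked_linear (pu_good s)) !linearP.
Qed.

Lemma pgraph_mul s x y x' y' : pgraph s x y -> pgraph s x' y' ->
  pgraph s (smul x x') (smul y y').
Proof.
move=> [z [-> ->]] [z' [-> ->]]; exists (z *m z').
by rewrite (linked_mul z z' (pu_good s)) -!starhomM.
Qed.

Lemma pgraph_star s x y : pgraph s x y -> pgraph s (star x) (star y).
Proof.
move=> [z [-> ->]]; exists (z^t*).
by rewrite (linked_star z (pu_good s)) -!starhomS.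
Qed.

Lemma pgraph_diag s x y : pgraph s x y -> tdiag T1 x <-> tdiag T2 y.
Proof.
move=> [z [-> ->]].
have H := linked_diag (tQ_herm T1 _) (tQ_herm T2 _) z (pu_good s) (tn_gt0 T2 _).
exact: iff_trans (tdiag_stage _) (iff_trans H (iff_sym (tdiag_stage _))).
Qed.

(** The graphs increase to the graph of a map on all of [B1]. Its image is the union of [T2], which
    may be a proper subalgebra of [B2]. *)
Lemma tower_iso (s0 : partial_iso) : (forall x, tunion T1 x) ->
  exists Psi : {starhom B1 -> B2},
    [/\ injective Psi, forall y, tunion T2 y <-> exists x, Psi x = y
      & forall x, tdiag T1 x <-> tdiag T2 (Psi x)].
Proof.
move=> T1all.
have /choice[next nextP] : forall si : partial_iso * nat, exists s',
    [/\ forall x y, pgraph si.1 x y -> pgraph s' x y,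
        forall z, exists y, pgraph s' (th T1 si.2 z) y
      & forall z, exists x, pgraph s' x (th T2 si.2 z)].
  by case=> s i; exact: pgraph_step.
pose s := fix s n := if n is n'.+1 then next (s n', n') else s0.
have mono m n x y : (m <= n)%N -> pgraph (s m) x y -> pgraph (s n) x y.
  move=> /subnK <-; elim: (n - m)%N => [//|d IH] /IH.
  by have [+ _ _] := nextP (s (d + m)%N, (d + m)%N); apply.
pose G x y := exists n, pgraph (s n) x y.
have G2 x y x' y' : G x y -> G x' y' -> exists n, pgraph (s n) x y /\ pgraph (s n) x' y'.
  move=> [m Gm] [n Gn]; exists (maxn m n); split.
    by apply: mono Gm; exact: leq_maxl.
  by apply: mono Gn; exact: leq_maxr.
have Gfun x y y' : G x y -> G x y' -> y = y'.
  by move=> Gy Gy'; have [n [/pgraph_functional H /H]] := G2 _ _ _ _ Gy Gy'.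
have /choice[Psi PsiP] : forall x, exists y, G x y.
  move=> x; have [i [z ->]] := T1all x.
  by have [_ /(_ z)[y Gy] _] := nextP (s i, i); exists y, i.+1.
have [F FE] : exists F : {starhom B1 -> B2}, F =1 Psi.
  apply: starhom_of.
  - move=> c x y; have [n [Gx Gy]] := G2 _ _ _ _ (PsiP x) (PsiP y).
    by apply: (Gfun _ _ _ (PsiP _)); exists n; exact: pgraph_linear.
  - move=> x y; have [n [Gx Gy]] := G2 _ _ _ _ (PsiP x) (PsiP y).
    by apply: (Gfun _ _ _ (PsiP _)); exists n; exact: pgraph_mul.
  - move=> x; have [n Gx] := PsiP x.
    by apply: (Gfun _ _ _ (PsiP _)); exists n; exact: pgraph_star.
exists F; split.
- move=> x x'; rewrite !FE => xx'.
  have [n [Gx Gx']] := G2 _ _ _ _ (PsiP x) (PsiP x').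
  by apply: pgraph_injective Gx _; rewrite xx'.
- move=> y; split=> [[i [z ->]]|[x <-]].
    have [_ _ /(_ z)[x Gx]] := nextP (s i, i).
    by exists x; rewrite FE; apply: (Gfun _ _ _ (PsiP x)); exists i.+1.
  rewrite FE; have [n [z [_ ->]]] := PsiP x.
  by exists (pl (s n)), (pu (s n) z).
- by move=> x; rewrite FE; have [n Gx] := PsiP x; exact: pgraph_diag Gx.
Qed.

End BackAndForth.
End Towers.

(** * Direct limits and UHF algebras *)

Section Stages.
Variables (R : realType) (A : nat -> starAlgType R).
Variable f : forall k, {starhom A k -> A k.+1}.

(** A thread has a term at every level. Below level [k] it is the default 0, invisible in the limit;
    at level [k] the element is transported along the equality of indices. *)
Fixpoint push k (x : A k) m : A m :=
  match k =P m with
  | ReflectT e => eq_rect k (fun i => A i : Type) x m e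
  | ReflectF _ => if m is m'.+1 return A m then f m' (push x m') else 0
  end.

Lemma push_id k (x : A k) : push x k = x.
Proof. by case: k x => [|k] x /=; case: eqP => // e; rewrite (eq_axiomK e). Qed.

Lemma pushS k (x : A k) m : (k <= m)%N -> push x m.+1 = f m (push x m).
Proof. by move=> km /=; case: eqP => // e; rewrite e ltnn in km. Qed.

Definition push_thread k (x : A k) : thread (V := fun i => A i) f :=
  Thread (ex_intro _ k (fun m km => pushS x km)).

Definition stage k (x : A k) : starlim f := \pi_(starlim f) (push_thread x).

Lemma push_eq k (x : A k) (t : thread (V := fun i => A i) f) :
  t k = x -> (forall m, (k <= m)%N -> t m.+1 = f m (t m)) ->
  stage x = \pi_(starlim f) t.
Proof.
move=> tk tS; apply/dirlim_eqP; exists k => m /subnK <- /=.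
elim: (m - k)%N => [|d IH]; first by rewrite push_id.
by rewrite addSn pushS ?leq_addl // IH tS // leq_addl.
Qed.

Fact stage_linear k : linear (@stage k).
Proof.
move=> c x y; rewrite starlim_scaleE starlimD_pi; apply: push_eq => [|m km] /=.
  by rewrite !push_id.
by rewrite -!/(push _ m.+1) !pushS // linearP.
Qed.

Fact stage_mul k : {morph @stage k : x y / smul x y}.
Proof.
move=> x y; rewrite starlim_smulE; apply: push_eq => [|m km] /=.
  by rewrite !push_id.
by rewrite -!/(push _ m.+1) !pushS // starhomM.
Qed.

Fact stage_star k : {morph @stage k : x / star x}.
Proof.
move=> x; rewrite starlim_starE; apply: push_eq => [|m km] /=.
  by rewrite !push_id.
by rewrite -!/(push _ m.+1) !pushS // starhomS.
Qed.

HB.instance Definition _ k :=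
  GRing.isLinear.Build R[i] (A k) (starlim f) *:%R (@stage k) (@stage_linear k).
HB.instance Definition _ k :=
  isStarMorphism.Build R (A k) (starlim f) (@stage k) (@stage_mul k) (@stage_star k).

Definition stage_hom k : {starhom A k -> starlim f} := @stage k.

Lemma stage_thread (t : thread (V := fun i => A i) f) :
  exists N, forall k, (N <= k)%N -> \pi_(starlim f) t = stage (t k).
Proof.
have [N tN] := threadP t; exists N => k Nk; symmetry.
by apply: push_eq => // m km; apply: tN; exact: leq_trans km.
Qed.

Lemma stage_surj (x : starlim f) : exists k (z : A k), x = stage z.
Proof.
elim/quotW: x => t; have [N tN] := stage_thread t.
by exists N, (t N); exact: tN.
Qed.

Lemma stage_link k (x : A k) : stage (f k x) = stage x.
Proof.
apply: push_eq => [|m km]; first by rewrite /= -/(push _ k.+1) pushS // push_id.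
by rewrite [LHS]pushS //; exact: ltnW.
Qed.

Hypothesis f_inj : forall k, injective (f k).

Lemma push_inj k m : (k <= m)%N -> injective (fun x : A k => push x m).
Proof.
move=> /subnK <-; elim: (m - k)%N => [|d IH] x y; first by rewrite !push_id.
by rewrite addSn !pushS ?leq_addl // => /f_inj /IH.
Qed.

Lemma stage_inj k : injective (@stage k).
Proof.
move=> x y /dirlim_eqP[N /= H]; apply: (@push_inj k (maxn N k)).
  exact: leq_maxr.
by apply: H; exact: leq_maxl.
Qed.

End Stages.

Section Lifting.
Variables (R : realType) (B : starAlgType R).

(** The identities required of [g] may be checked after applying the injective [h], where they are
    those of [ka]. *)
Lemma lift_starhom (U W : starAlgType R) (h : {starhom U -> B}) (ka : {starhom W -> B}) :
  injective h -> (forall x, exists y, h y = ka x) ->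
  exists g : {starhom W -> U}, forall x, h (g x) = ka x.
Proof.
move=> hi /choice[g hg].
have [G GE] : exists G : {starhom W -> U}, G =1 g.
  apply: starhom_of => [c x y|x y|x]; apply: hi.
  - by rewrite hg [RHS]linearP /= !hg [LHS]linearP.
  - by rewrite hg [RHS]starhomM !hg [LHS]starhomM.
  - by rewrite hg [RHS]starhomS !hg [LHS]starhomS.
by exists G => x; rewrite GE hg.
Qed.

Variables (n : nat -> nat) (h : forall k, {starhom 'M[R[i]]_(n k) -> B}).
Hypothesis h_mono : forall k z, exists y, h k.+1 y = h k z.

Lemma range_mono k m z : (k <= m)%N -> exists y, h m y = h k z.
Proof.
move=> /subnK <-; elim: (m - k)%N => [|d [y hy]]; first by exists z.
by have [y' hy'] := h_mono y; exists y'; rewrite hy' hy.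
Qed.

(* M_p is finite dimensional, so its image lies in a single stage. *)
Lemma finite_stage p (ka : {starhom 'M[R[i]]_p -> B}) :
  (forall x, exists k z, ka x = h k z) ->
  exists K, forall k, (K <= k)%N -> forall x, exists y, h k y = ka x.
Proof.
move=> kah.
have /choice[s sP] : forall ij : 'I_p * 'I_p, exists k, exists z,
  ka (delta_mx ij.1 ij.2) = h k z by move=> ij; exact: kah.
exists (\max_ij s ij) => k sk x.
have /choice[e eP] : forall ij : 'I_p * 'I_p, exists y,
    h k y = ka (delta_mx ij.1 ij.2).
  move=> ij; have [z ->] := sP ij; apply: range_mono.
  by apply: leq_trans sk; exact: leq_bigmax.
exists (\sum_i \sum_j x i j *: e (i, j)).
rewrite {2}[x]matrix_sum_delta !linear_sum; apply: eq_bigr => i _.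
rewrite !linear_sum; apply: eq_bigr => j _.
by rewrite !linearZ /= eP.
Qed.

End Lifting.

Section Ungraded.
Variable R : realType.
Local Notation C := R[i].

(** With zero projections every isometry is graded for every label, so the [4 * 2 ^ a] Kraus
    isometries can be labelled evenly at will. *)
Lemma good_ungraded m n (phi : {starhom 'M[C]_n -> 'M[C]_m}) a :
  (0 < n)%N -> phi 1%:M = 1%:M -> m = (2 ^ (a + 2) * n)%N ->
  good (fun=> 0) (fun=> 0) a phi.
Proof.
case: n phi => [//|n] phi _ phi1 mE.
have [d [V [_ Vi phiE]]] := starhom_kraus phi ord0.
have Vc : complete V by rewrite /complete -kraus1 -phiE.
have dE : d = #|{: lab * 'I_(2 ^ a)}|.
  have := complete_dim Vi Vc; rewrite mE card_ord => /eqP.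
  rewrite eqn_pmul2r // => /eqP <-.
  by rewrite !card_prod card_bool card_ord expnD mulnC.
pose tau (u : lab * 'I_(2 ^ a)) : 'I_d := cast_ord (esym dE) (enum_rank u).
have tb : bijective tau.
  apply: inj_card_bij; last by rewrite card_ord dE.
  by move=> u v /cast_ord_inj/enum_rank_inj.
exists (lab * 'I_(2 ^ a))%type, (fun u => V (tau u)), (fun u => u.1); split.
- by move=> s t; rewrite Vi (inj_eq (bij_inj tb)).
- by rewrite /complete -Vc (reindex tau) //; exact: onW_bij.
- by move=> s i; rewrite mulmx0 mul0mx.
- exact: fibre_fst.
- by move=> x; rewrite phiE /kraus (reindex tau) //; exact: onW_bij.
Qed.

Section Chain.
Variables (B : starAlgType R) (n c : nat -> nat).
Variable h : forall k, {starhom 'M[C]_(n k) -> B}.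
Hypotheses (h_inj : forall k, injective (h k))
  (h_mono : forall k z, exists y, h k.+1 y = h k z)
  (h_unit : forall k, h k.+1 1%:M = h k 1%:M)
  (nE : forall k, n k = (2 ^ c k)%N)
  (c_unbounded : forall N, exists K, forall k, (K <= k)%N -> (N <= c k)%N).

Fact ungraded_link k N : exists K, forall k', (K <= k')%N -> exists a f,
  [/\ (N <= a)%N, good (fun=> 0 : 'M[C]_(n k)) (fun=> 0 : 'M[C]_(n k')) a f
    & forall x, h k' (f x) = h k x].
Proof.
(* The multiplicity from stage [k] to [k'] is [2 ^ (c k' - c k)]. Spreading it over four labels
   costs 2 in the exponent, and at least [N] must remain. *)
have [K HK] := c_unbounded (c k + N + 2).
exists (maxn k K) => k'; rewrite geq_max => /andP[kk' /HK ck'].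
have [|f hf] := lift_starhom (ka := h k) (@h_inj k').
  by move=> x; exact: range_mono.
have hu : h k' 1%:M = h k 1%:M.
  by rewrite -(subnK kk'); elim: (k' - k)%N => [//|d IH]; rewrite h_unit.
exists (c k' - c k - 2)%N, f; split=> //; first by lia.
apply: good_ungraded; rewrite ?nE ?expn_gt0 //.
  by apply: (@h_inj k'); rewrite hf hu.
by rewrite -expnD; congr (2 ^ _)%N; lia.
Qed.

Fact chain_gt0 k : (0 < n k)%N.
Proof. by rewrite nE expn_gt0. Qed.

Fact hermitian0 k : hermitian (fun=> 0 : 'M[C]_(n k)).
Proof. by move=> i; rewrite adj0. Qed.

Definition ungraded_tower : tower B :=
  Tower chain_gt0 hermitian0 h_inj ungraded_link.

End Chain.
End Ungraded.

Section UHF.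
Variables (R : realType).
Variable j : forall k : nat, {starhom 'M[R[i]]_(2 ^ k) -> 'M[R[i]]_(2 ^ k.+1)}.
Hypothesis j_unital : forall k : nat, j k 1%:M = 1%:M.

Lemma unital_starhom_inj m n (f : {starhom 'M[R[i]]_n -> 'M[R[i]]_m}) :
  (0 < m)%N -> f 1%:M = 1%:M -> injective f.
Proof.
case: n f => [|n] f m0 f1; first by move=> x y _; rewrite !flatmx0.
have [d [V [_ Vi fE]]] := starhom_kraus f ord0.
have Vc : complete V by rewrite /complete -kraus1 -fE.
move=> x y; rewrite !fE; apply: (kraus_inj Vi).
by have := complete_dim Vi Vc; rewrite lt0n; case: #|_| => // m00; rewrite m00 in m0.
Qed.

Lemma j_inj k : injective (j k).
Proof. by apply: unital_starhom_inj => //; rewrite expn_gt0. Qed.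

Local Notation F := (starlim j).
Local Notation iota := (@stage R (fun k => 'M[R[i]]_(2 ^ k)) j).

Lemma uhf_stage_inj k : injective (iota (k := k)).
Proof. exact: (@stage_inj R (fun k => 'M[R[i]]_(2 ^ k)) j j_inj k). Qed.

Lemma uhf_stage_mono k z : exists y, iota (k := k.+1) y = iota (k := k) z.
Proof. by exists (j k z); exact: (@stage_link R (fun k => 'M[R[i]]_(2 ^ k)) j k). Qed.

Lemma uhf_stage_unit k : iota (k := k.+1) 1%:M = iota (k := k) 1%:M.
Proof. by rewrite -(@stage_link R (fun k => 'M[R[i]]_(2 ^ k)) j k 1%:M) j_unital. Qed.

Definition uhf_tower : tower F :=
  @ungraded_tower R F (fun k => 2 ^ k)%N id (@stage_hom R (fun k => 'M[R[i]]_(2 ^ k)) j)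
    uhf_stage_inj uhf_stage_mono uhf_stage_unit (fun=> erefl)
    (fun N => ex_intro _ N (fun k Nk => Nk)).

(** [F] begins with the 1 by 1 matrices, so this is the first partial isomorphism in a comparison
    with [F]. *)
Lemma scalar_starhom m : exists f : {starhom 'M[R[i]]_1 -> 'M[R[i]]_m},
  f 1%:M = 1%:M.
Proof.
have [|||f fE] := starhom_of (f := fun x : 'M[R[i]]_1 => (x 0 0)%:M : 'M[R[i]]_m).
- by move=> c x y; rewrite !mxE raddfD /= scale_scalar_mx.
- move=> x y; rewrite [smul x y]/(x *m y) [RHS]/(_ *m _) !mxE big_ord1.
  by rewrite scalar_mxM.
- by move=> x; apply/matrixP => a b; rewrite !mxE raddfMn eq_sym.
by exists f; rewrite fE mxE.
Qed.

(** Both chains are ungraded towers with a common start. The chain may exhaust only a subalgebra of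
    [B], as it does for the halves of the diagonal. *)
Lemma uhf_recognition (B : starAlgType R) (n c : nat -> nat)
    (h : forall k, {starhom 'M[R[i]]_(n k) -> B}) :
  (forall k, injective (h k)) -> (forall k z, exists y, h k.+1 y = h k z) ->
  (forall k, h k.+1 1%:M = h k 1%:M) -> (forall k, n k = 2 ^ c k)%N ->
  (forall N, exists K, forall k, (K <= k)%N -> (N <= c k)%N) ->
  exists Psi : {starhom F -> B}, injective Psi /\
    forall y, (exists k z, y = h k z) <-> exists x, Psi x = y.
Proof.
move=> hi hm hu nE cu; pose T := ungraded_tower hi hm hu nE cu.
(* The multiplicity [2 ^ c K] of the scalars must be divisible by 4 to be spread over the labels. *)
have [K HK] := cu 2%N; have cK := HK K (leqnn K).
have [f f1] := scalar_starhom (n K).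
have gf : good (tQ uhf_tower 0) (tQ T K) (c K - 2) f.
  by apply: good_ungraded => //=; rewrite nE muln1; congr (2 ^ _)%N; lia.
have [|Psi [Pi Pr _]] := tower_iso (PartialIso gf).
  by move=> x; have [k [z ->]] := stage_surj x; exists k, z.
by exists Psi; split.
Qed.

End UHF.

(** * Frames of block projections *)

Section Frames.
Variable R : realType.
Local Notation C := R[i].

Definition frame n (Q : 'I_4 -> 'M[C]_n) :=
  [/\ hermitian Q, forall i j, Q i *m Q j = (i == j)%:R *: Q i & \sum_i Q i = 1%:M].

Lemma frame_projection n (Q : 'I_4 -> 'M[C]_n) i : frame Q -> projection (Q i).
Proof. by case=> QH QM _; split; [rewrite QM eqxx scale1r | exact: QH]. Qed.

(** The coordinates of the large space are split into [4 * e] groups of [N], one for each label and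
    each index below [e]. *)
Lemma scalar_isometries N e : exists J : lab * 'I_e -> 'M[C]_(4 * e * N, N),
  isometric J /\ complete J.
Proof.
have cE : (4 * e * N)%N = #|{: (lab * 'I_e) * 'I_N}|.
  by rewrite !card_prod card_bool !card_ord.
pose tau (s : lab * 'I_e) (b : 'I_N) : 'I_(4 * e * N) := cast_ord (esym cE) (enum_rank (s, b)).
have tau_eq s b t b' : (tau s b == tau t b') = (s == t) && (b == b').
  by rewrite (inj_eq (@cast_ord_inj _ _ _)) (inj_eq enum_rank_inj) xpair_eqE.
exists (fun s => \sum_b delta_mx (tau s b) b); split.
  move=> s t; rewrite adj_sum mulmx_suml (eq_bigr (fun b => (s == t)%:R *: delta_mx b b)).
    by rewrite -scaler_sumr -mx1_sum_delta scalemx1.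
  move=> b _; rewrite adj_delta mulmx_sumr (bigD1 b) //= big1 => [|b' nb].
    by rewrite addr0 delta_mx_mulD tau_eq eqxx andbT.
  by rewrite delta_mx_mulD tau_eq eq_sym [b == b']eq_sym (negPf nb) andbF scale0r.
rewrite /complete mx1_sum_delta.
have tb : {on [pred _ | true], bijective (fun u : (lab * 'I_e) * 'I_N => tau u.1 u.2)}.
  apply: onW_bij; apply: inj_card_bij; last by rewrite card_ord -cE.
  by move=> [s b] [t b'] /= /eqP; rewrite tau_eq => /andP[/eqP-> /eqP->].
rewrite [RHS](reindex _ tb) (@sum_pair _ _ _ (lab * 'I_e)%type 'I_N) /=.
apply: eq_bigr => s _; rewrite mulmx_suml; apply: eq_bigr => b _.
rewrite adj_sum mulmx_sumr (bigD1 b) //= big1 => [|b' nb].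
  by rewrite addr0 adj_delta mul_delta_mx.
by rewrite adj_delta delta_mx_mulD eq_sym (negPf nb) scale0r.
Qed.

(* With Q i = W_i W_i^* and Q' i = W'_i W'_i^*, the isometry with label g and
   index a is sum_i W'_(g i) J_(g,a) W_i^*. *)
Lemma linked_frames m n (Q : 'I_4 -> 'M[C]_n) (Q' : 'I_4 -> 'M[C]_m) N e :
  frame Q -> frame Q' -> (forall i, \rank (Q i) = N) ->
  (forall i, \rank (Q' i) = (4 * e * N)%N) ->
  exists u, linked Q Q' (fun=> e) u.
Proof.
move=> fQ fQ' rQ rQ'.
have /choice[W WP] : forall i, exists W : 'M[C]_(n, N), W^t* *m W = 1%:M /\ W *m W^t* = Q i.
  by move=> i; apply: projection_isometry => //; exact: frame_projection.
have /choice[W' WP'] : forall i, exists W : 'M[C]_(m, 4 * e * N),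
    W^t* *m W = 1%:M /\ W *m W^t* = Q' i.
  by move=> i; apply: projection_isometry => //; exact: frame_projection.
have [J [Ji Jc]] := scalar_isometries N e.
(* [X i] equals [P i *m X i], so the orthogonality of the projections passes to the isometries. *)
have orth k p (P : 'I_4 -> 'M[C]_k) (X : 'I_4 -> 'M[C]_(k, p)) : frame P ->
    (forall i, (X i)^t* *m X i = 1%:M /\ X i *m (X i)^t* = P i) ->
    forall i j, (X i)^t* *m X j = (i == j)%:R%:M.
  move=> [_ PM _] XP i j; case: eqVneq => [<-|nij]; first by have [] := XP i.
  have [[X1 X2] [Y1 Y2]] := (XP i, XP j).
  rewrite -[_ *m X j]mul1mx -{1}X1 -[LHS]mulmx1 -{1}Y1 !mulmxA.
  rewrite -(mulmxA _ (X i)) X2 -(mulmxA _ (X j)) Y2 -(mulmxA _ (P i)) PM (negPf nij).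
  by rewrite scale0r mulmx0 mul0mx raddf0.
have WW := orth _ _ _ _ fQ WP; have WW' := orth _ _ _ _ fQ' WP'.
pose V (s : lab * 'I_e) := \sum_i W' (act s.1 i) *m J s *m (W i)^t*.
have VW s i : V s *m W i = W' (act s.1 i) *m J s.
  rewrite /V mulmx_suml (bigD1 i) //= big1 => [|k ki].
    by rewrite addr0 -mulmxA WW eqxx mulmx1.
  by rewrite -mulmxA WW (negPf ki) raddf0 mulmx0.
exists (kraus V), (lab * 'I_e)%type, V, (fun s => s.1); split=> //.
- move=> s t; rewrite {1}/V adj_sum mulmx_suml.
  rewrite (eq_bigr (fun i => (s == t)%:R *: Q i)) => [|i _].
    by rewrite -scaler_sumr; case: fQ => _ _ ->; rewrite scalemx1.
  have -> : (W' (act s.1 i) *m J s *m (W i)^t*)^t* *m V t =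
      \sum_k W i *m ((J s)^t* *m ((W' (act s.1 i))^t* *m W' (act t.1 k)) *m J t) *m (W k)^t*.
    rewrite /V mulmx_sumr; apply: eq_bigr => k _.
    by rewrite !adjM trmxCK !mulmxA.
  have [st|nst] := eqVneq s t; last first.
    rewrite scale0r big1 // => k _; rewrite WW'; case: eqP => _.
      by rewrite mulmx1 Ji (negPf nst) raddf0 mulmx0 mul0mx.
    by rewrite raddf0 mulmx0 mul0mx mulmx0 mul0mx.
  rewrite -st (bigD1 i) //= big1 => [|k ki].
    by rewrite addr0 WW' eqxx mulmx1 Ji eqxx mulmx1 scale1r; have [_ ->] := WP i.
  rewrite WW' (inj_eq perm_inj) eq_sym (negPf ki).
  by rewrite raddf0 mulmx0 mul0mx mulmx0 mul0mx.
- have VV s : V s *m (V s)^t* = \sum_i W' i *m (J s *m (J s)^t*) *m (W' i)^t*.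
    rewrite {2}/V adj_sum mulmx_sumr [RHS](reindex_inj (@perm_inj _ (act s.1))) /=.
    by apply: eq_bigr => i _; rewrite !adjM trmxCK !mulmxA VW.
  rewrite /complete (eq_bigr _ (fun s _ => VV s)) exchange_big /=.
  case: fQ' => _ _ <-; apply: eq_bigr => i _.
  by rewrite -mulmx_suml -mulmx_sumr Jc mulmx1; have [_ ->] := WP' i.
- move=> s i; have [[_ <-] [_ <-]] := (WP i, WP' (act s.1 i)).
  rewrite mulmxA VW /V mulmx_sumr (bigD1 i) //= big1 => [|k ki].
    rewrite addr0 !mulmxA -(mulmxA (W' _) _ (W' _)).
    by have [-> _] := WP' (act s.1 i); rewrite mulmx1.
  rewrite !mulmxA -(mulmxA (W' _) _ (W' _)) WW' (inj_eq perm_inj) eq_sym (negPf ki).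
  by rewrite raddf0 mulmx0 !mul0mx.
- exact: fibre_fst.
Qed.

Lemma delta_sandwich n (Y : 'M[C]_n) a b c d :
  delta_mx a b *m Y *m delta_mx c d = Y b c *: delta_mx a d :> 'M[C]_n.
Proof.
rewrite -(mul_delta_mx (0 : 'I_1) a b) -(mul_delta_mx (0 : 'I_1) c d).
rewrite -(mulmxA _ _ Y) -rowE !mulmxA -(mulmxA _ (row b Y)) -colE.
have -> : col c (row b Y) = (Y b c)%:M.
  by apply/matrixP => i j; rewrite !mxE !ord1 eqxx.
by rewrite mul_mx_scalar -scalemxAl mul_delta_mx.
Qed.

(* Averaging over the matrix units: sum_(a,b) e_ab Y e_ba = tr(Y) 1. *)
Lemma trace_unique n (t : 'M[C]_n -> C) Y : linear_for *%R t ->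
  (forall x y, t (x *m y) = t (y *m x)) -> n%:R * t Y = \tr Y * t 1%:M.
Proof.
move=> tL tC.
have [T tE] : exists T : {linear 'M[C]_n -> C | *%R}, T =1 t.
  pose T : {linear 'M[C]_n -> C | *%R} :=
    HB.pack t (GRing.isLinear.Build C 'M[C]_n C *%R t tL).
  by exists T.
have TC x y : T (x *m y) = T (y *m x) by rewrite !tE tC.
rewrite -!tE {tL tC tE t}.
have -> : \tr Y * T 1%:M = T (\sum_a \sum_b delta_mx a b *m Y *m delta_mx b a).
  rewrite -linearZ mx1_sum_delta scaler_sumr; congr (T _); apply: eq_bigr => a _.
  rewrite /mxtrace scaler_suml; apply: eq_bigr => b _.
  by rewrite delta_sandwich.
rewrite linear_sum (eq_bigr (fun=> T Y)) => [|a _].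
  by rewrite sumr_const card_ord mulr_natl.
rewrite linear_sum -{2}[Y]mul1mx mx1_sum_delta mulmx_suml linear_sum.
apply: eq_bigr => b _ /=; rewrite -mulmxA TC -mulmxA mul_delta_mx.
by rewrite TC.
Qed.

End Frames.

(** * Rigid embeddings *)

Section Characters.

(** The characters of the Klein group, indexed by [e]; [chi e] is the corresponding Fourier
    coefficient of the counts. *)
Definition sgn_lab (e g : lab) : int := (-1) ^+ ((e.1 && g.1) (+) (e.2 && g.2)).
Definition chi (e : lab) (c : lab -> nat) : int := \sum_g sgn_lab e g * (c g)%:Z.

Lemma chiE e c : chi e c =
  (c (false, false))%:Z + (-1) ^+ e.2 * (c (false, true))%:Z +
  ((-1) ^+ e.1 * (c (true, false))%:Z + (-1) ^+ (e.1 (+) e.2) * (c (true, true))%:Z).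
Proof.
rewrite /chi (@sum_pair _ _ _ bool bool) /= !big_bool /sgn_lab /=.
rewrite !(andbF, andbT, addbF, addFb) expr0 mul1r; ring.
Qed.

Lemma chi_conv e c c' : chi e (conv c c') = chi e c * chi e c'.
Proof.
rewrite !chiE /conv !sum_lab /ladd /=; case: e => -[] [] /=.
all: rewrite !(expr0, expr1); ring.
Qed.

(** Fourier inversion on the Klein group. *)
Lemma chi0_const c : (forall e, e != (false, false) -> chi e c = 0) ->
  forall g, c g = c (false, false).
Proof.
move=> chi0; have := chi0 (true, false) isT; have := chi0 (false, true) isT.
have := chi0 (true, true) isT; rewrite !chiE /= !(expr0, expr1) => h1 h2 h3.
by case=> -[] []; lia.
Qed.

(** The unit of [conv]: the label counts of an identity map. *)
Definition ldelta (g : lab) : nat := (g == (false, false)).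

Lemma chi_ldelta e : chi e ldelta = 1.
Proof. by rewrite chiE /ldelta /=; case: e => -[] []. Qed.

Lemma sum_conv c c' : (\sum_g conv c c' g = (\sum_g c g) * (\sum_g c' g))%N.
Proof. rewrite !sum_lab /conv !sum_lab /ladd /=; ring. Qed.

End Characters.

Lemma adjE (R : realType) m n (A : 'M[R[i]]_(m, n)) i j :
  (A^t*) i j = Num.conj (A j i).
Proof. by rewrite !mxE. Qed.

Section BlockProjections.
Variables (R : realType) (n : 'I_4 -> nat).
Local Notation C := R[i].
Local Notation N := (\sum_i n i)%N.
Implicit Types a b : 'I_N.
Local Notation Q := (@block_proj_mx R n).
Local Notation blk := tagnat.sig1.

Lemma block_projE i a b : Q i a b = ((a == b) && (blk a == i))%:R.
Proof.
rewrite mxE -(can_eq (@tagnat.sigK _ _)) /tagnat.sig1 /tagnat.sig2.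
case: (tagnat.sig a) (tagnat.sig b) => [/= j k] [/= j' k'].
have [jj'|njj'] := eqVneq j j'; last first.
  by rewrite mxE -tag_eqE /tag_eq /= (negPf njj').
rewrite -jj' in k' *; rewrite conform_mx_id mxE eq_Tagged /=.
rewrite [i == j]eq_sym; case: (k == k'); case: (j == i); rewrite ?mulr1n //.
Qed.

Lemma mul_block_proj m i (X : 'M[C]_(N, m)) a (b : 'I_m) :
  (Q i *m X) a b = (blk a == i)%:R * X a b.
Proof.
rewrite mxE [LHS](bigD1 a) //= [X in _ + X]big1 => [|k ka]; first by rewrite addr0 block_projE eqxx.
by rewrite block_projE eq_sym (negPf ka) mul0r.
Qed.

Lemma mulmx_block_proj m i (X : 'M[C]_(m, N)) (a : 'I_m) b :
  (X *m Q i) a b = X a b * (blk b == i)%:R.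
Proof.
rewrite mxE [LHS](bigD1 b) //= [X in _ + X]big1 => [|k ka]; first by rewrite addr0 block_projE eqxx.
by rewrite block_projE (negPf ka) mulr0.
Qed.

Lemma block_frame : frame Q.
Proof.
split=> [i|i j|].
- apply/matrixP => a b; rewrite adjE !block_projE rmorph_nat.
  by rewrite eq_sym; case: eqVneq => // ->.
- apply/matrixP => a b; rewrite mul_block_proj [RHS]mxE !block_projE.
  case: (a == b); rewrite ?mulr0 //=.
  by have [->|_] := eqVneq (blk a) i; rewrite ?(mul1r, mulr1, mul0r, mulr0).
- apply/matrixP => a b; rewrite summxE [LHS](bigD1 (blk a)) //= [X in _ + X]big1 => [|i ia].
    by rewrite addr0 block_projE eqxx andbT !mxE.
  by rewrite block_projE [blk a == _]eq_sym (negPf ia) andbF.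
Qed.

Lemma cyc_predE (x : 'M[C]_N) : x \in cyc_pred (R := R) (n := n) <->
  forall a b, ~~ cyc_pos (blk a) (blk b) -> x a b = 0.
Proof.
split=> [/cyc_predP xP a b /xP /matrixP/(_ (tagnat.sig2 a) (tagnat.sig2 b))|xP].
  by rewrite !mxE !tagnat.sig2K.
apply/cyc_predP => i j nij; apply/matrixP => a b.
by rewrite !mxE xP // !tagnat.Rank1K.
Qed.

(** The off-diagonal positions allowed by [cyc_pos] have their row in the first half and their
    column in the second, so the adjoint moves them to forbidden positions. Only the diagonal blocks
    survive both conditions. *)
Lemma block_diagE (x : 'M[C]_N) : (forall i, Q i *m x = x *m Q i) <->
  x \in cyc_pred (R := R) (n := n) /\ x^t* \in cyc_pred (R := R) (n := n).
Proof.
split=> [xQ|[/cyc_predE x1 /cyc_predE x2] i].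
  have x0 a b : blk a != blk b -> x a b = 0.
    move=> ab; have /matrixP/(_ a b) := xQ (blk a).
    by rewrite mul_block_proj mulmx_block_proj eqxx mul1r eq_sym (negPf ab) mulr0.
  split; apply/cyc_predE => a b; rewrite negb_or => /andP[ab _]; first exact: x0.
  by rewrite !mxE x0 ?rmorph0 // eq_sym.
apply/matrixP => a b; rewrite mul_block_proj mulmx_block_proj.
have [ab|nab] := eqVneq (blk a) (blk b); first by rewrite ab mulrC.
suff -> : x a b = 0 by rewrite mulr0 mul0r.
have [pab|/x1//] := boolP (cyc_pos (blk a) (blk b)).
apply: (fmorph_inj (Num.conj : {rmorphism C -> C})); rewrite rmorph0.
have := x2 b a; rewrite !mxE; apply; rewrite /cyc_pos eq_sym (negPf nab) /=.
by move: pab; rewrite /cyc_pos (negPf nab) /= => /andP[_ b2]; rewrite ltnNge b2.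
Qed.

Lemma trace_block_proj i : \tr (Q i) = (n i)%:R.
Proof.
rewrite mxtrace_mxdiag (bigD1 i) //= [X in _ + X]big1 => [|k ki].
  by rewrite addr0 eqxx mxtrace1.
by rewrite eq_sym (negPf ki) raddf0 mxtrace0.
Qed.

Lemma projection_rank k (p : 'M[C]_k) : projection p -> \tr p = (\rank p)%:R.
Proof.
move=> pP; have [W [W1 W2]] := projection_isometry pP (erefl (\rank p)).
by rewrite -[in LHS]W2 mxtrace_mulC W1 mxtrace1.
Qed.

Lemma block_proj_rank i : \rank (Q i) = n i.
Proof.
apply/eqP; rewrite -(eqr_nat C) -projection_rank ?trace_block_proj //.
exact: frame_projection block_frame.
Qed.

End BlockProjections.

Section Rigid.
Variable R : realType.
Local Notation C := R[i].

Lemma cyc_valM (n : 'I_4 -> nat) (a b : four_cycle R n) :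
  cyc_val (a * b) = cyc_val a *m cyc_val b.
Proof. by []. Qed.

Lemma cyc_val1 (n : 'I_4 -> nat) : cyc_val (1 : four_cycle R n) = 1%:M.
Proof. by []. Qed.

Section Blocks.
Variables n n' : 'I_4 -> nat.
Hypothesis n_gt0 : forall i, (0 < n i)%N.
Local Notation N := (\sum_i n i)%N.
Local Notation N' := (\sum_i n' i)%N.
Local Notation Q := (@block_proj_mx R n).
Local Notation Q' := (@block_proj_mx R n').

Definition block_elt i : 'I_N := tagnat.Rank i (Ordinal (n_gt0 i)).

Lemma block_eltE i : tagnat.sig1 (block_elt i) = i.
Proof. exact: tagnat.Rank1K. Qed.

(** Multiplicity one leaves a single Kraus isometry [V]. The type condition, tested on the unit,
    says that [V] carries block [k] into block [theta k]; summing over the blocks gives the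
    grading. *)
Lemma rigid_one_isometry theta (phi : four_cycle R n -> four_cycle R n') :
  rigid_one theta phi -> exists (V : 'M[C]_(N', N)) g,
    [/\ V^t* *m V = 1%:M, theta = act g, graded Q Q' g V
      & forall a, cyc_val (phi a) = V *m cyc_val a *m V^t*].
Proof.
case=> _ [Phi [PhiE Phi1]] /act_surj[g ->] ty.
have [d [V [dE Vi PE]]] := starhom_kraus Phi (block_elt 0).
have d1 : d = 1%N.
  (* A diagonal matrix unit is a rank one projection, and the number of Kraus isometries is the rank
     of its image. *)
  rewrite dE; apply: Phi1; rewrite ?mul_delta_mx ?adj_delta //.
  by rewrite mxrank_delta.
move: V Vi PE; rewrite d1 {d d1 dE} => V Vi PE.
have phiE a : cyc_val (phi a) = V 0 *m cyc_val a *m (V 0)^t*.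
  by rewrite -PhiE PE /kraus big_ord1.
have V1 : (V 0)^t* *m V 0 = 1%:M by rewrite Vi eqxx.
exists (V 0), g; split=> // i.
have [QH QM Q1] := block_frame R n; have [QH' QM' Q1'] := block_frame R n'.
have VQ k : Q' (act g k) *m V 0 *m Q k = V 0 *m Q k.
  have [a' /(congr1 (@cyc_val _ _))] := ty k k 1.
  rewrite phiE !cyc_valM cyc_val1 mulmx1 QM eqxx scale1r /= => E.
  have E2 : Q' (act g k) *m (V 0 *m Q k *m (V 0)^t*) = V 0 *m Q k *m (V 0)^t*.
    by rewrite E !mulmxA QM' eqxx scale1r.
  have := congr1 (mulmx^~ (V 0)) E2.
  by rewrite /= !mulmxA -!(mulmxA _ ((V 0)^t*) (V 0)) V1 !mulmx1.
rewrite -[RHS]mulmx1 -Q1 mulmx_sumr [RHS](bigD1 i) //= [X in _ + X]big1 => [|k ki].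
  by rewrite addr0 VQ.
by rewrite -mulmxA -VQ !mulmxA QM' (inj_eq perm_inj) eq_sym (negPf ki) scale0r !mul0mx.
Qed.

(** The 4-cycle algebra generates all matrices: a matrix unit inside one half is a product of two
    that cross to the other half and back, and those crossing in the forbidden direction are
    adjoints of permitted ones. *)
Lemma starhom_ext (Phi Psi : {starhom 'M[C]_N -> 'M[C]_N'}) :
  (forall a : four_cycle R n, Phi (cyc_val a) = Psi (cyc_val a)) -> Phi =1 Psi.
Proof.
move=> PP x; pose E y := Phi y = Psi y.
have EM y z : E y -> E z -> E (y *m z) by rewrite /E !mxhomM => -> ->.
have ES y : E y -> E (y^t*) by rewrite /E !mxhomS => ->.
pose blk := @tagnat.sig1 4 n.
have E0 a b : cyc_pos (blk a) (blk b) -> E (delta_mx a b).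
  move=> pab; suff yP : delta_mx a b \in cyc_pred (R := R) (n := n) by exact: (PP (FourCycle yP)).
  apply/cyc_predE => k l; rewrite mxE; case: eqP => [->|//].
  by case: eqP => [->|//]; rewrite pab.
have pos (i j : 'I_4) : (i < 2)%N -> ~~ (j < 2)%N -> cyc_pos i j.
  by move=> i2; rewrite -leqNgt => j2; rewrite /cyc_pos i2 j2 orbT.
have E1 a b : E (delta_mx a b).
  have [a2|a2] := boolP (blk a < 2)%N; have [b2|b2] := boolP (blk b < 2)%N.
  - pose c := block_elt (inord 2).
    have c2 : ~~ (blk c < 2)%N by rewrite /blk block_eltE inordK.
    rewrite -(mul_delta_mx c); apply: EM; first exact/E0/pos.
    by rewrite -adj_delta; apply/ES/E0/pos.
  - exact/E0/pos.
  - by rewrite -adj_delta; apply/ES/E0/pos.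
  - pose c := block_elt 0.
    have c2 : (blk c < 2)%N by rewrite /blk block_eltE.
    rewrite -(mul_delta_mx c); apply: EM; last exact/E0/pos.
    by rewrite -adj_delta; apply/ES/E0/pos.
rewrite [x]matrix_sum_delta !linear_sum; apply: eq_bigr => a _ /=.
rewrite !linear_sum; apply: eq_bigr => b _ /=.
by rewrite !linearZ /= E1.
Qed.

Lemma rigid_kraus (phi : rigid_embedding R n n') (Phi : {starhom 'M[C]_N -> 'M[C]_N'}) :
  star_extension (rig_map phi) Phi ->
  exists (V : 'I_(rig_size phi) -> 'M[C]_(N', N)) lam,
    [/\ isometric V, forall s, graded Q Q' (lam s) (V s),
        forall s, rig_type phi s = act (lam s) & Phi =1 kraus V].
Proof.
move=> PhiE.
have /choice[V VP] : forall s : 'I_(rig_size phi), exists V : 'M[C]_(N', N), exists g,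
    [/\ V^t* *m V = 1%:M, rig_type phi s = act g, graded Q Q' g V
      & forall a, cyc_val (rig_summand phi s a) = V *m cyc_val a *m V^t*].
  by move=> s; exact: rigid_one_isometry (rig_rigid s).
have /choice[lam lamP] := VP.
have Vi : isometric V.
  move=> s t; case: (eqVneq s t) => [<-|nst]; first by have [] := lamP s.
  have [Vs _ _ sE] := lamP s; have [Vt _ _ tE] := lamP t.
  (* At the units, [rig_orthogonal] says that the range projections are orthogonal; compressing by
     [V s] and [V t] gives the isometries. *)
  have /(congr1 (@cyc_val _ _)) := rig_orthogonal nst 1 1.
  rewrite cyc_valM sE tE cyc_val1 !mulmx1 => /= E.
  have := congr1 (fun X => (V s)^t* *m X *m V t) E.
  rewrite mulmx0 mul0mx !mulmxA Vs mul1mx -!(mulmxA _ _ (V t)) Vt mulmx1.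
  by move=> ->; rewrite raddf0.
exists V, lam; split=> [//|s|s|]; try by have [] := lamP s.
have [K KE] := kraus_starhom Vi.
move=> x; rewrite -KE; apply: starhom_ext => a.
rewrite PhiE KE /rig_map /kraus.
rewrite (big_morph (@cyc_val R n') (id1 := 0) (op1 := +%R)) //.
by apply: eq_bigr => s _; have [] := lamP s.
Qed.

End Blocks.

End Rigid.

(** * Generic systems *)

Section System.
Variables (R : realType) (S : generic_system R).
Local Notation C := R[i].
Local Notation n := (gs_block S).
Local Notation N k := (\sum_i gs_block S k i)%N.
Local Notation Q k := (@block_proj_mx R (gs_block S k)).
Local Notation B := (gs_B S).

Definition gs_stage k : {starhom 'M[C]_(N k) -> B} :=
  @stage_hom R (fun k => 'M[C]_(N k)) (gs_ext S) k.
Definition block_diagonal k (z : 'M[C]_(N k)) := forall i, Q k i *m z = z *m Q k i.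

Definition gs_count k g := #|summands_of_type (gs_map S k) (act g)|.

Lemma gs_count_gt0 k g : (0 < gs_count k g)%N.
Proof. exact: gs_generic (act_half g). Qed.

Lemma gs_size_gt0 k : (0 < N k)%N.
Proof. by rewrite (bigD1 ord0) //= addn_gt0 gs_block_gt0. Qed.

Lemma gs_kraus k : exists (V : 'I_(rig_size (gs_map S k)) -> 'M[C]_(N k.+1, N k)) lam,
  [/\ isometric V, forall s, graded (Q k) (Q k.+1) (lam s) (V s),
      forall g, fibre lam g = gs_count k g & gs_ext S k =1 kraus V].
Proof.
have [V [lam [Vi Vg lamE PhiE]]] := rigid_kraus (gs_block_gt0 S k) (@gs_extP R S k).
exists V, lam; split=> // g; apply: eq_card => s.
by rewrite !inE lamE (inj_eq act_inj).
Qed.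

Lemma gs_ext_inj k : injective (gs_ext S k).
Proof.
have [V [lam [Vi _ _ PhiE]]] := gs_kraus k.
move=> x y; rewrite !PhiE; apply: (kraus_inj Vi).
by rewrite card_ord rig_size_gt0.
Qed.

Lemma gs_stage_inj k : injective (gs_stage k).
Proof. exact: (@stage_inj R (fun k => 'M[C]_(N k)) (gs_ext S) gs_ext_inj k). Qed.

Lemma gs_stage_link k x : gs_stage k.+1 (gs_ext S k x) = gs_stage k x.
Proof. exact: (@stage_link R (fun k => 'M[C]_(N k)) (gs_ext S) k x). Qed.

Lemma gs_stage_mono k z : exists y, gs_stage k.+1 y = gs_stage k z.
Proof. by exists (gs_ext S k z); exact: gs_stage_link. Qed.

Lemma gs_stage_surj x : exists k z, x = gs_stage k z.
Proof. exact: (@stage_surj R (fun k => 'M[C]_(N k)) (gs_ext S) x). Qed.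

Lemma gs_ext_diag k (z : 'M[C]_(N k)) :
  block_diagonal z <-> block_diagonal (gs_ext S k z).
Proof.
have [V [lam [Vi Vg _ PhiE]]] := gs_kraus k; rewrite PhiE.
have [[QH _ _] [QH' _ _]] := (block_frame R (n k), block_frame R (n k.+1)).
by apply: (kraus_diag QH QH' z Vi _ Vg); rewrite card_ord rig_size_gt0.
Qed.

Local Notation gpush := (@push R (fun k => 'M[C]_(N k)) (gs_ext S)).

Lemma push_diag k m (z : 'M[C]_(N k)) : (k <= m)%N ->
  block_diagonal z <-> block_diagonal (gpush z m).
Proof.
move=> /subnK <-; elim: (m - k)%N => [|d IH]; first by rewrite push_id.
rewrite addSn pushS ?leq_addl //; exact: iff_trans IH (gs_ext_diag _).
Qed.

(** Membership in the limit speaks only of late stages; it descends to stage [k] because the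
    connecting maps reflect block diagonality. *)
Lemma gs_diagonal_stage k (z : 'M[C]_(N k)) :
  gs_diagonal S (gs_stage k z) <-> block_diagonal z.
Proof.
split=> [[[t [tE [M tM]]] [_ [t' [-> [M' tM']]] sE]]|zd].
  have [L HL] := (dirlim_eqP _ _).1 tE.
  move: sE; rewrite tE starlim_starE => /dirlim_eqP[L' HL'].
  pose m := maxn k (maxn (maxn M M') (maxn L L')).
  have km : (k <= m)%N by rewrite leq_max leqnn.
  apply/(push_diag z km); apply/block_diagE.
  have -> : gpush z m = t m by apply: HL; rewrite !leq_max leqnn ?orbT.
  split; first by apply: tM; rewrite !leq_max leqnn ?orbT.
  have <- : star (t' m) = t m by apply: HL'; rewrite !leq_max leqnn ?orbT.
  by rewrite [star _]/(_^t*) trmxCK; apply: tM'; rewrite !leq_max leqnn ?orbT.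
have pd m : (k <= m)%N -> gpush z m \in cyc_pred (R := R) (n := n m) /\
    (gpush z m)^t* \in cyc_pred (R := R) (n := n m).
  by move=> km; apply/block_diagE; exact: (push_diag z km).1.
split.
  exists (push_thread (gs_ext S) z); split=> //.
  by exists k => m km /=; have [] := pd m km.
exists (star (gs_stage k z)); last by rewrite starK.
exists (threadS (push_thread (gs_ext S) z)); split; first by rewrite starlim_starE.
by exists k => m km /=; have [] := pd m km.
Qed.

Section Links.
Variable k0 : nat.
Hypothesis unital : forall k, (k0 <= k)%N -> gs_ext S k 1%:M = 1%:M.

Definition links k l c := exists f : 'M[C]_(N k) -> 'M[C]_(N l),
  linked (Q k) (Q l) c f /\ forall x, gs_stage l (f x) = gs_stage k x.

Lemma links_refl k : links k k ldelta.
Proof.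
exists id; split=> //; exists unit, (fun=> 1%:M), (fun=> (false, false)); split.
- by move=> [] []; rewrite adj1 mulmx1 eqxx.
- by rewrite /complete big_const card_unit /= adj1 mulmx1 addr0.
- by move=> s i; rewrite mul1mx mulmx1 /act /= mulg1 perm1.
- by move=> g; rewrite fibre_sum big_const card_unit /= addn0 /ldelta eq_sym.
- by move=> x; rewrite /kraus big_const card_unit /= adj1 mulmx1 mul1mx addr0.
Qed.

Lemma links_trans k l m c c' : links k l c -> links l m c' -> links k m (conv c' c).
Proof.
move=> [f [fL fE]] [g [gL gE]]; exists (g \o f); split; first exact: linked_comp fL gL.
by move=> x; rewrite /= gE fE.
Qed.

Lemma links_step k : (k0 <= k)%N -> links k k.+1 (gs_count k).
Proof.
move=> k0k; exists (gs_ext S k); split; last exact: gs_stage_link.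
have [V [lam [Vi Vg Vf PhiE]]] := gs_kraus k.
exists 'I_(rig_size (gs_map S k)), V, lam; split=> //.
by rewrite /complete -kraus1 -PhiE unital.
Qed.

Fixpoint gs_counts k d : lab -> nat :=
  if d is d'.+1 then conv (gs_count (d' + k)) (gs_counts k d') else ldelta.

Lemma links_counts k d : (k0 <= k)%N -> links k (d + k) (gs_counts k d).
Proof.
move=> k0k; elim: d => [|d IH]; first exact: links_refl.
by apply: links_trans IH (links_step _); exact: leq_trans k0k (leq_addl _ _).
Qed.

(** A generic map has a summand of each of the four types, so each step multiplies the total count
    by at least 4. *)
Lemma gs_counts_ge k d : (4 ^ d <= \sum_g gs_counts k d g)%N.
Proof.
elim: d => [|d IH]; first by rewrite sum_lab.
rewrite sum_conv expnS leq_mul // sum_lab.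
have := gs_count_gt0 (d + k); move=> H.
have := H (false, false); have := H (false, true); have := H (true, false).
have := H (true, true); lia.
Qed.

Lemma links_size k l c : links k l c -> N l = ((\sum_g c g) * N k)%N.
Proof.
move=> [f [[T [V [lam [Vi Vc _ Vf _]]]] _]].
rewrite (complete_dim Vi Vc) (card_fibre lam); congr (_ * _)%N.
exact: eq_bigr.
Qed.

(** Moving [Q l i] past [V s] turns it into [Q k (act (lam s) i)], and the trace does not see
    conjugation by an isometry; the terms are then grouped by label. *)
Lemma links_trace k l c f i x : linked (Q k) (Q l) c f ->
  \tr (Q l i *m f x) = \sum_g (c g)%:R * \tr (Q k (act g i) *m x).
Proof.
move=> [T [V [lam [Vi Vc Vg Vf fE]]]]; rewrite fE /kraus mulmx_sumr raddf_sum /=.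
rewrite (partition_big lam xpredT) //=; apply: eq_bigr => g _.
rewrite (eq_bigr (fun=> \tr (Q k (act g i) *m x))) => [|s /eqP <-].
  by rewrite sumr_const -Vf mulr_natl /fibre; congr (_ *+ _); apply: eq_card => s; rewrite !inE.
have -> : Q l i *m (V s *m x *m (V s)^t*) = V s *m (Q k (act (lam s) i) *m x) *m (V s)^t*.
  by rewrite !mulmxA Vg act_inv.
by rewrite [LHS]mxtrace_mulC !mulmxA (isometric_mul1 Vi) mul1mx.
Qed.

End Links.
End System.

(** * Uniqueness *)

Section StarAlgebra.
Variables (R : realType) (A : starAlgType R).

Lemma smul0l (a : A) : smul 0 a = 0.
Proof. by rewrite -[X in smul X a](scale0r (0 : A)) smulZl scale0r. Qed.

Lemma smul0r (a : A) : smul a 0 = 0.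
Proof. by rewrite -[X in smul a X](scale0r (0 : A)) smulZr scale0r. Qed.

Lemma star0 : star (0 : A) = 0.
Proof. by rewrite -[X in star X](scale0r (0 : A)) starZ rmorph0 scale0r. Qed.

End StarAlgebra.

(** For distinct exponents the sum is a power of 2 times an odd number larger than 1. *)
Lemma pow2_add a b c : (2 ^ a + 2 ^ b = 2 ^ c)%N -> a = b.
Proof.
have gt a' b' : (a' < b')%N -> (2 ^ a' + 2 ^ b' = 2 ^ c)%N -> False.
  move=> ab E; have ac : (a' < c)%N.
    rewrite -(ltn_exp2l _ _ (isT : (1 < 2)%N)) -E -{1}[(2 ^ a')%N]addn0 ltn_add2l.
    by rewrite expn_gt0.
  have : (2 ^ a' * (1 + 2 ^ (b' - a')) = 2 ^ a' * 2 ^ (c - a'))%N.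
    by rewrite mulnDr muln1 -!expnD (subnKC (ltnW ab)) (subnKC (ltnW ac)).
  move/eqP; rewrite eqn_pmul2l ?expn_gt0 // => /eqP/(congr1 odd).
  rewrite oddD !oddX /= !orbF; lia.
case: (ltngtP a b) => // ab; [move/(gt a b ab) | rewrite addnC; move/(gt b a ab)] => //.
Qed.

(** * The two halves of the set of blocks *)

Section BlockLabels.

Definition blk0 (h : bool) : 'I_4 := inord (if h then 2 else 0).
Definition blk1 (h : bool) : 'I_4 := inord (if h then 3 else 1).
Definition swaps (h : bool) (g : lab) := if h then g.2 else g.1.

Lemma act_blk0 h g : act g (blk0 h) = if swaps h g then blk1 h else blk0 h.
Proof.
apply: ord_inj; rewrite act_nat (fun_if (@nat_of_ord 4)) /blk0 /blk1.
by case: h; case: g => -[] []; rewrite /= ?inordK.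
Qed.

Lemma act_blk1 h g : act g (blk1 h) = if swaps h g then blk0 h else blk1 h.
Proof.
apply: ord_inj; rewrite act_nat (fun_if (@nat_of_ord 4)) /blk0 /blk1.
by case: h; case: g => -[] []; rewrite /= ?inordK.
Qed.

Lemma blk01 h : blk0 h == blk1 h = false.
Proof. by rewrite -val_eqE /= !inordK; case: h. Qed.

Lemma blk_half h (i : 'I_4) : (i == blk0 h) || (i == blk1 h) = ~~ ((i == blk0 (~~ h)) || (i == blk1 (~~ h))).
Proof.
by rewrite -!val_eqE /= !inordK; case: h => //; case: i => [[|[|[|[|//]]]] hi].
Qed.

Lemma blk_lt2 h : ((blk0 h < 2)%N = ~~ h) * ((blk1 h < 2)%N = ~~ h).
Proof. by rewrite /= !inordK; case: h. Qed.

Lemma big_blk (V : nmodType) (F : 'I_4 -> V) : \sum_i F i =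
  (F (blk0 false) + F (blk1 false)) + (F (blk0 true) + F (blk1 true)).
Proof.
rewrite !big_ord_recl big_ord0 addr0 !addrA.
by congr (F _ + F _ + F _ + F _); apply: val_inj; rewrite /= inordK.
Qed.

End BlockLabels.

(** Translating the labels by the one that exchanges the two blocks of the half [h] permutes the
    terms. *)
Lemma sum_act_blk (V : nmodType) (t : 'I_4 -> V) h :
  \sum_g t (act g (blk0 h)) = \sum_g t (act g (blk1 h)).
Proof.
pose s : lab := if h then (false, true) else (true, false).
have s01 : act s (blk0 h) = blk1 h by rewrite act_blk0 /swaps /s; case: (h).
rewrite (reindex_inj (inv_inj (laddK s))) /=; apply: eq_bigr => g _.
by rewrite laddC act_ladd s01.
Qed.

Lemma actE g : act g = ((if g.1 then perm12 else 1) * (if g.2 then perm34 else 1))%g.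
Proof. by []. Qed.

(* Unification would otherwise evaluate inord. *)
#[global] Opaque blk0 blk1 act.

(** * Unit, centre and unital matrix subalgebras of F *)

Section UHFAlgebra.
Variables (R : realType).
Variable j : forall k : nat, {starhom 'M[R[i]]_(2 ^ k) -> 'M[R[i]]_(2 ^ k.+1)}.
Hypothesis j_unital : forall k : nat, j k 1%:M = 1%:M.
Local Notation C := R[i].
Local Notation F := (starlim j).

Definition uhf_stage k : {starhom 'M[C]_(2 ^ k) -> F} :=
  @stage_hom R (fun k => 'M[C]_(2 ^ k)) j k.
Definition uhf1 : F := uhf_stage 0 1%:M.

Lemma uhf_stage1 k : uhf_stage k 1%:M = uhf1.
Proof. by elim: k => [//|k IH]; rewrite -IH; exact: uhf_stage_unit. Qed.

Lemma uhf_surj (x : F) : exists k z, x = uhf_stage k z.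
Proof. exact: (@stage_surj R (fun k => 'M[C]_(2 ^ k)) j x). Qed.

Lemma uhf_stage_injective k : injective (uhf_stage k).
Proof. exact: uhf_stage_inj. Qed.

Lemma uhf_mul1 (x : F) : smul uhf1 x = x.
Proof.
have [k [z ->]] := uhf_surj x.
by rewrite -(uhf_stage1 k) -starhomM; congr (uhf_stage k _); exact: mul1mx.
Qed.

Lemma uhf_mulr1 (x : F) : smul x uhf1 = x.
Proof.
have [k [z ->]] := uhf_surj x.
by rewrite -(uhf_stage1 k) -starhomM; congr (uhf_stage k _); exact: mulmx1.
Qed.

Lemma uhf_lift p (phi : {starhom 'M[C]_p -> F}) : exists l (psi : {starhom 'M[C]_p -> 'M[C]_(2 ^ l)}),
  forall x, uhf_stage l (psi x) = phi x.
Proof.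
have [x|K /(_ K (leqnn _)) HK] := finite_stage (h := uhf_stage) (@uhf_stage_mono R j) (ka := phi).
  exact: uhf_surj.
by have [psi psiE] := lift_starhom (@uhf_stage_injective K) HK; exists K, psi.
Qed.

(** The image lies in a single stage of [F], where a complete Kraus family makes [p] divide
    [2 ^ l]. *)
Lemma uhf_unital_pow2 p (phi : {starhom 'M[C]_p -> F}) :
  (0 < p)%N -> phi 1%:M = uhf1 -> exists a, p = (2 ^ a)%N.
Proof.
case: p phi => [//|p] phi _ phi1; have [l [psi psiE]] := uhf_lift phi.
have psi1 : psi 1%:M = 1%:M by apply: (@uhf_stage_injective l); rewrite psiE phi1 uhf_stage1.
have [d [V [_ Vi VE]]] := starhom_kraus psi ord0.
have Vc : complete V by rewrite /complete -kraus1 -VE.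
have : (p.+1 %| 2 ^ l)%N by rewrite (complete_dim Vi Vc) dvdn_mull.
by move=> /(dvdn_pfactor _ _ (isT : prime 2))[a _ ->]; exists a.
Qed.

Lemma mx_central n (Z : 'M[C]_n) (i0 : 'I_n) : (forall Y, Z *m Y = Y *m Z) -> Z = (Z i0 i0)%:M.
Proof.
move=> ZY; rewrite -[LHS]mulmx1 -[RHS]scalemx1 mx1_sum_delta.
rewrite mulmx_sumr scaler_sumr; apply: eq_bigr => a _.
by rewrite -[X in Z *m X](mul_delta_mx i0) mulmxA ZY delta_sandwich.
Qed.

(** A central element is a scalar at the stage that contains it, and an idempotent scalar is 0 or
    1. *)
Lemma uhf_central (z : F) : (forall w, smul z w = smul w z) -> smul z z = z ->
  z = 0 \/ z = uhf1.
Proof.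
move=> zC zz; have [k [Z zE]] := uhf_surj z.
have i0 : 'I_(2 ^ k) by exists 0%N; rewrite expn_gt0.
have ZC Y : Z *m Y = Y *m Z.
  apply: (@uhf_stage_injective k).
  have := zC (uhf_stage k Y); rewrite zE -!starhomM; exact.
have ZZ : Z *m Z = Z by apply: (@uhf_stage_injective k); move: zz; rewrite zE -starhomM.
have := mx_central i0 ZC; set c := Z i0 i0 => Zc.
have cc : c * c = c.
  have := congr1 (fun X : 'M[C]__ => X i0 i0) ZZ.
  by rewrite Zc -scalar_mxM !mxE eqxx !mulr1n.
have /eqP : c * (c - 1) = 0 by rewrite mulrBr cc mulr1 subrr.
rewrite mulf_eq0 subr_eq0 => /orP[] /eqP c0; [left|right]; rewrite zE Zc c0.
  by rewrite raddf0 linear0.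
exact: uhf_stage1.
Qed.

End UHFAlgebra.

Definition half (R : realType) n (Q : 'I_4 -> 'M[R[i]]_n) h := Q (blk0 h) + Q (blk1 h).

Section Half.
Variables (R : realType) (m n : nat).
Local Notation C := R[i].

Lemma graded_half (Q : 'I_4 -> 'M[C]_n) (Q' : 'I_4 -> 'M[C]_m) g V h :
  graded Q Q' g V -> V *m half Q h = half Q' h *m V.
Proof.
move=> gV; rewrite mulmxDr mulmxDl !gV act_blk0 act_blk1.
by case: (swaps h g); first rewrite addrC.
Qed.

Section FrameHalf.
Variable Q : 'I_4 -> 'M[C]_n.
Hypothesis fQ : frame Q.

Lemma half_sum : half Q false + half Q true = 1%:M.
Proof. by case: fQ => _ _ <-; rewrite big_blk. Qed.

Lemma half_mul h : half Q h *m half Q h = half Q h.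
Proof.
have [_ QM _] := fQ; rewrite mulmxDl !mulmxDr !QM blk01 eq_sym blk01 !eqxx.
by rewrite !scale0r !scale1r addr0 add0r.
Qed.

Lemma half_orth h : half Q h *m half Q (~~ h) = 0.
Proof.
have [_ QM _] := fQ; rewrite mulmxDl !mulmxDr !QM.
have D (i k : 'I_4) : (i < 2)%N != (k < 2)%N -> (i == k) = false.
  by apply: contraNF => /eqP->.
by rewrite !D ?scale0r ?addr0 ?blk_lt2 //; case: h.
Qed.

Lemma half_diag h i : Q i *m half Q h = half Q h *m Q i.
Proof.
have [_ QM _] := fQ; rewrite mulmxDl mulmxDr !QM.
by congr (_ + _); case: eqVneq => [->|_]; rewrite ?scale0r.
Qed.

Lemma half_comb_diag h a b i :
  Q i *m (a *: Q (blk0 h) - b *: Q (blk1 h)) = (a *: Q (blk0 h) - b *: Q (blk1 h)) *m Q i.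
Proof.
have [_ QM _] := fQ; rewrite mulmxBr mulmxBl -!scalemxAr -!scalemxAl !QM.
have E k : (i == k)%:R *: Q i = (k == i)%:R *: Q k.
  by case: eqVneq => [->|_]; rewrite ?scale0r.
by rewrite !E.
Qed.

Lemma half_comb h a b : half Q h *m (a *: Q (blk0 h) - b *: Q (blk1 h)) =
  a *: Q (blk0 h) - b *: Q (blk1 h).
Proof.
have [_ QM _] := fQ.
rewrite mulmxDl !mulmxBr -!scalemxAr !QM !eqxx [blk1 h == _]eq_sym blk01.
by rewrite !scale0r !scaler0 !scale1r subr0 sub0r.
Qed.

End FrameHalf.
End Half.

Section Uniqueness.
Variable R : realType.
Variable j : forall k : nat, {starhom 'M[R[i]]_(2 ^ k) -> 'M[R[i]]_(2 ^ k.+1)}.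
Hypothesis j_unital : forall k : nat, j k 1%:M = 1%:M.
Local Notation C := R[i].
Local Notation F := (starlim j).
Local Notation uhf1 := (uhf1 j).
Variables (S : generic_system R) (pi : {starhom F * F -> F}) (Psi : {starhom F -> gs_B S}).
Hypotheses (pi_inj : injective pi) (Psi_bij : bijective Psi).
Hypothesis Psi_range : (Psi @` range pi)%classic = gs_diagonal S.
Local Notation n := (gs_block S).
Local Notation N k := (\sum_i gs_block S k i)%N.
Local Notation Q k := (@block_proj_mx R (gs_block S k)).
Local Notation B := (gs_B S).

Let theta w : B := Psi (pi w).

Lemma gs_diagonalE y : gs_diagonal S y <-> exists w, theta w = y.
Proof.
rewrite -Psi_range; split=> [[_ [w _ <-] <-]|[w <-]]; first by exists w.
by exists (pi w) => //; exists w.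
Qed.

Let theta_inj : injective theta.
Proof. by move=> w w' /(bij_inj Psi_bij)/pi_inj. Qed.

Let thetaM w w' : theta (smul w w') = smul (theta w) (theta w').
Proof. by rewrite /theta !starhomM. Qed.

(** The connecting maps are not assumed unital, but [B], being a copy of [F], has a unit; in every
    stage that contains it, it is the identity matrix. *)
Lemma eventually_unital :
  exists k0, forall k, (k0 <= k)%N -> gs_ext S k 1%:M = 1%:M.
Proof.
have uE y : smul (Psi uhf1) y = y.
  have [Psi' _ PsiK] := Psi_bij.
  by rewrite -(PsiK y) -starhomM uhf_mul1.
have [k0 [U UE]] := gs_stage_surj (Psi uhf1).
have u1 k : (k0 <= k)%N -> Psi uhf1 = gs_stage S k 1%:M.
  move=> /(range_mono (@gs_stage_mono R S) U)[U' U'E].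
  rewrite UE -U'E; congr (gs_stage S k _); apply: (@gs_stage_inj R S k).
  by rewrite -[in LHS](mulmx1 U') [LHS]starhomM U'E -UE uE.
exists k0 => k k0k; apply: (@gs_stage_inj R S k.+1).
by rewrite gs_stage_link -!u1 // leqW.
Qed.

Variable k0 : nat.
Hypothesis unital : forall k, (k0 <= k)%N -> gs_ext S k 1%:M = 1%:M.

Lemma gs_stage_above (y : B) : exists k z, (k0 <= k)%N /\ y = gs_stage S k z.
Proof.
have [k [z ->]] := gs_stage_surj y.
have [z' zz'] := range_mono (@gs_stage_mono R S) z (leq_maxl k k0).
by exists (maxn k k0), z'; rewrite zz' leq_maxr.
Qed.

Definition gs_half h : B := gs_stage S k0 (half (Q k0) h).

(** Labels preserve the halves, so every Kraus isometry intertwines the projections onto a half, and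
    a unital connecting map carries one to the next. *)
Lemma gs_halfE h k : (k0 <= k)%N -> gs_stage S k (half (Q k) h) = gs_half h.
Proof.
move=> /subnK <-; elim: (k - k0)%N => [//|d <-].
rewrite -[RHS]gs_stage_link; congr (gs_stage S _ _).
have [V [lam [_ Vg _ fE]]] := gs_kraus S (d + k0).
rewrite -[LHS]mulmx1 -(unital (leq_addl d k0)) !fE /kraus mulmx_sumr.
by apply: eq_bigr => s _; rewrite !mulmx1 mulmxA (graded_half h (Vg s)).
Qed.

Lemma gs_half_diagonal h : gs_diagonal S (gs_half h).
Proof. by apply/gs_diagonal_stage => i; exact: half_diag (block_frame _ _) _ _. Qed.

Lemma gs_half_comm h y : gs_diagonal S y -> smul (gs_half h) y = smul y (gs_half h).
Proof.
have [k [z [kk ->]]] := gs_stage_above y => /gs_diagonal_stage zd.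
rewrite -(gs_halfE h kk) -!starhomM; congr (gs_stage S k _).
by rewrite [LHS]mulmxDl [RHS]mulmxDr !zd.
Qed.

Lemma gs_half_mul h : smul (gs_half h) (gs_half h) = gs_half h.
Proof.
rewrite /gs_half -starhomM; congr (gs_stage S k0 _).
exact: half_mul (block_frame _ _) h.
Qed.

Lemma gs_half_orth h : smul (gs_half h) (gs_half (~~ h)) = 0.
Proof.
rewrite /gs_half -starhomM [smul _ _](half_orth (block_frame R _)).
exact: linear0.
Qed.

Lemma half_trace k h : \tr (half (Q k) h) = (n k (blk0 h) + n k (blk1 h))%:R.
Proof. by rewrite raddfD /= !trace_block_proj natrD. Qed.

Lemma gs_half_neq0 h : gs_half h <> 0.
Proof.
rewrite -(linear0 (gs_stage S k0)) => /(@gs_stage_inj R S k0).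
move=> /(congr1 (@mxtrace _ _))/eqP; rewrite half_trace mxtrace0 pnatr_eq0.
by rewrite addn_eq0 -leqn0 leqNgt gs_block_gt0.
Qed.

(* The central projection onto a half of the diagonal comes from one of the
   two copies of F, because F has no other central projections than 0 and 1. *)
Lemma half_corner h : exists ka : {starhom F -> B},
  [/\ injective ka, ka uhf1 = gs_half h, forall x, gs_diagonal S (ka x)
    & forall y, gs_diagonal S y -> smul (gs_half h) y = y -> exists x, ka x = y].
Proof.
have [z zE] := (gs_diagonalE _).1 (gs_half_diagonal h).
have [z' z'E] := (gs_diagonalE _).1 (gs_half_diagonal (~~ h)).
have zC w : smul z w = smul w z.
  apply: theta_inj; rewrite !thetaM zE gs_half_comm //.
  by apply/gs_diagonalE; exists w.
have zz : smul z z = z by apply: theta_inj; rewrite thetaM zE gs_half_mul.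
have z1 : z.1 = 0 \/ z.1 = uhf1.
  apply: uhf_central => // [w|]; last by have := congr1 fst zz.
  by have := congr1 fst (zC (w, 0)).
have z2 : z.2 = 0 \/ z.2 = uhf1.
  apply: uhf_central => // [w|]; last by have := congr1 snd zz.
  by have := congr1 snd (zC (0, w)).
have theta0 : theta 0 = 0 by rewrite /theta !linear0.
have corner (inc : F -> F * F) (prj : F * F -> F) : linear inc ->
    {morph inc : x y / smul x y} -> {morph inc : x / star x} ->
    cancel inc prj -> inc uhf1 = z -> (forall w, smul z w = w -> inc (prj w) = w) ->
    exists ka : {starhom F -> B}, [/\ injective ka, ka uhf1 = gs_half h,
      forall x, gs_diagonal S (ka x)
    & forall y, gs_diagonal S y -> smul (gs_half h) y = y -> exists x, ka x = y].
  move=> iL iM iS iK i1 iP.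
  have [||| ka kaE] := starhom_of (f := fun x => theta (inc x)).
  - by move=> c x y; rewrite iL /theta !linearP.
  - by move=> x y; rewrite iM thetaM.
  - by move=> x; rewrite iS /theta !starhomS.
  exists ka; split.
  - by move=> x y; rewrite !kaE => /theta_inj/(can_inj iK).
  - by rewrite kaE i1.
  - by move=> x; rewrite kaE; apply/gs_diagonalE; exists (inc x).
  - move=> y /gs_diagonalE[w <-]; rewrite -zE -thetaM => /theta_inj zw.
    by exists (prj w); rewrite kaE iP.
(* If both components were 0, or both 1, the half or its complement would vanish; the two mixed
   cases single out one copy of [F]. *)
case: z1 z2 => z1 [] z2.
- by case: (gs_half_neq0 (h := h)); rewrite -zE (_ : z = 0) //; apply: injective_projections.
- apply: (corner (fun x => (0, x)) snd) => //.
  + by move=> c x y; congr (_, _); rewrite /= scaler0 addr0.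
  + by move=> x y; congr (_, _); rewrite /= smul0l.
  + by move=> x; congr (_, _); rewrite /= star0.
  + by apply: injective_projections; rewrite /= ?z1 ?z2.
  + move=> w zw; apply: injective_projections => //=.
    by have := congr1 fst zw; rewrite /= z1 smul0l.
- apply: (corner (fun x => (x, 0)) fst) => //.
  + by move=> c x y; congr (_, _); rewrite /= scaler0 addr0.
  + by move=> x y; congr (_, _); rewrite /= smul0l.
  + by move=> x; congr (_, _); rewrite /= star0.
  + by apply: injective_projections; rewrite /= ?z1 ?z2.
  + move=> w zw; apply: injective_projections => //=.
    by have := congr1 snd zw; rewrite /= z2 smul0l.
- case: (gs_half_neq0 (h := ~~ h)).
  rewrite -(gs_half_orth h) -z'E -zE -thetaM; congr theta.
  by apply: injective_projections; rewrite /= ?z1 ?z2 uhf_mul1.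
Qed.

(** A matrix algebra placed in a half of the diagonal with the unit of that half maps unitally to
    [F], which constrains its size. *)
Lemma half_unital_starhom h k p (mu : {starhom 'M[C]_p -> 'M[C]_(N k)}) :
  (k0 <= k)%N -> mu 1%:M = half (Q k) h -> (forall x, block_diagonal (mu x)) ->
  exists xi : {starhom 'M[C]_p -> F}, xi 1%:M = uhf1.
Proof.
move=> kk mu1 mud; have [ka [ki k1 kd kP]] := half_corner h.
have [G GE] := starhom_comp (gs_stage S k) mu.
have [x|xi xiE] := lift_starhom (ka := G) ki.
  rewrite GE; apply: kP; first exact/gs_diagonal_stage.
  rewrite -(gs_halfE h kk) -starhomM; congr (gs_stage S k _).
  by rewrite -mu1 -starhomM; congr (mu _); exact: mul1mx.
by exists xi; apply: ki; rewrite xiE GE mu1 k1 gs_halfE.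
Qed.

(** For X = n_1 Q_0 - n_0 Q_1 the trace of Q_0 X is n_0 n_1 and that of Q_1 X is its negative. A
    label thus contributes the sign telling whether it exchanges the two blocks, and this sign is
    the character [e]. *)
Lemma chi_swaps h c k : let e : lab := if h then (false, true) else (true, false) in
  (\sum_g (c g)%:R * \tr (Q k (act g (blk0 h)) *m
     ((n k (blk1 h))%:R *: Q k (blk0 h) - (n k (blk0 h))%:R *: Q k (blk1 h))) : C) =
  (n k (blk0 h) * n k (blk1 h))%:R * (chi e c)%:~R.
Proof.
have [_ QM _] := block_frame R (n k).
rewrite /chi raddf_sum /= mulr_sumr; apply: eq_bigr => g _.
rewrite act_blk0 mulmxBr -!scalemxAr.
rewrite natrM intrM -pmulrn /sgn_lab.
case E: (swaps h g); rewrite !QM ?eqxx ?[blk1 h == _]eq_sym blk01 scale0r scaler0 scale1r.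
  rewrite sub0r raddfN /= mxtraceZ trace_block_proj.
  have -> : (if h then (false, true) else (true, false)).1 && g.1
     (+) ((if h then (false, true) else (true, false)).2 && g.2) = true.
    by move: E; rewrite /swaps; case: h => /= ->; rewrite ?addbF.
  by rewrite /= expr1 rmorphN rmorph1; ring.
rewrite subr0 mxtraceZ trace_block_proj.
have -> : (if h then (false, true) else (true, false)).1 && g.1
     (+) ((if h then (false, true) else (true, false)).2 && g.2) = false.
  by move: E; rewrite /swaps; case: h => /= ->; rewrite ?addbF.
by rewrite /= expr0 rmorph1; ring.
Qed.

(* X = n_1 Q_0 - n_0 Q_1 has trace zero and lies in one copy of F. A tracial
   functional on a stage of F is a multiple of the trace, so tr(Q_0 X) vanishes
   at a later stage; its value there is n_0 n_1 times the character. *)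
Lemma half_chi_vanishes h k : (k0 <= k)%N ->
  exists d, chi (if h then (false, true) else (true, false)) (gs_counts S k d) = 0.
Proof.
move=> kk; have [ka [ki k1 kd kP]] := half_corner h.
have [_ QM _] := block_frame R (n k).
pose X := (n k (blk1 h))%:R *: Q k (blk0 h) - (n k (blk0 h))%:R *: Q k (blk1 h).
have Xd : block_diagonal X by move=> i; exact: half_comb_diag (block_frame R (n k)) _ _ _ _.
have EX : half (Q k) h *m X = X by exact: half_comb (block_frame R (n k)) _ _ _.
have trX : \tr X = 0.
  by rewrite raddfB /= !mxtraceZ !trace_block_proj mulrC subrr.
have [x xE] : exists x, ka x = gs_stage S k X.
  apply: kP; first exact/gs_diagonal_stage.
  by rewrite -(gs_halfE h kk) -starhomM; congr (gs_stage S k _).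
have [l [W WE]] := uhf_surj x.
have [G GE] := starhom_comp ka (uhf_stage j l).
(* The stage of [F] that contains [x] maps into a single stage of the system, taken to be
   [K + k]. *)
have [y|K HK] := finite_stage (h := gs_stage S) (@gs_stage_mono R S) (ka := G).
  exact: gs_stage_surj.
have [f [fL fE]] := links_counts unital K kk.
set m := (K + k)%N in f fL fE.
have km : (k0 <= m)%N by exact: leq_trans kk (leq_addl _ _).
have [ka' kaE] := lift_starhom (@gs_stage_inj R S m) (HK m (leq_addr _ _)).
have kaW : ka' W = f X.
  by apply: (@gs_stage_inj R S m); rewrite kaE fE GE -WE.
have ka1 : ka' 1%:M = half (Q m) h.
  by apply: (@gs_stage_inj R S m); rewrite kaE GE uhf_stage1 // k1 gs_halfE.
have kad y : block_diagonal (ka' y).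
  by apply/gs_diagonal_stage; rewrite kaE GE.
have n0 : (2 ^ l)%:R != 0 :> C by rewrite pnatr_eq0 -lt0n expn_gt0.
have trf : \tr (f X) = 0.
  move: fL => [T [V [lam [Vi _ _ _ VE]]]].
  by rewrite VE (kraus_trace Vi) trX mulr0.
(* The trace pulled back along [ka'] is a multiple of the trace, vanishes at [W] and is nonzero at
   1. *)
have trW : \tr W = 0.
  have := @trace_unique R _ (fun y => \tr (ka' y)) W.
  rewrite kaW trf mulr0 ka1 half_trace => /(_ _ _)/esym/eqP.
  rewrite mulf_eq0 pnatr_eq0 addn_eq0 [X in _ || (X && _)]eqn0Ngt gs_block_gt0 orbF => H.
  apply/eqP/H => [c y z|y z]; first by rewrite !linearP.
  by rewrite !mxhomM mxtrace_mulC.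
(* The block projection commutes with the image of [ka'], so weighting the pulled back trace by it
   still gives a tracial functional. *)
have trQ : \tr (Q m (blk0 h) *m f X) = 0.
  have := @trace_unique R _ (fun y => \tr (Q m (blk0 h) *m ka' y)) W.
  rewrite kaW trW mul0r => H; apply/eqP; rewrite -(mulrI_eq0 _ (mulfI n0)); apply/eqP/H.
    by move=> c y z; rewrite linearP mulmxDr -scalemxAr linearP.
  move=> y z; rewrite !mxhomM mulmxA (kad y) -mulmxA mxtrace_mulC -mulmxA.
  by [].
exists K; move: trQ; rewrite (links_trace _ _ fL) chi_swaps => /eqP.
rewrite mulf_eq0 pnatr_eq0 muln_eq0 !eqn0Ngt !gs_block_gt0 /= intr_eq0.
by move/eqP.
Qed.

Hypothesis H1_0 : forall x : gs_H1 S, x = 0.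

Lemma chi_gs_count k : chi (true, true) (gs_count S k) = H1_mult (gs_map S k).
Proof.
rewrite chiE /gs_count /H1_mult !actE /= !mulg1 !mul1g mulN1r mulN1r mul1r !PoszD; ring.
Qed.

(** The partial products of the multipliers from level [k] on form the thread of the generator of
    H_1(A_k). Its class is 0, so some product vanishes, and that product is the character of the
    composite. *)
Lemma H1_chi_vanishes k : exists d, chi (true, true) (gs_counts S k d) = 0.
Proof.
have tP : exists M, forall m, (M <= m)%N ->
    \prod_(k <= i < m.+1) H1_mult (gs_map S i) =
    (H1_mult (gs_map S m) \*o idfun) (\prod_(k <= i < m) H1_mult (gs_map S i)) :> int.
  by exists k => m km /=; rewrite big_nat_recr //= mulrC.
pose t := @Thread (fun=> int) (fun k => H1_mult (gs_map S k) \*o idfun)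
  (fun m => \prod_(k <= i < m) H1_mult (gs_map S i)) tP.
have : \pi_(gs_H1 S) t = \pi_(gs_H1 S) (thread0 _) by rewrite [LHS]H1_0 [RHS]H1_0.
move=> /dirlim_eqP[M /(_ (M + k)%N (leq_addr _ _)) /= E]; exists M.
rewrite -[RHS]E; elim: M {E} => [|d IH]; first by rewrite big_geq // chi_ldelta.
rewrite /= chi_conv IH addSn big_nat_recr ?leq_addl //= chi_gs_count.
by rewrite mulrC.
Qed.

(** The three nontrivial characters are killed one after the other. A character once zero stays zero
    by multiplicativity, so the counts are constant at every later stage. *)
Lemma balanced_links k : (k0 <= k)%N ->
  exists L, forall l, (L <= l)%N -> (k0 <= l)%N /\ exists e, links S k l (fun=> e).
Proof.
move=> kk.
have [d1 E1] := half_chi_vanishes false kk.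
have kk1 : (k0 <= d1 + k)%N by exact: leq_trans kk (leq_addl _ _).
have [d2 E2] := half_chi_vanishes true kk1.
have kk2 : (k0 <= d2 + (d1 + k))%N by exact: leq_trans kk1 (leq_addl _ _).
have [d3 E3] := H1_chi_vanishes (d2 + (d1 + k)).
exists (d3 + (d2 + (d1 + k)))%N => l Ll.
have kl : (k0 <= l)%N by apply: leq_trans Ll; exact: leq_trans kk2 (leq_addl _ _).
split=> //.
have kk3 : (k0 <= d3 + (d2 + (d1 + k)))%N by exact: leq_trans kk2 (leq_addl _ _).
have L12 := links_trans (links_counts unital d1 kk) (links_counts unital d2 kk1).
have L13 := links_trans L12 (links_counts unital d3 kk2).
have := links_trans L13 (links_counts unital (l - (d3 + (d2 + (d1 + k)))) kk3).
rewrite subnK //; set c := conv _ _ => Lc; exists (c (false, false)).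
suff <- : c = (fun=> c (false, false)) by [].
apply/funext; apply: chi0_const => e; rewrite /c !chi_conv.
by case: e => -[] [] // _; rewrite ?E1 ?E2 ?E3 ?(mulr0, mul0r).
Qed.

Lemma size_pow2 k : (k0 <= k)%N -> exists c, N k = (2 ^ c)%N.
Proof.
move=> kk; have [x|phi phiE] := lift_starhom (ka := gs_stage S k) (bij_inj Psi_bij).
  by have [Psi' _ PsiK] := Psi_bij; exists (Psi' (gs_stage S k x)).
apply: (uhf_unital_pow2 j_unital (phi := phi)); first exact: gs_size_gt0.
apply: (bij_inj Psi_bij); rewrite phiE.
have sE : forall y, smul (gs_stage S k 1%:M) y = y.
  move=> y; have [l [z ->]] := gs_stage_surj y.
  have [z' <-] := range_mono (@gs_stage_mono R S) z (leq_maxr k l).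
  have -> : gs_stage S k 1%:M = gs_stage S (maxn k l) 1%:M.
    rewrite -(subnK (leq_maxl k l)); elim: (_ - k)%N => [//|d ->].
    rewrite -gs_stage_link; congr (gs_stage S _ _); apply: unital.
    exact: leq_trans kk (leq_addl _ _).
  by rewrite -starhomM; congr (gs_stage S _ _); exact: mul1mx.
rewrite -[RHS]sE; have [Psi' _ PsiK] := Psi_bij.
by rewrite -[X in smul X _]PsiK -starhomM uhf_mulr1.
Qed.

(** Two equal blocks of size [p] carry a copy of M_p acting in the same way on both, inside the half
    and with its unit, and [half_unital_starhom] applies. *)
Lemma block_pow2 k h : (k0 <= k)%N -> n k (blk0 h) = n k (blk1 h) ->
  exists a, n k (blk0 h) = (2 ^ a)%N.
Proof.
move=> kk eqn; set p := n k (blk0 h).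
have fQ := block_frame R (n k); have [_ QM _] := fQ.
pose b (t : bool) := if t then blk1 h else blk0 h.
have /choice[W WP] : forall t, exists W : 'M[C]_(N k, p),
    W^t* *m W = 1%:M /\ W *m W^t* = Q k (b t).
  move=> t; apply: projection_isometry; first exact: frame_projection.
  by rewrite block_proj_rank /b; case: t.
have WW s t : (W s)^t* *m W t = (s == t)%:R%:M.
  case: (eqVneq s t) => [<-|nst]; first by have [] := WP s.
  have [[X1 X2] [Y1 Y2]] := (WP s, WP t).
  rewrite -[_ *m W t]mul1mx -{1}X1 -[LHS]mulmx1 -{1}Y1 !mulmxA.
  rewrite -(mulmxA _ (W s)) X2 -(mulmxA _ (W t)) Y2 -(mulmxA _ (Q k (b s))) QM.
  have -> : b s == b t = false.
    by clear -nst; move: nst; rewrite /b; case: s t => -[] // _; rewrite ?blk01 // eq_sym blk01.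
  by rewrite scale0r mulmx0 mul0mx raddf0.
have [mu muE] := kraus_starhom WW.
have QW i t : Q k i *m W t = (i == b t)%:R *: W t.
  have [X1 X2] := WP t; rewrite -[in LHS](mulmx1 (W t)) -X1 !mulmxA -(mulmxA _ (W t)) X2 QM.
  case: eqVneq => [->|_]; last by rewrite !scale0r mul0mx.
  by rewrite !scale1r -X2 -mulmxA X1 mulmx1.
have [||xi xi1] := half_unital_starhom (h := h) (k := k) (mu := mu) kk.
- by rewrite muE kraus1 big_bool /= !(proj2 (WP _)) addrC.
- move=> x i; rewrite muE /kraus mulmx_sumr mulmx_suml; apply: eq_bigr => t _.
  have QH : (Q k i)^t* = Q k i by have [] := fQ.
  have WQ : (W t)^t* *m Q k i = (i == b t)%:R *: (W t)^t*.
    rewrite -[Q k i]QH -adjM QW; apply/matrixP => x' y'.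
    by rewrite !mxE rmorphM rmorph_nat.
  by rewrite !mulmxA QW -[RHS]mulmxA WQ -!scalemxAl -scalemxAr.
by apply: (uhf_unital_pow2 j_unital _ xi1); exact: gs_block_gt0.
Qed.

(** The size of a block is the trace of its projection; pulled back through a balanced map it is a
    sum over all labels, the same for both blocks of a half. *)
Lemma balanced_blocks k l e h : links S k l (fun=> e) -> n l (blk0 h) = n l (blk1 h).
Proof.
move=> [f [fL fE]]; have fL' := fL.
have f1 : f 1%:M = 1%:M.
  by move: fL' => [T [V [lam [_ Vc _ _ VE]]]]; rewrite VE kraus1.
have T i : \tr (Q l i) = \sum_g e%:R * \tr (Q k (act g i)) :> C.
  rewrite -[Q l i in LHS]mulmx1 -f1 (links_trace i 1%:M fL).
  by apply: eq_bigr => g _; rewrite mulmx1.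
apply/eqP; rewrite -(eqr_nat C) -!trace_block_proj !T; apply/eqP.
exact: (sum_act_blk (fun i => e%:R * \tr (Q k i))).
Qed.

(** The blocks have size [2 ^ a] in one half and [2 ^ b] in the other, and twice [2 ^ a + 2 ^ b] is
    again a power of 2; this forces [a = b]. *)
Lemma equal_blocks l k e : (k0 <= l)%N -> links S k l (fun=> e) ->
  exists a, forall i, n l i = (2 ^ a)%N.
Proof.
move=> ll kl; have eqb h := balanced_blocks h kl.
have [a aE] := block_pow2 ll (eqb false); have [b bE] := block_pow2 ll (eqb true).
have [c cE] := size_pow2 ll.
have ab : a = b.
  apply: (@pow2_add _ _ c.-1); have : (2 * (2 ^ a + 2 ^ b) = 2 ^ c)%N.
    rewrite -cE -aE -bE; have := big_blk (fun i => (n l i)%:R%:M : 'M[C]_1).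
    move=> /(congr1 (@mxtrace _ _)); rewrite !raddfD raddf_sum /= => H.
    apply/eqP; rewrite -(eqr_nat C) natr_sum.
    move: H; rewrite !mxtrace_scalar !mulr1n; under eq_bigr => i _ do rewrite mxtrace_scalar mulr1n.
    by move=> ->; rewrite -!eqb natrM !natrD; apply/eqP; ring.
  case: c {cE} => [|c]; last by rewrite expnS => /eqP; rewrite eqn_pmul2l // => /eqP.
  by rewrite expn0; have := expn_gt0 2 a; lia.
exists a => i; have := blk_half false i.
have [->|_] := eqVneq i (blk0 false); first by rewrite aE.
have [->|_] := eqVneq i (blk1 false); first by rewrite -eqb aE.
have [->|_] := eqVneq i (blk0 true); first by rewrite bE ab.
by have [->|_] := eqVneq i (blk1 true); first by rewrite -eqb bE ab.
Qed.

(** The constant [e] divides the total size [N l], a power of 2, so it is a power of 2 itself; it is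
    large because each step multiplies the size by at least 4. *)
Lemma gs_link k M : (k0 <= k)%N -> exists L, forall l, (L <= l)%N -> exists a f,
  [/\ (M <= a)%N, good (Q k) (Q l) a f & forall x, gs_stage S l (f x) = gs_stage S k x].
Proof.
(* One step beyond [M] pays for the factor 4 that goes to the labels. *)
move=> kk; have [L HL] := balanced_links kk; exists (maxn L (M.+1 + k)) => l.
rewrite geq_max => /andP[/HL[ll [e [f [fL fE]]]] lk].
have sz : N l = (4 * e * N k)%N.
  by rewrite (links_size (c := fun=> e) (ex_intro _ f (conj fL fE))) sum_lab; lia.
have sz' : N l = ((\sum_g gs_counts S k (l - k) g) * N k)%N.
  have kl : (k <= l)%N by apply: leq_trans lk; exact: leq_addl.
  by have := links_size (links_counts unital (l - k) kk); rewrite subnK.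
have e4 : (4 ^ M.+1 <= 4 * e)%N.
  rewrite -(leq_pmul2r (gs_size_gt0 S k)) -sz sz' leq_pmul2r ?gs_size_gt0 //.
  apply: leq_trans (gs_counts_ge S k (l - k)); rewrite (leq_exp2l _ _ (isT : (1 < 4)%N)).
  by move: lk; clear; lia.
have [c cE] := size_pow2 ll.
have : (e %| 2 ^ c)%N by rewrite -cE sz mulnAC dvdn_mull.
move=> /(dvdn_pfactor _ _ (isT : prime 2))[a _ eE].
exists a, f; split=> //; last by rewrite /good -eE.
rewrite -(leq_exp2l _ _ (isT : (1 < 2)%N)) -eE.
have : (4 ^ M <= e)%N by move: e4; rewrite expnS leq_pmul2l.
have -> : (4 ^ M = 2 ^ (2 * M))%N by rewrite expnM.
by apply: leq_trans; rewrite (leq_exp2l _ _ (isT : (1 < 2)%N)) leq_pmull.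
Qed.

(** The indices are shifted by [k0], from which on the connecting maps are unital. *)
Definition generic_tower : tower B :=
  @Tower R B (fun k => N (k + k0)) (fun k => Q (k + k0)) (fun k => gs_stage S (k + k0))
    (fun k => gs_size_gt0 S (k + k0))
    (fun k => let: And3 QH _ _ := block_frame R (n (k + k0)) in QH)
    (fun k => @gs_stage_inj R S (k + k0))
    (fun k M => let: ex_intro L HL := gs_link M (leq_addl k k0) in
       ex_intro _ L (fun l Ll => HL (l + k0)%N (leq_trans Ll (leq_addr k0 l)))).

Lemma generic_tower_all x : tunion generic_tower x.
Proof.
have [k [z [kk ->]]] := gs_stage_above x; exists (k - k0)%N.
by rewrite /= subnK //; exists z.
Qed.

Lemma generic_tower_diag x : tdiag generic_tower x <-> gs_diagonal S x.
Proof.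
split=> [[k [z [-> zd]]]|]; first exact/gs_diagonal_stage.
have [k [z [-> ]]] := generic_tower_all x.
by move=> /gs_diagonal_stage zd; exists k, z.
Qed.

Lemma generic_tower_ranks M : exists k a, (M <= a)%N /\
  forall i, \rank (tQ generic_tower k i) = (2 ^ a)%N.
Proof.
have [L HL] := balanced_links (leqnn k0).
have [ll [e kl]] := HL (L + (M.+1 + k0))%N (leq_addr _ _).
have [a aE] := equal_blocks ll kl; exists (L + M.+1)%N, a; split; last first.
  by move=> i; rewrite /= block_proj_rank -addnA aE.
have sz := links_size (links_counts unital (L + M.+1) (leqnn k0)).
have := gs_counts_ge S k0 (L + M.+1); set s := (\sum_g gs_counts S k0 _ g)%N in sz * => sge.
have szN : N (L + M.+1 + k0) = (2 ^ (a + 2))%N.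
  by rewrite -addnA (eq_bigr _ (fun i _ => aE i)) sum_nat_const card_ord expnD mulnC.
have : (2 ^ (2 * M.+1) <= 2 ^ (a + 2))%N.
  rewrite -szN sz; apply: leq_trans (leq_pmulr _ (gs_size_gt0 S k0)).
  by apply: leq_trans sge; rewrite expnM (leq_exp2l _ _ (isT : (1 < 4)%N)) leq_addl.
by rewrite (leq_exp2l _ _ (isT : (1 < 2)%N)); clear; lia.
Qed.

End Uniqueness.

(** * Conjugacy of two inclusions *)

Section Conjugacy.
Variable R : realType.
Variable j : forall k : nat, {starhom 'M[R[i]]_(2 ^ k) -> 'M[R[i]]_(2 ^ k.+1)}.
Hypothesis j_unital : forall k : nat, j k 1%:M = 1%:M.
Local Notation F := (starlim j).

Lemma index4_tower (S : generic_system R) (pi : {starhom F * F -> F}) :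
  index4_inclusion_of S pi -> (forall x : gs_H1 S, x = 0) ->
  exists T : tower (gs_B S), [/\ forall x, tunion T x,
    forall x, tdiag T x <-> gs_diagonal S x, forall k, frame (tQ T k)
  & forall M, exists k a, (M <= a)%N /\ forall i, \rank (tQ T k i) = (2 ^ a)%N].
Proof.
move=> [_ _ _ pi_inj [Psi [Psi_bij Psi_range]]] H1_0.
have [k0 unital] := eventually_unital j_unital Psi_bij.
exists (generic_tower j_unital pi_inj Psi_bij Psi_range unital H1_0); split.
- exact: generic_tower_all.
- exact: generic_tower_diag.
- by move=> k; exact: block_frame.
- exact: generic_tower_ranks.
Qed.

(** Equal blocks on both sides let [linked_frames] provide the first partial isomorphism; the target
    stage is taken late enough for its blocks to be at least four times larger. *)
Lemma tower_conjugacy (B1 B2 : starAlgType R) (T1 : tower B1) (T2 : tower B2) :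
  (forall x, tunion T1 x) -> (forall y, tunion T2 y) ->
  (forall k, frame (tQ T1 k)) -> (forall k, frame (tQ T2 k)) ->
  (exists k a, forall i, \rank (tQ T1 k i) = (2 ^ a)%N) ->
  (forall M, exists k a, (M <= a)%N /\ forall i, \rank (tQ T2 k i) = (2 ^ a)%N) ->
  exists Phi : {starhom B1 -> B2}, bijective Phi /\
    forall x, tdiag T1 x <-> tdiag T2 (Phi x).
Proof.
move=> all1 all2 f1 f2 [k [a r1]] /(_ (a + 2)%N)[l [b [ab r2]]].
have [|u gu] := @linked_frames R _ _ (tQ T1 k) (tQ T2 l) (2 ^ a)%N (2 ^ (b - (a + 2)))%N (f1 k) (f2 l) r1.
  by move=> i; rewrite r2 -{1}(subnKC ab) !expnD; lia.
have [Phi [Pi Pr Pd]] := tower_iso (PartialIso gu) all1.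
exists Phi; split=> //.
have /choice[g gK] : forall y, exists x, Phi x = y by move=> y; apply/Pr.
by exists g => [x|//]; apply: Pi; rewrite gK.
Qed.

(** The automorphism is [Phi] read through [Psi1] and [Psi2]; as [Phi] preserves and reflects the
    diagonal, it matches the two ranges. *)
Lemma H1_zero_same_position (pi1 pi2 : {starhom F * F -> F}) :
  H1_zero pi1 -> H1_zero pi2 -> same_position pi1 pi2.
Proof.
move=> [S1 [i1 H1]] [S2 [i2 H2]].
have [T1 [all1 d1 f1 r1]] := index4_tower i1 H1.
have [T2 [all2 d2 f2 r2]] := index4_tower i2 H2.
have [|Phi [Phib Phid]] := tower_conjugacy all1 all2 f1 f2 _ r2.
  by have [k [a [_ ra]]] := r1 0%N; exists k, a.
have [_ _ _ _ [Psi1 [b1 e1]]] := i1; have [_ _ _ _ [Psi2 [b2 e2]]] := i2.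
have [G GE] := starhom_comp Phi Psi1.
have [Psi2' Psi2K Psi2'K] := b2.
have [x|sigma sE] := lift_starhom (ka := G) (bij_inj b2).
  by exists (Psi2' (G x)).
have mem (i : {starhom F * F -> F}) (Q : generic_system R) (P : {starhom F -> gs_B Q}) x :
    bijective P -> (P @` range i)%classic = gs_diagonal Q ->
    range i x <-> gs_diagonal Q (P x).
  move=> Pb <-; split=> [ix|[y iy /(bij_inj Pb)<-]]; last by [].
  by exists x.
exists sigma; split.
  have [Phi' PhiK Phi'K] := Phib; have [Psi1' Psi1K Psi1'K] := b1.
  exists (fun x => Psi1' (Phi' (Psi2 x))) => x.
    by rewrite sE GE PhiK Psi1K.
  by apply: (bij_inj b2); rewrite sE GE Psi1'K Phi'K.
apply/seteqP; split=> [_ [x /(mem _ _ _ _ b1 e1) dx <-]|y /(mem _ _ _ _ b2 e2) dy].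
  by apply/(mem _ _ _ _ b2 e2); rewrite sE GE; apply/d2/Phid/d1.
have [Phi' PhiK Phi'K] := Phib; have [Psi1' Psi1K Psi1'K] := b1.
exists (Psi1' (Phi' (Psi2 y))).
  by apply/(mem _ _ _ _ b1 e1); rewrite Psi1'K; apply/d1/Phid; rewrite Phi'K; apply/d2.
by apply: (bij_inj b2); rewrite sE GE Psi1'K Phi'K.
Qed.

End Conjugacy.

(** * Existence *)

Section RigidOfKraus.
Variable R : realType.
Local Notation C := R[i].
Variables n n' : 'I_4 -> nat.
Local Notation N := (\sum_i n i)%N.
Local Notation N' := (\sum_i n' i)%N.
Local Notation Q := (@block_proj_mx R n).
Local Notation Q' := (@block_proj_mx R n').

Lemma cyc_pred_block (m : 'I_4 -> nat) (x : 'M[C]_(\sum_i m i)) :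
  x \in cyc_pred (R := R) (n := m) <->
  forall i k, ~~ cyc_pos i k -> @block_proj_mx R m i *m x *m @block_proj_mx R m k = 0.
Proof.
split=> [/cyc_predE xP i k nik|xP]; last first.
  apply/cyc_predE => a b /xP/matrixP/(_ a b).
  by rewrite mulmx_block_proj mul_block_proj !eqxx mul1r mulr1 mxE.
apply/matrixP => a b; rewrite mulmx_block_proj mul_block_proj mxE.
case: eqVneq => [ai|_]; last by rewrite !mul0r.
case: eqVneq => [bk|_]; last by rewrite mulr0.
by rewrite xP ?mulr0 ?mul0r // ai bk.
Qed.

Lemma cyc_pos_act g i k : cyc_pos (act g i) (act g k) = cyc_pos i k.
Proof. by rewrite /cyc_pos (inj_eq perm_inj) ![(2 <= _)%N]leqNgt !act_half. Qed.

Section OneSummand.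
Variables (V : 'M[C]_(N', N)) (g : lab).
Hypotheses (V1 : V^t* *m V = 1%:M) (Vg : graded Q Q' g V).

Lemma conj_graded i k x :
  Q' i *m (V *m x *m V^t*) *m Q' k = V *m (Q (act g i) *m x *m Q (act g k)) *m V^t*.
Proof.
have [[QH _ _] [QH' _ _]] := (block_frame R n, block_frame R n').
rewrite -!mulmxA (graded_adj QH QH' Vg) !mulmxA.
by rewrite -[in X in X *m V](act_inv g i) -Vg.
Qed.

Fact conj_cyc_pred (a : four_cycle R n) : V *m cyc_val a *m V^t* \in cyc_pred (R := R) (n := n').
Proof.
apply/cyc_pred_block => i k nik; rewrite conj_graded.
have /cyc_pred_block -> := cyc_valP a; first by rewrite mulmx0 mul0mx.
by rewrite cyc_pos_act.
Qed.

Definition conj_cyc (a : four_cycle R n) : four_cycle R n' := FourCycle (conj_cyc_pred a).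

Lemma cyc_val_inj (m : 'I_4 -> nat) : injective (@cyc_val R m).
Proof. exact: val_inj. Qed.

Lemma conj_rigid_one : rigid_one (act g) conj_cyc.
Proof.
have compress x : V^t* *m (V *m x *m V^t*) *m V = x.
  by rewrite !mulmxA V1 mul1mx -mulmxA V1 mulmx1.
split.
- split.
  + move=> a b /(congr1 (@cyc_val _ _)) /= E; apply: cyc_val_inj.
    by rewrite -(compress (cyc_val a)) E compress.
  + move=> c a b; apply: cyc_val_inj => /=.
    by rewrite mulmxDr mulmxDl -scalemxAr -scalemxAl.
  + move=> a b; apply: cyc_val_inj; rewrite [RHS]cyc_valM.
    change (V *m (cyc_val a *m cyc_val b) *m V^t* =
      (V *m cyc_val a *m V^t*) *m (V *m cyc_val b *m V^t*)).
    by rewrite !mulmxA -(mulmxA _ (V^t*) V) V1 mulmx1.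
- have Vi : isometric (fun _ : 'I_1 => V) by move=> s t; rewrite !ord1 eqxx.
  have [Phi PhiE] := kraus_starhom Vi.
  have {}PhiE x : Phi x = V *m x *m V^t* by rewrite PhiE /kraus big_ord1.
  exists Phi; split=> [a|p pp pH rp]; first by rewrite PhiE.
  apply/eqP; rewrite -(eqr_nat C) -projection_rank; last first.
    by split; rewrite -?(mxhomM Phi) -?(mxhomS Phi) ?pp ?pH.
  rewrite PhiE mxtrace_mulC mulmxA V1 mul1mx projection_rank ?rp //; split=> //.
- exact: act_half.
- move=> i k a; exists (conj_cyc (block_proj R n i * a * block_proj R n k)).
  apply: cyc_val_inj; set x := Q i *m cyc_val a *m Q k.
  change (V *m x *m V^t* = Q' (act g i) *m (V *m x *m V^t*) *m Q' (act g k)).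
  rewrite conj_graded !act_inv /x; have [_ QM _] := block_frame R n.
  suff -> : Q i *m (Q i *m cyc_val a *m Q k) *m Q k = Q i *m cyc_val a *m Q k by [].
  by rewrite !mulmxA QM eqxx scale1r -(mulmxA _ (Q k) (Q k)) QM eqxx scale1r.
Qed.

End OneSummand.

(** The converse of [rigid_kraus], by which systems are built from isometries. *)
Lemma rigid_of_kraus d (V : 'I_d -> 'M[C]_(N', N)) lam : (0 < d)%N ->
  isometric V -> (forall s, graded Q Q' (lam s) (V s)) ->
  exists (phi : rigid_embedding R n n') (Phi : {starhom 'M[C]_N -> 'M[C]_N'}),
    [/\ star_extension (rig_map phi) Phi, Phi =1 kraus V
      & forall g, #|summands_of_type phi (act g)| = fibre lam g].
Proof.
move=> d0 Vi Vg; have [Phi PhiE] := kraus_starhom Vi.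
have V1 s : (V s)^t* *m V s = 1%:M by rewrite Vi eqxx.
have orth s t : s != t -> forall a b, conj_cyc (Vg s) a * conj_cyc (Vg t) b = 0.
  move=> nst a b; apply: cyc_val_inj; rewrite cyc_valM /=.
  by rewrite !mulmxA -(mulmxA _ ((V s)^t*) (V t)) Vi (negPf nst) raddf0 mulmx0 !mul0mx.
pose phi := @RigidEmbedding R n n' d (fun s => act (lam s))
  (fun s => conj_cyc (Vg s)) d0 (fun s => conj_rigid_one (V1 s) (Vg s)) orth.
exists phi, Phi; split=> // [a|g].
  rewrite PhiE /rig_map /= (big_morph (@cyc_val R n') (id1 := 0) (op1 := +%R)) //.
by rewrite /summands_of_type /fibre; apply: eq_card => s; rewrite !inE (inj_eq act_inj).
Qed.

End RigidOfKraus.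

Section FourAdic.
Variable R : realType.
Local Notation C := R[i].
Local Notation N k := (\sum_(i < 4) 4 ^ k)%N.
Local Notation Q k := (@block_proj_mx R (fun=> 4 ^ k)%N).

(** [linked_frames] with [e] equal to 1 gives exactly one isometry for each label. *)
Lemma four_adic_step k : exists (phi : rigid_embedding R (fun=> 4 ^ k)%N (fun=> 4 ^ k.+1)%N)
    (Phi : {starhom 'M[C]_(N k) -> 'M[C]_(N k.+1)}),
  [/\ star_extension (rig_map phi) Phi, Phi 1%:M = 1%:M
    & forall g, #|summands_of_type phi (act g)| = 1%N].
Proof.
have [|i|u [T [V [lam [Vi Vc Vg Vf _]]]]] := @linked_frames R _ _ (Q k) (Q k.+1) (4 ^ k)%N 1
  (block_frame _ _) (block_frame _ _).
- by move=> i; rewrite block_proj_rank.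
- by rewrite block_proj_rank muln1 expnS.
have Ve : isometric (fun s : 'I_#|T| => V (enum_val s)).
  by move=> s t; rewrite Vi (inj_eq enum_val_inj).
have T0 : (0 < #|T|)%N by rewrite (card_fibre_const Vf).
have [phi [Phi [PhiX PhiE cE]]] := rigid_of_kraus T0 Ve (fun s => Vg (enum_val s)).
exists phi, Phi; split=> // [|g].
  rewrite PhiE kraus1 -Vc [RHS](reindex (@enum_val T T)) //=.
  exact: onW_bij (enum_val_bij T).
rewrite cE -(Vf g) !fibre_sum [RHS](reindex (@enum_val T T)) //=.
exact: onW_bij (enum_val_bij T).
Qed.

Lemma four_adic_exists : exists S : generic_system R, four_adic_system S.
Proof.
pose P k := cid (four_adic_step k); pose phi k := projT1 (P k).
pose PP k := cid (projT2 (P k)); pose Phi k := projT1 (PP k).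
have PhiP k : [/\ star_extension (rig_map (phi k)) (Phi k), Phi k 1%:M = 1%:M
    & forall g, #|summands_of_type (phi k) (act g)| = 1%N] := projT2 (PP k).
have gen k : generic (phi k).
  by move=> theta /act_surj[g ->]; have [_ _ ->] := PhiP k.
have ext k : star_extension (rig_map (phi k)) (Phi k) by have [] := PhiP k.
exists (@GenericSystem R (fun k _ => 4 ^ k)%N (fun k _ => expn_gt0 4 k) phi gen Phi ext).
split=> //= k; last by move=> theta /act_surj[g ->]; have [_ _ ->] := PhiP k.
by apply: cyc_val_inj; rewrite -(ext k) cyc_val1; have [_ -> _] := PhiP k.
Qed.

End FourAdic.

(** * Factoring a half of the diagonal through a full matrix algebra *)

Section Expand.
Variables (R : realType) (m n : nat).
Implicit Types A B D E : 'M[R[i]]_(m, n).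

Lemma adj_mul_add A B D E : (A + B)^t* *m (D + E) =
  A^t* *m D + A^t* *m E + (B^t* *m D + B^t* *m E).
Proof. by rewrite adjD mulmxDl !mulmxDr. Qed.

Lemma sandwich_add A B x : (A + B) *m x *m (A + B)^t* =
  A *m x *m A^t* + A *m x *m B^t* + (B *m x *m A^t* + B *m x *m B^t*).
Proof. by rewrite adjD !mulmxDl !mulmxDr. Qed.

End Expand.

Section HalfLabels.
Variable h : bool.

(** [s] tells whether the label exchanges the blocks of the half [h]; [o] is its action on the other
    half. *)
Definition half_lab s o : lab := if h then (o, s) else (s, o).
Definition half_blk t := if t then blk1 h else blk0 h.
Local Notation lb := half_lab.
Local Notation b := half_blk.

Lemma half_lab_eq s o s' o' : (lb s o == lb s' o') = (s == s') && (o == o').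
Proof. by rewrite /lb; case: h; rewrite xpair_eqE // andbC. Qed.

Lemma act_half_lab s o t : act (lb s o) (b t) = b (s (+) t).
Proof.
by rewrite /b /lb; case: t; rewrite ?act_blk0 ?act_blk1 /swaps; case: h; case: s.
Qed.

Lemma half_blk_eq t t' : (b t == b t') = (t == t').
Proof. by rewrite /b; case: t t' => [] []; rewrite ?eqxx ?blk01 // eq_sym blk01. Qed.

Lemma half_blkE : (blk0 h = b false) * (blk1 h = b true).
Proof. by []. Qed.

Lemma sum_half_lab (V : nmodType) (f : lab -> V) :
  \sum_o f (lb false o) + \sum_o f (lb true o) = \sum_g f g.
Proof.
rewrite (@sum_pair _ _ _ bool bool) !big_bool /lb; case: (h) => /=; last exact: addrC.
by rewrite [LHS]addrACA; congr (_ + _); exact: addrC.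
Qed.

End HalfLabels.

#[global] Opaque half_lab half_blk.

Section HalfChain.
Variables (R : realType) (m n p : nat).
Local Notation C := R[i].
Variables (Q : 'I_4 -> 'M[C]_n) (Q' : 'I_4 -> 'M[C]_m) (V : lab -> 'M[C]_(m, n)).
Variables (h : bool) (W : 'M[C]_(n, p)).
Hypotheses (fQ : frame Q) (fQ' : frame Q') (Vi : isometric V).
Hypothesis Vg : forall g, graded Q Q' g (V g).
Hypotheses (W1 : W^t* *m W = 1%:M) (W2 : W *m W^t* = half Q h).

Local Notation lb := (half_lab h).
Local Notation b := (half_blk h).

Lemma half_b t : half Q h = Q (b t) + Q (b (~~ t)).
Proof. by rewrite /half !half_blkE; case: t => /=; first rewrite addrC. Qed.

(* Block b t of the target receives b t through the labels that fix the blocks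
   of the half h and the other block through those that exchange them. *)
Definition half_iso (u : bool * bool) : 'M[C]_(m, n) :=
  V (lb false u.2) *m Q (b u.1) + V (lb true u.2) *m Q (b (~~ u.1)).

Lemma half_isoE u : half_iso u = Q' (b u.1) *m (V (lb false u.2) + V (lb true u.2)).
Proof. by rewrite /half_iso !Vg !act_half_lab /= negbK mulmxDr. Qed.

(** The target block [u.1] and the label bit [u.2] separate the ranges; the two terms of one map
    start from the two different blocks of the half. *)
Lemma half_iso_isometric u v :
  (half_iso u)^t* *m half_iso v = (u == v)%:R *: half Q h.
Proof.
have [QH QM _] := fQ; case: u v => [t o] [t' o'].
have VV s s' : V (lb s o)^t* *m V (lb s' o') = ((s == s') && (o == o'))%:R%:M.
  by rewrite Vi half_lab_eq.
have T s s' r r' : (V (lb s o) *m Q (b r))^t* *m (V (lb s' o') *m Q (b r')) =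
    ((s == s') && (o == o') && (r == r'))%:R *: Q (b r).
  rewrite adjM QH mulmxA -(mulmxA _ ((V (lb s o))^t*)) VV mul_mx_scalar -scalemxAl QM half_blk_eq.
  by rewrite scalerA -natrM mulnb.
rewrite [LHS]adj_mul_add.
rewrite [LHS](congr2 +%R (congr2 +%R (T _ _ _ _) (T _ _ _ _)) (congr2 +%R (T _ _ _ _) (T _ _ _ _))).
rewrite /= !scale0r add0r addr0.
rewrite (inj_eq negb_inj) -scalerDr (half_b t) xpair_eqE.
by rewrite andbC.
Qed.

Definition corner_iso u := half_iso u *m W.

Lemma corner_isometric : isometric corner_iso.
Proof.
move=> u v; rewrite /corner_iso adjM mulmxA -(mulmxA _ _ (half_iso v)).
rewrite half_iso_isometric -W2 -scalemxAr -scalemxAl !mulmxA W1 mul1mx W1.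
by rewrite scalemx1.
Qed.

Lemma corner_block i u : Q' i *m corner_iso u = (i == b u.1)%:R *: corner_iso u.
Proof.
have [_ QM' _] := fQ'; rewrite /corner_iso half_isoE !mulmxA QM'.
by case: eqVneq => [->|_]; rewrite ?scale1r // !scale0r !mul0mx.
Qed.

Lemma corner_diag y i : Q' i *m kraus corner_iso y = kraus corner_iso y *m Q' i.
Proof.
have [QH' _ _] := fQ'; rewrite /kraus mulmx_sumr mulmx_suml; apply: eq_bigr => u _.
have YQ : (corner_iso u)^t* *m Q' i = (i == b u.1)%:R *: (corner_iso u)^t*.
  rewrite -[Q' i]QH' -adjM corner_block; apply/matrixP => a c.
  by rewrite !mxE rmorphM rmorph_nat.
move: (corner_iso u) (corner_block i u) YQ => Y QY YQ.
by rewrite !mulmxA QY -[RHS]mulmxA YQ -!scalemxAl -scalemxAr.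
Qed.

Lemma corner_half y : half Q' h *m kraus corner_iso y = kraus corner_iso y.
Proof.
have hY u : half Q' h *m corner_iso u = corner_iso u.
  rewrite /half mulmxDl !corner_block.
  by rewrite !half_blkE !half_blk_eq; case: u => [[] o]; rewrite /= scale0r scale1r ?addr0 ?add0r.
rewrite /kraus mulmx_sumr; apply: eq_bigr => u _.
by move: (corner_iso u) (hY u) => Y E; rewrite !mulmxA E.
Qed.

(** The cross terms of [corner_iso] contain [Q (b t) *m x *m Q (b t')] with distinct blocks, which
    vanishes for block diagonal [x]; what remains is [kraus V x]. *)
Lemma corner_kraus x : (forall i, Q i *m x = x *m Q i) -> half Q h *m x = x ->
  kraus corner_iso (W^t* *m x *m W) = kraus V x.
Proof.
move=> xQ hx; have [QH QM _] := fQ.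
have xh : x *m half Q h = x by rewrite -[RHS]hx mulmxDl mulmxDr !xQ.
have QxQ t t' : Q (b t) *m x *m Q (b t') = (t == t')%:R *: (x *m Q (b t)).
  by rewrite xQ -mulmxA QM half_blk_eq -scalemxAr.
have T u : corner_iso u *m (W^t* *m x *m W) *m (corner_iso u)^t* =
    V (lb false u.2) *m (x *m Q (b u.1)) *m (V (lb false u.2))^t* +
    V (lb true u.2) *m (x *m Q (b (~~ u.1))) *m (V (lb true u.2))^t*.
  have -> : corner_iso u *m (W^t* *m x *m W) *m (corner_iso u)^t* =
      half_iso u *m (half Q h *m x *m half Q h) *m (half_iso u)^t*.
    by rewrite /corner_iso adjM -W2 !mulmxA.
  have E s s' t t' : V (lb s u.2) *m Q (b t) *m x *m (V (lb s' u.2) *m Q (b t'))^t* =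
      (t == t')%:R *: (V (lb s u.2) *m (x *m Q (b t)) *m (V (lb s' u.2))^t*).
    rewrite scalemxAl scalemxAr -QxQ adjM QH.
    by rewrite !mulmxA.
  rewrite hx xh [LHS]sandwich_add.
  rewrite [LHS](congr2 +%R (congr2 +%R (E _ _ _ _) (E _ _ _ _)) (congr2 +%R (E _ _ _ _) (E _ _ _ _))).
  rewrite !eqxx !scale1r.
  by case: (u.1); rewrite !scale0r add0r addr0.
(* For fixed [s] and [o], the two target blocks together receive both source blocks, which add up to
   the half. *)
have S s : \sum_t \sum_o V (lb s o) *m (x *m Q (b (s (+) t))) *m (V (lb s o))^t* =
    \sum_o V (lb s o) *m x *m (V (lb s o))^t*.
  rewrite exchange_big /=; apply: eq_bigr => o _.
  rewrite -mulmx_suml -mulmx_sumr -mulmx_sumr big_bool /=.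
  by rewrite addbT addbF addrC -[in RHS]xh (half_b s).
rewrite /kraus (eq_bigr _ (fun u _ => T u)) big_split /=.
rewrite (@sum_pair _ _ _ bool bool) [X in _ + X](@sum_pair _ _ _ bool bool).
rewrite [LHS](congr2 +%R (S false) (S true)).
exact: (sum_half_lab h (fun g => V g *m x *m (V g)^t*)).
Qed.

End HalfChain.

Section Existence.
Variables (R : realType) (S : generic_system R).
Hypothesis S4 : four_adic_system S.
Local Notation C := R[i].
Local Notation n := (gs_block S).
Local Notation N k := (\sum_i gs_block S k i)%N.
Local Notation Q k := (@block_proj_mx R (gs_block S k)).
Local Notation B := (gs_B S).

Lemma four_adic_unital k : (0 <= k)%N -> gs_ext S k 1%:M = 1%:M.
Proof.
move=> _; have [_ u _] := S4.
by have := @gs_extP R S k 1; rewrite cyc_val1 u.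
Qed.

Lemma four_adic_H1 (x : gs_H1 S) : x = 0.
Proof.
elim/quotW: x => t; apply/dirlim_eqP; have [M tM] := threadP t.
have H0 k : H1_mult (gs_map S k) = 0.
  have [_ _ c1] := S4; rewrite -chi_gs_count chiE /gs_count !c1; try exact: act_half.
  by [].
by exists M.+1 => -[//|k]; rewrite ltnS => /tM ->; rewrite /= [X in X * _]H0 mul0r.
Qed.

Lemma four_adic_kraus k : exists V : lab -> 'M[C]_(N k.+1, N k),
  [/\ isometric V, forall g, graded (Q k) (Q k.+1) g (V g) & gs_ext S k =1 kraus V].
Proof.
have [V [lam [Vi Vg Vf E]]] := gs_kraus S k.
have [|tau [tb tl]] := @fibre_bij lab _ id lam.
  move=> g; rewrite Vf /gs_count; have [_ _ ->] := S4; last exact: act_half.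
  by rewrite /fibre -(cards1 g); apply: eq_card => h; rewrite !inE.
exists (fun g => V (tau g)); split.
- by move=> g g'; rewrite Vi (inj_eq (bij_inj tb)).
- by move=> g; rewrite -{1}(tl g); exact: Vg.
- by move=> x; rewrite E /kraus (reindex tau) //; exact: onW_bij.
Qed.

(** A full matrix algebra interleaved between the halves of the diagonal at stages [k] and [k.+1];
    [2 * 4 ^ k] is the size of a half at stage [k]. *)
Definition half_stage k h (H : {starhom 'M[C]_(2 * 4 ^ k) -> B}) :=
  [/\ injective H,
      forall x, block_diagonal x -> half (Q k) h *m x = x ->
        exists y, H y = gs_stage S k x,
      forall y, exists x, [/\ block_diagonal x, half (Q k.+1) h *m x = x
                            & H y = gs_stage S k.+1 x]
    & H 1%:M = gs_half S 0 h].

Lemma four_adic_half k h : exists H, @half_stage k h H.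
Proof.
have [V [Vi Vg VE]] := four_adic_kraus k.
have [fQ fQ'] := (block_frame R (n k), block_frame R (n k.+1)).
have [blocks _ _] := S4.
have hP : projection (half (Q k) h).
  split; first exact: half_mul.
  by rewrite adjD; have [QH _ _] := fQ; rewrite !QH.
have [|W [W1 W2]] := projection_isometry (r := (2 * 4 ^ k)%N) hP.
  apply/eqP; rewrite -(eqr_nat C) -projection_rank // half_trace !blocks.
  by rewrite addnn mul2n.
have Yi := corner_isometric fQ Vi W1 W2.
have [G GE] := kraus_starhom Yi.
have [H HE] := starhom_comp (gs_stage S k.+1) G.
have Hc x : block_diagonal x -> half (Q k) h *m x = x ->
    H (W^t* *m x *m W) = gs_stage S k x.
  move=> xd hx; rewrite HE GE (corner_kraus V fQ W2 xd hx) -VE.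
  exact: gs_stage_link.
exists H; split.
- move=> y y'; rewrite !HE => /(@gs_stage_inj R S k.+1); rewrite !GE.
  by apply: (kraus_inj Yi); rewrite card_prod card_bool.
- by move=> x xd hx; exists (W^t* *m x *m W); exact: Hc.
- move=> y; exists (G y); split; rewrite ?HE //.
    by move=> i; rewrite GE; exact: (corner_diag h W fQ' Vg).
  by rewrite GE; exact: (corner_half h W fQ' Vg).
- rewrite -(gs_halfE four_adic_unital h (leq0n k)) -Hc; last exact: half_mul.
    by rewrite -W2 !mulmxA W1 mul1mx W1.
  by move=> i; exact: half_diag.
Qed.

Section Target.
Variable j : forall k : nat, {starhom 'M[C]_(2 ^ k) -> 'M[C]_(2 ^ k.+1)}.
Hypothesis j_unital : forall k : nat, j k 1%:M = 1%:M.
Local Notation F := (starlim j).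

(** Stage [k] has four blocks of size [4 ^ k], whence the exponent [2 * k + 2]. *)
Lemma four_adic_whole : exists Psi : {starhom F -> B}, bijective Psi.
Proof.
have [blocks _ _] := S4.
have [||||| Psi [Pi Pr]] := uhf_recognition j_unital (n := fun k => N k)
  (c := fun k => (2 * k + 2)%N) (h := gs_stage S).
- exact: (@gs_stage_inj R S).
- exact: (@gs_stage_mono R S).
- by move=> k; rewrite -[RHS]gs_stage_link four_adic_unital.
- move=> k; rewrite (eq_bigr _ (fun i _ => blocks k i)) sum_nat_const card_ord.
  by rewrite expnD expnM mulnC.
- by move=> M; exists M => k; lia.
exists Psi; have /choice[g gK] : forall y, exists x, Psi x = y.
  by move=> y; apply/Pr; exact: gs_stage_surj.
by exists g => [x|//]; apply: Pi; rewrite gK.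
Qed.

(** By interleaving, the full matrix algebras of [half_stage] form an increasing chain whose union
    is the half of the diagonal. *)
Lemma four_adic_corner h : exists psi : {starhom F -> B}, injective psi /\
  forall y, (gs_diagonal S y /\ smul (gs_half S 0 h) y = y) <-> exists x, psi x = y.
Proof.
pose P k := cid (four_adic_half k h); pose H k := projT1 (P k).
have HP k : half_stage h (H k) := projT2 (P k).
have [||||| psi [psii psir]] := uhf_recognition j_unital (n := fun k => (2 * 4 ^ k)%N)
  (c := fun k => (2 * k).+1%N) (h := H).
- by move=> k; have [] := HP k.
- move=> k y; have [_ _ /(_ y)[x [xd hx ->]] _] := HP k.
  by have [_ /(_ x xd hx) ? _ _] := HP k.+1.
- by move=> k; have [_ _ _ ->] := HP k.+1; have [_ _ _ ->] := HP k.
- by move=> k; rewrite expnS expnM.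
- by move=> M; exists M => k; lia.
exists psi; split=> // y; split=> [[yd hy]|].
  apply/psir; have [k [z yE]] := gs_stage_surj y.
  have zd : block_diagonal z by apply/gs_diagonal_stage; rewrite -yE.
  have hz : half (Q k) h *m z = z.
    apply: (@gs_stage_inj R S k); rewrite -yE -[RHS]hy.
    by rewrite -(gs_halfE four_adic_unital h (leq0n k)) yE -starhomM.
  have [_ /(_ z zd hz)[y' y'E] _ _] := HP k.
  by exists k, y'; rewrite y'E.
move/psir => [k [z ->]]; have [_ _ /(_ z)[x [xd hx ->]] _] := HP k.
split; first exact/gs_diagonal_stage.
by rewrite -(gs_halfE four_adic_unital h (leq0n k.+1)) -starhomM [smul _ _]hx.
Qed.

Lemma gs_half_sum y : smul (gs_half S 0 false) y + smul (gs_half S 0 true) y = y.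
Proof.
have [k [z ->]] := gs_stage_surj y.
rewrite -!(gs_halfE four_adic_unital _ (leq0n k)) -smulDl -linearD -starhomM.
by rewrite (half_sum (block_frame R _)); congr (gs_stage S k _); exact: mul1mx.
Qed.

Lemma gs_diagonalD y y' : gs_diagonal S y -> gs_diagonal S y' -> gs_diagonal S (y + y').
Proof.
have [k [z ->]] := gs_stage_surj y; have [l [z' [kl ->]]] := gs_stage_above k y'.
have [z1 <-] := range_mono (@gs_stage_mono R S) z kl.
move=> /gs_diagonal_stage zd /gs_diagonal_stage zd'.
rewrite -linearD; apply/gs_diagonal_stage => i.
by rewrite mulmxDr mulmxDl zd zd'.
Qed.

Lemma gs_diagonal_half h y : gs_diagonal S y -> gs_diagonal S (smul (gs_half S 0 h) y).
Proof.
have [k [z ->]] := gs_stage_surj y => /gs_diagonal_stage zd.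
rewrite -(gs_halfE four_adic_unital _ (leq0n k)) -starhomM.
apply/gs_diagonal_stage => i; rewrite [smul _ _]/(_ *m _).
by rewrite mulmxA (half_diag (block_frame R _)) -mulmxA zd mulmxA.
Qed.

Lemma matroid_uhf : matroid F.
Proof.
exists (fun k => 2 ^ k)%N, (uhf_stage j); split=> [k|k|k _ [x _ <-]|x].
- by rewrite expn_gt0.
- exact: uhf_stage_injective.
- by have [y yE] := @uhf_stage_mono R j k x; exists y.
- by have [k [z ->]] := uhf_surj x; exists k, z.
Qed.

(** The diagonal is the orthogonal sum of its two halves, each a copy of [F]; the sum of the two
    embeddings is pulled back along the isomorphism of [F] with [B]. *)
Lemma four_adic_inclusion : exists zeta : {starhom F * F -> F}, index4_inclusion_of S zeta.
Proof.
have [Psi Psib] := four_adic_whole; have [Psi' PsiK Psi'K] := Psib.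
have [p0 [p0i p0r]] := four_adic_corner false.
have [p1 [p1i p1r]] := four_adic_corner true.
have comm := gs_half_comm four_adic_unital.
have p0P x : gs_diagonal S (p0 x) /\ smul (gs_half S 0 false) (p0 x) = p0 x.
  by apply/p0r; exists x.
have p1P x : gs_diagonal S (p1 x) /\ smul (gs_half S 0 true) (p1 x) = p1 x.
  by apply/p1r; exists x.
have e0p1 x : smul (gs_half S 0 false) (p1 x) = 0.
  by rewrite -(p1P x).2 smulA (gs_half_orth S 0 false) smul0l.
have e1p0 x : smul (gs_half S 0 true) (p0 x) = 0.
  by rewrite -(p0P x).2 smulA (gs_half_orth S 0 true) smul0l.
have p01 x y : smul (p0 x) (p1 y) = 0.
  by rewrite -(p0P x).2 (comm _ _ (p0P x).1) -smulA e0p1 smul0r.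
have p10 x y : smul (p1 x) (p0 y) = 0.
  by rewrite -(p1P x).2 (comm _ _ (p1P x).1) -smulA e1p0 smul0r.
have [G GE] : exists G : {starhom F * F -> B}, forall w, G w = p0 w.1 + p1 w.2.
  apply: starhom_of => [c x y|x y|x] /=.
  - by rewrite !linearP /= scalerDr addrACA.
  - by rewrite !starhomM smulDl !smulDr p01 p10 addr0 add0r.
  - by rewrite !starhomS starD.
have [w|zeta zE] := lift_starhom (ka := G) (bij_inj Psib).
  by exists (Psi' (G w)).
exists zeta; split; try exact: matroid_uhf.
  have e0 x y : smul (gs_half S 0 false) (p0 x + p1 y) = p0 x.
    by rewrite smulDr (p0P x).2 e0p1 addr0.
  have e1 x y : smul (gs_half S 0 true) (p0 x + p1 y) = p1 y.
    by rewrite smulDr (p1P y).2 e1p0 add0r.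
  move=> w w' /(congr1 Psi); rewrite !zE !GE => E; apply: injective_projections.
    by apply: p0i; rewrite -(e0 w.1 w.2) E e0.
  by apply: p1i; rewrite -(e1 w.1 w.2) E e1.
exists Psi; split=> //; apply/seteqP; split=> [_ [_ [w _ <-] <-]|y yd].
  by rewrite zE GE; apply: gs_diagonalD; [exact: (p0P _).1 | exact: (p1P _).1].
have ee h : smul (gs_half S 0 h) (smul (gs_half S 0 h) y) = smul (gs_half S 0 h) y.
  by rewrite (smulA (gs_half S 0 h) (gs_half S 0 h) y) gs_half_mul.
have [x0 x0E] : exists x, p0 x = smul (gs_half S 0 false) y.
  by apply/p0r; split; [exact: gs_diagonal_half | exact: ee].
have [x1 x1E] : exists x, p1 x = smul (gs_half S 0 true) y.
  by apply/p1r; split; [exact: gs_diagonal_half | exact: ee].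
exists (zeta (x0, x1)); first by exists (x0, x1).
by rewrite zE GE /= x0E x1E gs_half_sum.
Qed.

End Target.
End Existence.

(* F is the limit of the M_(2^k) along arbitrary unital embeddings j_k. *)
Theorem theorem4p4 (R : realType)
    (j : forall k : nat, {starhom 'M[R[i]]_(2 ^ k) -> 'M[R[i]]_(2 ^ k.+1)})
    (j_unital : forall k : nat, j k 1%:M = 1%:M) :
  let F : starAlgType R := starlim j in
  (exists (zeta : {starhom F * F -> F}) (S : generic_system R),
     [/\ index4_inclusion_of S zeta,
         four_adic_system S
       & forall x : gs_H1 S, x = 0]) /\
  (forall pi1 pi2 : {starhom F * F -> F},
     generic_index4_inclusion pi1 -> H1_zero pi1 ->
     generic_index4_inclusion pi2 -> H1_zero pi2 ->
     same_position pi1 pi2).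
Proof.
split=> [|pi1 pi2 _ z1 _ z2]; last exact: H1_zero_same_position.
have [S S4] := four_adic_exists R.
have [zeta zP] := four_adic_inclusion S4 j_unital.
by exists zeta, S; split=> //; exact: four_adic_H1.
Qed.
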